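(* In the rapidly switching Markov modulated model for $n$ obligors described in the context (processes $X^\alpha$, $N^\alpha$, filtrations $(\mathcal F^\alpha_t)$, $\alpha>0$), let $\lambda_\infty=\lambda^\top\pi$ and let $N$ be a counting process with $N_0=0$ and $\mathrm dN_t=\lambda_\infty(n-N_t)\,\mathrm dt+\mathrm dm_t$, with $m$ a martingale with respect to the filtration generated by $N$. For $0\le s<t$ and $0\le i\le n$ put $\zeta^{\alpha,i}_{t|s}=\mathbb E[\mathbf 1_{\{N^\alpha_t=i\}}X^\alpha_t\mid\mathcal F^\alpha_s]$, and for $0\le i,j\le n$ put $g_{ij}(r)=0$ if $i<j$ and $$g_{ij}(r)=\binom{n-j}{n-i}\exp(-(n-i)\lambda_\infty r)\,(1-\exp(-\lambda_\infty r))^{i-j}\quad\text{if } i\ge j .$$ (a) For all $0\le s<t$ and $0\le i\le n$, in the limit $\alpha\to\infty$ the conditional probabilities are given by $g_{i,N_s}(t-s)\,\pi$; that is, $$\big\|\zeta^{\alpha,i}_{t|s}-g_{i,N^\alpha_s}(t-s)\,\pi\big\|_{L^\infty}\to0\qquad(\alpha\to\infty).$$ (b) It follows that, in the limit $\alpha\to\infty$, conditionally on the past up to time $s$ the increment over $(s,t]$ has a binomial distribution: $\big\|\mathbb P(N^\alpha_t=i\mid\mathcal F^\alpha_s)-g_{i,N^\alpha_s}(t-s)\big\|_{L^\infty}\to0$ for all $i$, and, given $N_u$ for $u\le s$, $N_t-N_s$ has the $\mathrm{Bin}(n-N_s,\,1-\exp(-\lambda_\infty(t-s)))$ distribution. (c)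 The processes $N^\alpha$ converge weakly to $N$ as $\alpha\to\infty$.
   Context: $X$ is a continuous-time Markov chain with values in the set $\{e_1,\dots,e_d\}$ of standard basis vectors of $\mathbb R^d$, with irreducible transition matrix $Q\in\mathbb R^{d\times d}$ and invariant probability vector $\pi$ ($Q\pi=0$); convention: $Q_{ij}$, $i\neq j$, is the intensity of a transition from state $j$ to state $i$, so column sums of $Q$ are zero. Let $\lambda\in\mathbb R^d_+$. For $\alpha>0$ let $X^\alpha_t=X_{\alpha t}$, a Markov chain with transition matrix $\alpha Q$. For each $\alpha$ there are $n$ default times $\tau^{\alpha,1},\dots,\tau^{\alpha,n}$ which, conditionally on the whole process $X$, are independent with $\mathbb P(\tau^{\alpha,k}>t\mid\mathcal F^X)=\exp(-\int_0^t\lambda^\top X_{\alpha s}\,\mathrm ds)$. Put $N^\alpha_t=\sum_{k=1}^n\mathbf 1_{\{\tau^{\alpha,k}\le t\}}$, so that $N^\alpha_0=0$ and $N^\alpha_t=\int_0^t(n-N^\alpha_s)\lambda^\top X_{\alpha s}\,\mathrm ds+m^\alpha_t$ with $m^\alpha$ a martingale; $X^\alpha$ and $N^\alpha$ have a.s. no simultaneous jumps. $(\mathcal F^\alpha_t)$ is the filtration generated by $X^\alpha$ and the indicator processes $\mathbf 1_{\{\tau^{\alpha,k}\le t\}}$, $k=1,\dots,n$. $\|\cdot\|_{L^\infty}$ is the essential supremum norm on random variables (vectors). Weak convergence of processes means convergence in distribution in the Skorokhod space $D[0,\infty)$. *)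

(* Defs.v *)
From HB Require Import structures.
From mathcomp Require Import all_boot all_order all_algebra fingraph.
From mathcomp Require Import all_classical all_reals all_analysis measurable_realfun.

Set Implicit Arguments.
Unset Strict Implicit.
Unset Printing Implicit Defensive.

Import Order.TTheory GRing.Theory Num.Theory.
Import numFieldNormedType.Exports.

Local Open Scope classical_set_scope.
Local Open Scope ring_scope.

(* A sub-sigma-algebra is always given by a generating system [G] of events:
   "measurable with respect to G" means with respect to [<<s G >>]. *)

Section conditional_expectation.
Context {d : measure_display} {T : measurableType d} {R : realType}.
Variable P : probability T R.

(* [g] is a version of the conditional expectation of [f] given [<<s G >>]. *)
Definition is_cond_exp (G : set_system T) (f g : T -> R) : Prop :=
  [/\ P.-integrable setT (EFin \o f),
      P.-integrable setT (EFin \o g),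
      measurable_fun setT (g : g_sigma_algebraType G -> R) &
      forall A, <<s G >> A ->
        (\int[P]_(w in A) (g w)%:E = \int[P]_(w in A) (f w)%:E)%E].

Definition is_cond_prob (G : set_system T) (E : set T) (p : T -> R) : Prop :=
  is_cond_exp G (\1_E) p.

(* Subfamilies are covered by taking [B k = setT]. *)
Definition cond_independent d' (U : measurableType d') (n : nat)
    (G : set_system T) (Y : 'I_n -> T -> U) : Prop :=
  forall (B : 'I_n -> set U) (p : 'I_n -> T -> R),
    (forall k, measurable (B k)) ->
    (forall k, is_cond_prob G (Y k @^-1` B k) (p k)) ->
    is_cond_prob G (\bigcap_(k in [set: 'I_n]) (Y k @^-1` B k))
      (fun w => \prod_(k < n) p k w).

Definition events_of (I : Type) (D : set I) (Y : I -> T -> R) : set_system T :=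
  \bigcup_(i in D) preimage_set_system setT (Y i) measurable.

Definition martingale (G : R -> set_system T) (M : R -> T -> R) : Prop :=
  forall s t, 0 <= s -> s <= t -> is_cond_exp (G s) (M t) (M s).

End conditional_expectation.

Section paths.
Context {R : realType}.

Definition cadlag (U : topologicalType) (f : R -> U) : Prop :=
  (forall t, 0 <= t -> f u @[u --> t^'+] --> f t) /\
  (forall t, 0 < t -> exists l : U, f u @[u --> t^'-] --> l).

(* increasing bijections of [0, +oo[, hence homeomorphisms *)
Definition time_change (mu : R -> R) : Prop :=
  set_bij `[0, +oo[ `[0, +oo[ mu /\
  {in `[0, +oo[ &, {homo mu : s t / s < t}}.

End paths.

(* D[0, +oo[. Paths are total functions on R; the value 0 at negative times
   makes two elements equal iff they agree on [0, +oo[. *)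
Record skorokhod (R : realType) := Skorokhod {
  skor_fun :> R -> R;
  skor_cadlag : cadlag skor_fun;
  skor_neg : forall t, t < 0 -> skor_fun t = 0 }.

Section skorokhod_topology.
Context {R : realType}.
Local Notation D := (skorokhod R).

HB.instance Definition _ := gen_eqMixin D.
HB.instance Definition _ := gen_choiceMixin D.

(* Basic neighbourhoods of the J1 topology: a sequence [x_n] is eventually in
   each [skor_ball x b e] iff there are time changes [mu_n] such that
   sup_s |mu_n s - s| -> 0 and, for all b, sup_(s <= b) |x_n (mu_n s) - x s|
   -> 0, which is the usual description of convergence for the (metrizable)
   Skorokhod topology of D[0, +oo[. *)
Definition skor_ball (x : D) (b e : R) : set D :=
  [set y : D | exists mu : R -> R, [/\ time_change mu,
    (forall s, 0 <= s -> `|mu s - s| < e) &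
    (forall s, 0 <= s -> s <= b -> `|y (mu s) - x s| < e)]].

Definition skor_nbhs (x : D) : set_system D :=
  filter_from [set be : R * R | 0 < be.2] (fun be => skor_ball x be.1 be.2).

HB.instance Definition _ := hasNbhs.Build D skor_nbhs.

Lemma time_change_id : time_change (@id R).
Proof.
by split=> //; split=> // x xD; exists x.
Qed.

Lemma time_change_ge0 (mu : R -> R) s : time_change mu -> 0 <= s -> 0 <= mu s.
Proof.
move=> [[mumap _ _] _] s0; have : `[0, +oo[%classic (mu s).
  by apply: mumap; rewrite /= in_itv/= s0.
by rewrite /= in_itv/= andbT.
Qed.

Lemma time_change_comp (mu nu : R -> R) :
  time_change mu -> time_change nu -> time_change (mu \o nu).
Proof.
move=> [bmu hmu] [bnu hnu]; split; first exact: set_bij_comp bnu bmu.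
move=> s t sD tD st /=; apply: hmu; last exact: hnu.
- rewrite in_itv/= andbT; apply: (@time_change_ge0 nu) => //.
  by move: sD; rewrite in_itv/= andbT.
- rewrite in_itv/= andbT; apply: (@time_change_ge0 nu) => //.
  by move: tD; rewrite in_itv/= andbT.
Qed.

Lemma skor_ball_center (x : D) b e : 0 < e -> skor_ball x b e x.
Proof.
move=> e0; exists id; split; first exact: time_change_id.
- by move=> s _; rewrite subrr normr0.
- by move=> s _ _; rewrite subrr normr0.
Qed.

Lemma skor_ballS (x : D) b b' e e' : b' <= b -> e <= e' ->
  skor_ball x b e `<=` skor_ball x b' e'.
Proof.
move=> bb ee y [mu [tc h1 h2]]; exists mu; split => //.
- by move=> s s0; exact: lt_le_trans (h1 _ s0) ee.
- by move=> s s0 sb; apply: lt_le_trans (h2 _ s0 _) ee; exact: le_trans bb.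
Qed.

Lemma skor_ball_triangle (x y z : D) b e e' : e <= 1 ->
  skor_ball x b e y -> skor_ball y (b + 1) e' z -> skor_ball x b (e + e') z.
Proof.
move=> e1 [mu [tm m1 m2]] [nu [tn n1 n2]]; exists (nu \o mu); split.
- exact: time_change_comp.
- move=> s s0 /=; rewrite -(subrKA (mu s)) addrC.
  apply: le_lt_trans (ler_normD _ _) _; apply: ltrD; first exact: m1.
  by apply: n1; exact: time_change_ge0.
- move=> s s0 sb /=; rewrite -(subrKA (y (mu s))) addrC.
  apply: le_lt_trans (ler_normD _ _) _; apply: ltrD; first exact: m2.
  apply: n2; first exact: time_change_ge0.
  have := m1 _ s0; rewrite ltr_norml => /andP[_ h].
  have h' : mu s < e + s by rewrite -ltrBlDr.
  by rewrite addrC; apply: le_trans (ltW h') _; apply: lerD.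
Qed.

Lemma skor_nbhs_filter (x : D) : ProperFilter (nbhs x).
Proof.
apply: filter_from_proper; last first.
  by move=> [b e] /= e0; exists x; exact: skor_ball_center.
apply: filter_from_filter; first by exists (0, 1) => /=.
move=> [b e] [b' e'] /= e0 e'0; exists (Num.max b b', Num.min e e') => /=.
  by rewrite lt_min e0.
move=> y h; split; apply: skor_ballS h.
- by rewrite le_max lexx.
- by rewrite ge_min lexx.
- by rewrite le_max lexx orbT.
- by rewrite ge_min lexx orbT.
Qed.

Lemma skor_nbhs_singleton (x : D) (A : set D) : nbhs x A -> A x.
Proof. by move=> [[b e] /= e0]; apply; exact: skor_ball_center. Qed.

Lemma skor_nbhs_nbhs (x : D) (A : set D) : nbhs x A -> nbhs x (nbhs^~ A).
Proof.
move=> [[b e] /= e0 sub]; pose e1 := Num.min (e / 2) 1.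
have e10 : 0 < e1 by rewrite lt_min ltr01 divr_gt0.
have e11 : e1 <= 1 by rewrite ge_min lexx orbT.
exists (b, e1) => //= y xy; exists (b + 1, e / 2) => /=; first by rewrite divr_gt0.
move=> z yz; apply: sub; have := skor_ball_triangle e11 xy yz.
apply: skor_ballS => //; rewrite [leRHS]splitr; apply: lerD => //.
by rewrite ge_min lexx.
Qed.

HB.instance Definition _ := Nbhs_isNbhsTopological.Build D
  skor_nbhs_filter skor_nbhs_singleton skor_nbhs_nbhs.

Lemma cadlag_restrict (f : R -> R) : cadlag f -> cadlag (f \_ `[0, +oo[).
Proof.
move=> [fr fl]; split.
- move=> t t0; have -> : (f \_ `[0, +oo[) t = f t.
    by rewrite patchE mem_set//= in_itv/= t0.
  apply: cvg_trans (fr t t0); apply: near_eq_cvg; near=> u.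
  rewrite patchE mem_set//= in_itv/= andbT; apply: le_trans t0 _.
  by near: u; exact: nbhs_right_ge.
- move=> t t0; have [l fl'] := fl t t0; exists l.
  apply: cvg_trans fl'; apply: near_eq_cvg; near=> u.
  rewrite patchE mem_set//= in_itv/= andbT.
  by near: u; exact: nbhs_left_ge.
Unshelve. all: by end_near. Qed.

Lemma restrict_neg (f : R -> R) t : t < 0 -> (f \_ `[0, +oo[) t = 0.
Proof.
by move=> t0; rewrite patchE memNset//= in_itv/= andbT leNgt t0.
Qed.

Lemma cadlag_cst (c : R) : cadlag (fun _ : R => c).
Proof. by split=> [t _|t _]; [|exists c]; exact: cvg_cst. Qed.

(* The element of D[0, +oo[ given by the restriction of [f] to [0, +oo[;
   only meant for cadlag [f] (the null path otherwise). *)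
Definition path_of (f : R -> R) : D :=
  match pselect (cadlag f) with
  | left cf => Skorokhod (cadlag_restrict cf) (@restrict_neg f)
  | right _ => Skorokhod (cadlag_restrict (cadlag_cst 0)) (@restrict_neg _)
  end.

Lemma path_ofE (f : R -> R) t : cadlag f -> 0 <= t -> path_of f t = f t.
Proof.
move=> cf t0; rewrite /path_of; case: pselect => //= _.
by rewrite patchE mem_set//= in_itv/= t0.
Qed.

End skorokhod_topology.

(* Convergence in distribution in D[0, +oo[, as a -> +oo, of the cadlag
   processes [Y a] to the cadlag process [Z] (on possibly different
   probability spaces). *)
Definition weak_cvg {R : realType} {d d' : measure_display}
    {T : measurableType d} {T' : measurableType d'}
    (P : probability T R) (P' : probability T' R)
    (Y : R -> R -> T -> R) (Z : R -> T' -> R) : Prop :=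
  forall F : skorokhod R -> R,
    continuous F -> (exists M : R, forall x, `|F x| <= M) ->
    'E_P[fun w => F (path_of (Y a ^~ w))]%E @[a --> +oo] -->
    'E_P'[fun w => F (path_of (Z ^~ w))]%E.

Section markov_chain.
Context {R : realType} {m : nat}.

(* Column convention: [Q i j], i != j, is the intensity of j -> i. *)
Definition transition_matrix (Q : 'M[R]_m) : Prop :=
  (forall i j, i != j -> 0 <= Q i j) /\ (forall j, \sum_i Q i j = 0).

Definition irreducible (Q : 'M[R]_m) : Prop :=
  forall i j : 'I_m, connect [rel k l | 0 < Q l k] i j.

Definition invariant_probability (Q : 'M[R]_m) (pi : 'cV[R]_m) : Prop :=
  [/\ forall k, 0 <= pi k 0, \sum_k pi k 0 = 1 & Q *m pi = 0].

Definition expmx (A : 'M[R]_m) : 'M[R]_m :=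
  limn (series (fun k => k`!%:R^-1 *: A ^+ k)).

Context {d : measure_display} {T : measurableType d}.

Definition chain_events (X : R -> T -> 'cV[R]_m) (D : set R) : set_system T :=
  \bigcup_(k in [set: 'I_m]) events_of D (fun u w => X u w k 0).

Record markov_chain (P : probability T R) (Q : 'M[R]_m)
    (X : R -> T -> 'cV[R]_m) : Prop := MarkovChain {
  chain_values : forall (t : R) w, 0 <= t -> exists i, X t w = delta_mx i 0;
  chain_measurable : forall (t : R) k, 0 <= t ->
    measurable_fun setT (fun w => X t w k 0);
  chain_cadlag : forall w, cadlag (X ^~ w);
  chain_markov : forall (s t : R) i, 0 <= s -> s <= t ->
    is_cond_prob P (chain_events X `[0, s]) [set w | X t w = delta_mx i 0]
      (fun w => (expmx ((t - s) *: Q) *m X s w) i 0) }.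

End markov_chain.

Section default_model.
Context {R : realType} {m n : nat} {d : measure_display} {T : measurableType d}.

Definition speed_up (X : R -> T -> 'cV[R]_m) (a : R) : R -> T -> 'cV[R]_m :=
  fun t => X (a * t).

(* Default times may be infinite (they are when lam = 0). *)
Record default_times (P : probability T R) (lam : 'cV[R]_m)
    (X : R -> T -> 'cV[R]_m) (a : R) (tau : 'I_n -> T -> \bar R) : Prop :=
  DefaultTimes {
  default_measurable : forall k, measurable_fun setT (tau k);
  default_independent :
    cond_independent P (chain_events X `[0, +oo[) tau;
  default_survival : forall (k : 'I_n) (t : R), 0 <= t ->
    is_cond_prob P (chain_events X `[0, +oo[)
      [set w | (t%:E < tau k w)%E]
      (fun w => expR (- (\int[lebesgue_measure]_(s in `[0, t])
                          (lam^T *m speed_up X a s w) 0 0)%R)) }.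

Definition default_count (tau : 'I_n -> T -> \bar R) (t : R) (w : T) : nat :=
  (\sum_(k < n) (tau k w <= t%:E)%E)%N.

Definition default_filtration (X : R -> T -> 'cV[R]_m) (a : R)
    (tau : 'I_n -> T -> \bar R) (s : R) : set_system T :=
  chain_events (speed_up X a) `[0, s] `|`
  \bigcup_(k in [set: 'I_n])
    events_of `[0, s] (fun (u : R) w => (tau k w <= u%:E)%E%:R : R).

End default_model.

Lemma cadlag_indicator {R : realType} (x : \bar R) :
  cadlag (fun t : R => (x <= t%:E)%E%:R : R).
Proof.
split=> [t _|t _].
- have [xt|tx] := leP x t%:E.
    apply: cvg_near_cst; near=> u.
    suff -> : (x <= u%:E)%E by [].
    by apply: le_trans xt _; rewrite lee_fin; near: u; exact: nbhs_right_ge.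
  case: x tx => [r||//]; last first.
    by move=> _; apply: cvg_near_cst; near=> u; rewrite leye_eq.
  rewrite lte_fin => tr; apply: cvg_near_cst; near=> u.
  rewrite lee_fin leNgt; suff -> : u < r by [].
  by near: u; exact: nbhs_right_lt.
- have [xt|tx] := ltP x t%:E.
    exists 1; case: x xt => [r|//|]; last first.
      by move=> _; apply: cvg_near_cst; near=> u; rewrite leNye.
    rewrite lte_fin => rt; apply: cvg_near_cst; near=> u.
    rewrite lee_fin; suff -> : r <= u by [].
    by near: u; exact: nbhs_left_ge.
  exists 0; apply: cvg_near_cst; near=> u.
  suff /negbTE -> : ~~ (x <= u%:E)%E by [].
  rewrite -ltNge; apply: lt_le_trans tx.
  by rewrite lte_fin; near: u; exact: nbhs_left_lt.
Unshelve. all: by end_near. Qed.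

Lemma default_count_cadlag {R : realType} {n : nat} {d : measure_display}
    {T : measurableType d} (tau : 'I_n -> T -> \bar R) w :
  cadlag (fun t => (default_count tau t w)%:R : R).
Proof.
have -> : (fun t => (default_count tau t w)%:R : R) =
    (fun t => \sum_(k < n) ((tau k w <= t%:E)%E%:R : R)).
  by apply/funext => t; rewrite natr_sum.
split=> [t t0|t t0].
  by apply: cvg_big => [|k _]; first exact: add_continuous; exact: (cadlag_indicator _).1.
have /choice[l hl] : forall k : 'I_n, exists l : R,
    (tau k w <= u%:E)%E%:R @[u --> t^'-] --> l.
  by move=> k; exact: (cadlag_indicator _).2.
by exists (\sum_(k < n) l k); apply: cvg_big => [|k _]; first exact: add_continuous; exact: hl.
Qed.

Section limit_process.
Context {R : realType} {d : measure_display} {T : measurableType d}.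

Record counting_process (N : R -> T -> nat) : Prop := CountingProcess {
  counting0 : forall w, N 0 w = 0%N;
  counting_measurable : forall t : R, 0 <= t ->
    measurable_fun setT (fun w => (N t w)%:R : R);
  counting_nondecreasing : forall w (s t : R), 0 <= s -> s <= t -> (N s w <= N t w)%N;
  counting_cadlag : forall w, cadlag (fun t => (N t w)%:R : R);
  counting_unit_jumps : forall w (t : R), 0 < t ->
    \forall u \near t^'-, (N t w <= (N u w).+1)%N }.

Definition count_filtration (N : R -> T -> nat) (s : R) : set_system T :=
  events_of `[0, s] (fun u w => (N u w)%:R : R).

(* dN_t = l (n - N_t) dt + dm_t, with m a martingale for the filtration
   generated by N *)
Definition binomial_intensity (P : probability T R) (n : nat) (l : R)
    (N : R -> T -> nat) : Prop :=
  martingale P (count_filtration N)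
    (fun t w => (N t w)%:R -
      (\int[lebesgue_measure]_(s in `[0, t]) (l * (n%:R - (N s w)%:R)))%R).

End limit_process.

(* [l] plays the role of lambda_infinity *)
Definition gtrans {R : realType} (n : nat) (l : R) (i j : nat) (r : R) : R :=
  if (j <= i)%N then
    'C(n - j, n - i)%:R * expR (- (n - i)%:R * l * r)
      * (1 - expR (- l * r)) ^+ (i - j)
  else 0.

(* Main.v *)
(* Conditionally on X the default indicators are independent, so the mean of
   C(n - N^a_t, k) given F^a_s and X is exp(-kH) C(n - N^a_s, k), where H is
   the integral of lambda^T X^a over [s, t]; inverting these factorial
   moments gives a binomial law with the random parameter exp(-H). A power of
   exp(Q) has positive entries, so exp(rQ) converges to pi exponentially fast
   (Doeblin), and the conditional second moment of H - linf (t - s) is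
   O(1/a), uniformly over the past. This gives (a) and the first half of (b);
   all bounds are averages over the events A of the past, of the form c P(A),
   which amounts to L^oo bounds on the conditional expectations.
   For N, the martingale problem makes j |-> C(n - j, k) an eigenfunction of
   the generator, which again yields the factorial moments and the binomial
   law.
   For (c), (b) gives the convergence of the finite-dimensional laws on a
   grid. No tightness argument is needed: a counting path agreeing on a fine
   grid with a path with unit jumps is close to it in the Skorokhod topology,
   so a bounded continuous functional is squeezed between functions of the
   grid values. *)
Require Import Defs.
From HB Require Import structures.
From mathcomp Require Import all_boot all_order all_algebra fingraph.
From mathcomp Require Import all_classical all_reals all_analysis measurable_realfun.
From mathcomp Require Import ess_sup_inf ring lra zify.

Set Implicit Arguments.
Unset Strict Implicit.
Unset Printing Implicit Defensive.

Import Order.TTheory GRing.Theory Num.Theory.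
Import numFieldNormedType.Exports.

Local Open Scope classical_set_scope.
Local Open Scope ring_scope.

(** * Exponentials of irreducible generators *)

(** The events of [Fa s] are tested on a pi-system of rectangles: a chain event up to time [s]
    intersected with upper bounds, in [[0, s]] or [+oo], on the default times. On a rectangle,
    conditional independence evaluates the probability that all obligors of a set [K] survive [t],
    also when intersected with any further event of the chain, such as its state at [t]. Summing
    over the sets [K] of size [k] gives the factorial moments. Two obstacles shape the rest. Nothing
    says beforehand that [N] stays below [n], so its intensity might become negative; the functions
    n - j and its positive part are eigenfunctions for the same eigenvalue with the same initial
    value, and comparing their means shows that [N] exceeds [n] with probability 0. For a continuous
    functional [F], measurability of [F] along the paths of the default counts is not established;
    their expectation is only enclosed, by a monotonicity of the integral valid for arbitrary
    functions. *)

Section exp_product.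
Context {R : realType}.
Implicit Types (u v : nat -> R).

Lemma cauchy_product_triangle u v N :
  \sum_(0 <= k < N) \sum_(a < k.+1) u a * v (k - a)%N =
  \sum_(0 <= a < N) \sum_(0 <= b < N | (a + b < N)%N) u a * v b.
Proof.
under eq_bigr => k _ do rewrite -(big_mkord xpredT (fun a => u a * v (k - a)%N)).
transitivity (\sum_(0 <= k < N) \sum_(0 <= a < N | (a < k.+1)%N) u a * v (k - a)%N).
  rewrite !big_nat; apply: eq_bigr => k /andP[_ kN].
  by rewrite (big_nat_widen 0 k.+1 N).
rewrite (exchange_big_dep_nat xpredT)//= !big_nat; apply: eq_bigr => a /andP[_ aN].
transitivity (\sum_(a <= k < N) u a * v (k - a)%N).
  by rewrite (big_nat_widenl a 0)//=; apply: eq_bigl => k; rewrite ltnS.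
rewrite -{1}[a]add0n big_addn.
rewrite (big_nat_widen 0 (N - a) N) ?leq_subr//=.
apply: congr_big_nat => // b bN; last by rewrite addnK.
by rewrite ltn_subRL addnC.
Qed.

Lemma cauchy_product_gap u v N :
  (\sum_(0 <= a < N) u a) * (\sum_(0 <= b < N) v b) -
  \sum_(0 <= k < N) \sum_(a < k.+1) u a * v (k - a)%N =
  \sum_(0 <= a < N) \sum_(0 <= b < N | ~~ (a + b < N)%N) u a * v b.
Proof.
rewrite cauchy_product_triangle big_distrl/= -sumrB; apply: eq_bigr => a _.
by rewrite big_distrr/= (bigID (fun b => (a + b < N)%N))/= addrC addrK.
Qed.

Lemma cauchy_product_exp (x y : R) k :
  \sum_(a < k.+1) exp_coeff x a * exp_coeff y (k - a)%N = exp_coeff (x + y) k.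
Proof.
rewrite /exp_coeff /= addrC exprDn mulr_suml; apply: eq_bigr => -[a ak] _ /=.
rewrite -(bin_fact (ltnSE ak)) !natrM -mulr_natr.
have f0 j : (j`!%:R : R) != 0 by rewrite pnatr_eq0 -lt0n fact_gt0.
have c0 : ('C(k, a)%:R : R) != 0 by rewrite pnatr_eq0 -lt0n bin_gt0 -ltnS.
by field; rewrite !f0 c0.
Qed.

(** The gap between the product of the partial sums and the partial sum of the Cauchy product is a
    sum of terms [u a * v b] outside a triangle. Termwise it is dominated by the same gap for the
    two exponential series, which tends to 0 because [expR (x + y) = expR x * expR y]. *)
Lemma cvg_cauchy_product_exp u v (x y U V : R) :
  (forall k, `|u k| <= exp_coeff x k) -> (forall k, `|v k| <= exp_coeff y k) ->
  series u @ \oo --> U -> series v @ \oo --> V ->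
  series (fun k => \sum_(a < k.+1) u a * v (k - a)%N) @ \oo --> U * V.
Proof.
move=> ux vy cu cv.
set w := (fun k => _).
have g0 : (fun N => series u N * series v N - series w N) @ \oo --> (0 : R).
  have e0 : (fun N => series (exp_coeff x) N * series (exp_coeff y) N -
      series (exp_coeff (x + y)) N) @ \oo --> (0 : R).
    have -> : (0 : R) = expR x * expR y - expR (x + y) by rewrite expRD subrr.
    by apply: cvgB; [apply: cvgM|]; exact: is_cvg_series_exp_coeff.
  apply: norm_cvg0; apply: (squeeze_cvgr _ (cvg_cst 0) e0); apply: nearW => N.
  rewrite normr_ge0/=; rewrite /series/= cauchy_product_gap.
  under [X in _ - X]eq_bigr do rewrite -cauchy_product_exp.
  rewrite cauchy_product_gap.
  apply: le_trans (ler_norm_sum _ _ _) _; apply: ler_sum => a _.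
  apply: le_trans (ler_norm_sum _ _ _) _; apply: ler_sum => b _.
  by rewrite normrM ler_pM.
have -> : series w = (fun N => series u N * series v N -
    (series u N * series v N - series w N)).
  by apply/funext => N; rewrite subKr.
by rewrite -[U * V]subr0; apply: cvgB => //; exact: cvgM.
Qed.

End exp_product.

Section expmx_entries.
Context {R : realType} {m : nat}.
Implicit Types A : 'M[R]_m.

Lemma expmx_mulmx_entry A B i j : (A * B) i j = \sum_l A i l * B l j.
Proof. by rewrite -mulmxE mxE. Qed.

Lemma exprmxZ (r : R) A k : (r *: A) ^+ k = r ^+ k *: A ^+ k.
Proof.
elim: k => [|k IH]; first by rewrite !expr0 scale1r.
by rewrite !exprS IH -!mulmxE -scalemxAl -scalemxAr scalerA.
Qed.

Lemma norm_exprmx_entry_le A k i j :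
  `|(A ^+ k) i j| <= (\sum_i \sum_j `|A i j|) ^+ k.
Proof.
set c := \sum_i _.
have c0 : 0 <= c by apply: sumr_ge0 => a _; apply: sumr_ge0.
elim: k i j => [|k IH] i j.
  rewrite !expr0 -idmxE mxE; case: eqP => _; by rewrite ?normr0 ?normr1.
rewrite exprS expmx_mulmx_entry; apply: le_trans (ler_norm_sum _ _ _) _.
apply: (@le_trans _ _ (\sum_l `|A i l| * c ^+ k)).
  by apply: ler_sum => l _; rewrite normrM ler_wpM2l.
rewrite -mulr_suml exprS ler_wpM2r ?exprn_ge0//.
rewrite /c [leRHS](bigD1 i)//= lerDl; apply: sumr_ge0 => a _; exact: sumr_ge0.
Qed.

Lemma cvg_mx_entries (f : nat -> 'M[R]_m) (M : 'M[R]_m) :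
  (forall i j, (fun k => f k i j) @ \oo --> M i j) -> f @ \oo --> M.
Proof.
move=> fM; apply/cvgrPdist_lt => e e0.
have h : \forall k \near \oo, forall ij : 'I_m * 'I_m,
    `|M (ij.1) (ij.2) - f k (ij.1) (ij.2)| < e.
  apply: filter_forall => -[i j] /=.
  by have /cvgrPdist_lt := fM i j; exact.
apply: filterS h => k h.
rewrite /Num.Def.normr/= mx_normrE; apply/bigmax_ltP; split => // ij _ /=.
by rewrite !mxE; exact: h.
Qed.

Lemma expmx_entry A i j :
  series (fun k => k`!%:R^-1 * (A ^+ k) i j) @ \oo --> expmx A i j.
Proof.
set c := \sum_i \sum_j `|A i j|.
have cv a b : cvgn (series (fun k => k`!%:R^-1 * (A ^+ k) a b)).
  apply: normed_cvg; apply: (series_le_cvg _ _ _ (is_cvg_series_exp_coeff c)) => k /=.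
  - exact: normr_ge0.
  - by rewrite /exp_coeff/= divr_ge0// exprn_ge0//; apply: sumr_ge0 => ? _; apply: sumr_ge0.
  - rewrite normrM /exp_coeff/= mulrC [`|_^-1|]ger0_norm ?invr_ge0//.
    by rewrite ler_wpM2r ?invr_ge0//; exact: norm_exprmx_entry_le.
pose L := \matrix_(a, b) limn (series (fun k => k`!%:R^-1 * (A ^+ k) a b)).
have cvL : series (fun k => k`!%:R^-1 *: A ^+ k) @ \oo --> L.
  apply: cvg_mx_entries => a b; rewrite mxE.
  rewrite (_ : (fun k => _) = series (fun k => k`!%:R^-1 * (A ^+ k) a b)).
    exact: cv.
  by apply/funext => N; rewrite /series/= summxE; apply: eq_bigr => k _; rewrite mxE.
have hM : hausdorff_space 'M[R]_m by exact: norm_hausdorff.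
rewrite /expmx (cvg_lim hM cvL).
by rewrite mxE; exact: cv.
Qed.

(** Uniformization: as [P] commutes with 1, the series of exp(r(P - 1)) is entrywise the Cauchy
    product of the series of exp(rP) with the scalar series of exp(-r). The matrix exponential thus
    becomes a Poisson mixture of powers of [P]. *)
Lemma expmx_scale_shift (P : 'M[R]_m) (r : R) i j : 0 <= r ->
  series (fun k => exp_coeff r k * (P ^+ k) i j) @ \oo -->
    expR r * expmx (r *: (P - 1)) i j.
Proof.
move=> r0; set c := \sum_i \sum_j `|P i j|.
have sgn b (B : 'M[R]_m) x y : ((-1) ^+ b * B) x y = (-1) ^+ b * B x y.
  elim: b B => [|b IH] B; first by rewrite !expr0 !mul1r.
  by rewrite !exprSr -!mulrA IH !mulN1r mxE.
pose u k := exp_coeff r k * (P ^+ k) i j.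
have ub k : `|u k| <= exp_coeff (r * c) k.
  rewrite normrM ger0_norm ?divr_ge0 ?exprn_ge0// /exp_coeff/= exprMn.
  by rewrite mulrAC ler_wpM2r ?invr_ge0// ler_wpM2l ?exprn_ge0// norm_exprmx_entry_le.
have cu : cvgn (series u).
  apply: normed_cvg; apply: (series_le_cvg _ _ ub (is_cvg_series_exp_coeff _)) => k.
    exact: normr_ge0.
  exact: le_trans (ub k).
have vb k : `|exp_coeff (- r) k| <= exp_coeff r k.
  by rewrite /exp_coeff/= normrM normrX normrN [`|_^-1|]ger0_norm ?invr_ge0// ger0_norm.
have := cvg_cauchy_product_exp ub vb cu (is_cvg_series_exp_coeff (- r)).
have -> : (fun k => \sum_(a < k.+1) u a * exp_coeff (- r) (k - a)%N) =
    (fun k => k`!%:R^-1 * ((r *: (P - 1)) ^+ k) i j).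
  apply/funext => k; rewrite exprmxZ mxE addrC exprDn_comm; last first.
    by rewrite /GRing.comm mulrN1 mulN1r.
  rewrite summxE !mulr_sumr; apply: eq_bigr => -[a ak] _ /=.
  rewrite mulmxnE sgn /u /exp_coeff/= -[- r]mulN1r exprMn.
  have -> : r ^+ k = r ^+ (k - a) * r ^+ a by rewrite -exprD subnK.
  rewrite -(bin_fact (ltnSE ak)) !natrM -mulr_natr.
  have f0 x : (x`!%:R : R) != 0 by rewrite pnatr_eq0 -lt0n fact_gt0.
  have c0 : ('C(k, a)%:R : R) != 0 by rewrite pnatr_eq0 -lt0n bin_gt0 -ltnS.
  by field; rewrite !f0 c0.
move=> /(cvg_lim (@Rhausdorff R)).
rewrite (cvg_lim (@Rhausdorff R) (expmx_entry (A := r *: (P - 1)) (i := i) (j := j))) => ->.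
rewrite mulrCA -/(expR (- r)) expRxMexpNx_1 mulr1; exact: cu.
Qed.

End expmx_entries.

(** * Doeblin contraction and exponential ergodicity *)

Section doeblin.
Context {R : realType} {m : nat}.
Implicit Types (P : 'M[R]_m) (v : 'I_m -> R).

(** Column-stochastic, in agreement with the column convention for [Q]. *)
Definition stochastic P :=
  (forall i j, 0 <= P i j) /\ (forall j, \sum_i P i j = 1).

Lemma stochastic1 : stochastic 1.
Proof.
split=> [i j|j]; first by rewrite -idmxE mxE ler0n.
rewrite (bigD1 j)//= big1 => [|i /negPf ij]; by rewrite -idmxE mxE ?eqxx ?addr0 ?ij.
Qed.

Lemma stochasticM P P' : stochastic P -> stochastic P' -> stochastic (P * P').
Proof.
move=> [P0 P1] [P'0 P'1]; split=> [i j|j].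
  by rewrite expmx_mulmx_entry; apply: sumr_ge0 => l _; rewrite mulr_ge0.
under eq_bigr do rewrite expmx_mulmx_entry.
rewrite exchange_big/=; under eq_bigr do rewrite -mulr_suml P1 mul1r.
exact: P'1.
Qed.

Lemma stochasticX P k : stochastic P -> stochastic (P ^+ k).
Proof.
move=> sP; elim: k => [|k IH]; first exact: stochastic1.
by rewrite exprS; exact: stochasticM.
Qed.

(* Subtracting [delta] from all entries does not change the image of a vector
   of sum 0. *)
Lemma doeblin_contraction P (delta : R) v :
  (forall i j, delta <= P i j) -> (forall j, \sum_i P i j = 1) ->
  \sum_j v j = 0 ->
  \sum_i `|\sum_j P i j * v j| <= (1 - m%:R * delta) * \sum_j `|v j|.
Proof.
move=> Pd P1 v0.
apply: (@le_trans _ _ (\sum_i \sum_j (P i j - delta) * `|v j|)).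
  apply: ler_sum => i _.
  have -> : \sum_j P i j * v j = \sum_j (P i j - delta) * v j.
    under [RHS]eq_bigr do rewrite mulrBl.
    by rewrite sumrB -mulr_sumr v0 mulr0 subr0.
  apply: le_trans (ler_norm_sum _ _ _) _; apply: ler_sum => j _.
  by rewrite normrM ger0_norm// subr_ge0.
rewrite exchange_big/= mulr_sumr; apply: ler_sum => j _.
rewrite -mulr_suml ler_wpM2r// sumrB P1 sumr_const card_ord.
by rewrite mulr_natl.
Qed.

Lemma pos_entryM P P' i j l : stochastic P -> stochastic P' ->
  0 < P i l -> 0 < P' l j -> 0 < (P * P') i j.
Proof.
move=> [P0 _] [P'0 _] Pil P'lj; rewrite expmx_mulmx_entry (bigD1 l)//=.
by rewrite ltr_wpDr ?mulr_gt0// sumr_ge0// => a _; rewrite mulr_ge0.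
Qed.

(** Since the diagonal is positive, a positive entry of a power stays positive in all higher powers.
    The sum of the exponents that work for the single pairs therefore works for all pairs at
    once. *)
Lemma primitive_pow P : stochastic P -> (forall i, 0 < P i i) ->
  (forall i j : 'I_m, connect [rel k l | 0 < P l k] i j) ->
  exists M, forall i j, 0 < (P ^+ M) i j.
Proof.
move=> sP Pd con.
have dg k i : 0 < (P ^+ k) i i.
  elim: k => [|k IH]; first by rewrite expr0 -idmxE mxE eqxx ltr01.
  by rewrite exprS; apply: (@pos_entryM _ _ _ _ i) => //; exact: stochasticX.
have ex (ij : 'I_m * 'I_m) : exists k, 0 < (P ^+ k) ij.2 ij.1.
  case: ij => i j /=; have /connectP[p + ->] := con i j.
  elim: p i => [|a p IH] i /=; first by exists 0%N; exact: dg.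
  move=> /andP[ia /IH[k hk]]; exists k.+1.
  by rewrite exprSr; apply: (@pos_entryM _ _ _ _ a) => //; exact: stochasticX.
have [f hf] := choice ex.
exists (\sum_ij f ij)%N => i j.
rewrite (bigD1 (j, i))//= exprD.
by apply: (@pos_entryM _ _ _ _ j) (hf (j, i)) (dg _ _); exact: stochasticX.
Qed.

Lemma stochastic_l1 P v : stochastic P ->
  \sum_i `|\sum_j P i j * v j| <= \sum_j `|v j|.
Proof.
move=> [P0 P1]; apply: (@le_trans _ _ (\sum_i \sum_j P i j * `|v j|)).
  apply: ler_sum => i _; apply: le_trans (ler_norm_sum _ _ _) _.
  by apply: ler_sum => j _; rewrite normrM ger0_norm.
rewrite exchange_big/=; apply: ler_sum => j _.
by rewrite -mulr_suml P1 mul1r.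
Qed.

(** The columns of [P ^+ k] minus [pi] have sum 0, so the Doeblin contraction for the positive
    matrix [P ^+ N] shrinks their l1 norm by a factor [th] every [N] steps. *)
Lemma stochastic_geometric P (pi : 'cV[R]_m) : stochastic P ->
  (forall i, 0 < P i i) ->
  (forall i j : 'I_m, connect [rel k l | 0 < P l k] i j) ->
  P *m pi = pi -> \sum_k pi k 0 = 1 ->
  exists C rho : R, [/\ 0 <= C, 0 < rho, rho < 1 &
    forall k i j, `|(P ^+ k) i j - pi i 0| <= C * rho ^+ k].
Proof.
move=> sP Pd con Ppi pi1.
have [M hM] := primitive_pow sP Pd con.
pose N := M.+1.
have hN i j : 0 < (P ^+ N) i j.
  by rewrite exprS; apply: (@pos_entryM _ _ _ _ i) => //; exact: stochasticX.
have [delta d0 hd] : exists2 delta : R, 0 < delta & forall i j, delta <= (P ^+ N) i j.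
  exists (\big[Num.min/1]_(ij : 'I_m * 'I_m) (P ^+ N) (ij.1) (ij.2)).
    by apply/bigmin_gtP.
  by move=> i j; exact: (@bigmin_le_cond _ _ _ 1 (i, j) xpredT
    (fun ij => (P ^+ N) (ij.1) (ij.2))).
(* The maximum with 1/2 keeps [th] positive when the contraction factor is 0. *)
pose th : R := Num.max (1 - m%:R * delta) 2^-1.
have m0 : (0 < m)%N.
  rewrite lt0n; apply/eqP => m0.
  suff : (0 : R) = 1 by move/eqP; rewrite eq_sym oner_eq0.
  by rewrite -pi1 big1// => k; have := leq_ltn_trans (leq0n k) (ltn_ord k); lia.
have th0 : 0 < th by rewrite lt_max invr_gt0 ltr0n orbT.
have th1 : th < 1.
  by rewrite gt_max ltrBlDr ltrDl mulr_gt0 ?ltr0n//= invf_lt1 ?ltr1n ?ltr0n.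
(* A substitute for the N-th root of [th]: Bernoulli's inequality gives [th <= rho ^+ N]. *)
pose rho := 1 - (1 - th) / N%:R.
have rho0 : 0 < rho.
  rewrite subr_gt0 ltr_pdivrMr ?ltr0n// mul1r; apply: (@lt_le_trans _ _ 1).
    by rewrite ltrBlDr ltrDl.
  by rewrite ler1n.
have rho1 : rho < 1 by rewrite ltrBlDr ltrDl divr_gt0 ?ltr0n// subr_gt0.
have rhoN : th <= rho ^+ N.
  have bern x n : -1 <= x -> 1 + n%:R * x <= (1 + x) ^+ n :> R.
    move=> x1; elim: n => [|n IH]; first by rewrite mul0r addr0 expr0.
    rewrite exprS; apply: (@le_trans _ _ ((1 + x) * (1 + n%:R * x))).
      have : 0 <= n%:R * x ^+ 2 by rewrite mulr_ge0 ?sqr_ge0.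
      by rewrite -natr1; nra.
    by rewrite ler_wpM2l// -lerBlDl sub0r.
  have := bern (- ((1 - th) / N%:R)) N.
  rewrite mulrN mulrCA divff ?pnatr_eq0// mulr1 subKr; apply.
  by have := rho0; rewrite /rho; lra.
pose e k j := \sum_i `|(P ^+ k) i j - pi i 0|.
pose B := 1 + \sum_i `|pi i 0|.
have B0 : 0 <= B by rewrite addr_ge0// sumr_ge0.
have Pkpi k : P ^+ k *m pi = pi.
  elim: k => [|k IH]; first by rewrite expr0 -idmxE mul1mx.
  by rewrite exprS -mulmxE -mulmxA IH.
have stepE k l i j : (P ^+ (k + l)) i j - pi i 0 =
    \sum_a (P ^+ k) i a * ((P ^+ l) a j - pi a 0).
  rewrite exprD expmx_mulmx_entry -{1}(Pkpi k) mxE -sumrB.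
  by apply: eq_bigr => a _; rewrite mulrBr.
have sum0 k j : \sum_i ((P ^+ k) i j - pi i 0) = 0.
  by rewrite sumrB pi1 (stochasticX k sP).2 subrr.
have eB k j : e k j <= B.
  have e0 : e 0%N j <= B.
    apply: (@le_trans _ _ (\sum_i ((1 : 'M[R]_m) i j + `|pi i 0|))).
      apply: ler_sum => i _; rewrite expr0; apply: le_trans (ler_normB _ _) _.
      by rewrite lerD2r ger0_norm// (stochastic1).1.
    by rewrite big_split/= (stochastic1).2.
  apply: le_trans e0; rewrite /e -{1}[k]addn0.
  under eq_bigr do rewrite stepE.
  exact/stochastic_l1/stochasticX.
have eN k j : e (N + k)%N j <= th * e k j.
  rewrite /e; under eq_bigr do rewrite stepE.
  apply: le_trans (doeblin_contraction hd (stochasticX N sP).2 (sum0 k j)) _.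
  by rewrite ler_wpM2r ?sumr_ge0// le_max lexx.
(* Dividing by [rho ^+ N] absorbs the exponents below [N], where only the bound [B] is available. *)
exists (B / rho ^+ N), rho; split => //; first by rewrite divr_ge0// exprn_ge0// ltW.
move=> k i j; apply: (@le_trans _ _ (e k j)).
  by rewrite /e (bigD1 i)//= lerDl sumr_ge0.
elim/ltn_ind: k => k IH.
have [kN|Nk] := ltnP k N.
  apply: le_trans (eB _ _) _; rewrite -mulrA ler_peMr// mulrC.
  rewrite ler_pdivlMr ?exprn_gt0// mul1r.
  by apply: ler_wiXn2l; [exact: ltW|exact: ltW|exact: ltnW].
rewrite -(subnKC Nk); apply: le_trans (eN _ _) _.
rewrite exprD mulrCA; apply: ler_pM => //; [exact: ltW|exact: sumr_ge0|].
by apply: IH; rewrite ltn_subrL /=; apply: leq_trans Nk.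
Qed.

(** With Q = q(P - 1), exp(rQ) is the mixture of the powers of [P] with Poisson weights of parameter
    rq. Averaging the error [C * rho ^+ k] over these weights gives C exp(- rq(1 - rho)), hence the
    rate q(1 - rho). *)
Lemma expmx_ergodic (Q : 'M[R]_m) (pi : 'cV[R]_m) :
  transition_matrix Q -> irreducible Q -> invariant_probability Q pi ->
  exists C kappa : R, [/\ 0 <= C, 0 < kappa &
    forall r, 0 <= r -> forall i j,
      `|expmx (r *: Q) i j - pi i 0| <= C * expR (- (kappa * r))].
Proof.
move=> [Qge0 Qsum] Qirr [pi0 pi1 Qpi].
(* Strictly larger than every entry in modulus, so that the diagonal of [P] is positive and [P] is
   aperiodic. *)
pose q : R := 1 + \sum_i \sum_j `|Q i j|.
have Qq i j : `|Q i j| < q.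
  apply: (@le_lt_trans _ _ (\sum_i \sum_j `|Q i j|)); last by rewrite /q ltrDr.
  rewrite [leRHS](bigD1 i)//= [X in _ <= X + _](bigD1 j)//= -addrA lerDl.
  by rewrite addr_ge0//; apply: sumr_ge0 => // ? _; exact: sumr_ge0.
have q0 : 0 < q by rewrite ltr_wpDr ?ltr01//; apply: sumr_ge0 => ? _; exact: sumr_ge0.
pose P : 'M[R]_m := 1 + q^-1 *: Q.
have PE i j : P i j = (i == j)%:R + q^-1 * Q i j.
  by rewrite /P -idmxE !mxE.
have Pd i : 0 < P i i.
  rewrite PE eqxx -(mulVf (lt0r_neq0 q0)) -mulrDr mulr_gt0 ?invr_gt0//.
  by have := Qq i i; rewrite ltr_norml => /andP[]; lra.
have sP : stochastic P.
  split=> [i j|j].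
    have [->|ij] := eqVneq i j; first exact: ltW.
    by rewrite PE (negPf ij) add0r mulr_ge0 ?Qge0 ?invr_ge0// ltW.
  under eq_bigr do rewrite PE.
  rewrite big_split/= -mulr_sumr Qsum mulr0 addr0.
  by rewrite (bigD1 j)//= eqxx big1 ?addr0// => i /negPf ->.
have con i j : connect [rel k l | 0 < P l k] i j.
  apply: connect_sub (Qirr i j) => k l /= Qlk; apply: connect1 => /=.
  have [->|lk] := eqVneq l k; first exact: Pd.
  by rewrite PE (negPf lk) add0r mulr_gt0// invr_gt0.
have Ppi : P *m pi = pi.
  by rewrite /P mulmxDl -idmxE mul1mx -scalemxAl Qpi scaler0 addr0.
have [C [rho [C0 rho0 rho1 HC]]] := stochastic_geometric sP Pd con Ppi pi1.
exists C, (q * (1 - rho)); split => //; first by rewrite mulr_gt0// subr_gt0.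
move=> r r0 i j.
have -> : r *: Q = (r * q) *: (P - 1).
  by rewrite /P addrC addKr scalerA mulrK// unitfE lt0r_neq0.
have rq0 : 0 <= r * q by rewrite mulr_ge0// ltW.
have cv1 := expmx_scale_shift (P := P) (i := i) (j := j) rq0.
set E := expmx _ i j in cv1 *.
have cv2 : series (fun k => exp_coeff (r * q) k * ((P ^+ k) i j - pi i 0)) @ \oo -->
    expR (r * q) * (E - pi i 0).
  rewrite mulrBr.
  have -> : series (fun k => exp_coeff (r * q) k * ((P ^+ k) i j - pi i 0)) =
     (fun n => series (fun k => exp_coeff (r * q) k * (P ^+ k) i j) n -
        series (exp_coeff (r * q)) n * pi i 0).
    apply/funext => n; rewrite /series/= mulr_suml -sumrB.
    by apply: eq_bigr => k _; rewrite mulrBr.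
  by apply: cvgB => //; apply: cvgMl; exact: is_cvg_series_exp_coeff.
have : `|expR (r * q) * (E - pi i 0)| <= C * expR (r * q * rho).
  have cv3 : (fun n => `|series (fun k => exp_coeff (r * q) k * ((P ^+ k) i j - pi i 0)) n|)
     @ \oo --> `|expR (r * q) * (E - pi i 0)| by exact: cvg_norm.
  have cv4 : (fun n => C * series (exp_coeff (r * q * rho)) n) @ \oo --> C * expR (r * q * rho).
    by apply: cvgMr; exact: is_cvg_series_exp_coeff.
  apply: (ler_cvg_to cv3 cv4); apply: nearW => n.
  rewrite /series/= mulr_sumr; apply: le_trans (ler_norm_sum _ _ _) _.
  apply: ler_sum => k _; rewrite normrM ger0_norm ?divr_ge0 ?exprn_ge0//.
  rewrite /exp_coeff/= [(_ * rho) ^+ k]exprMn.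
  apply: le_trans (ler_wpM2l _ (HC k i j)) _; first by rewrite divr_ge0 ?exprn_ge0.
  by rewrite le_eqVlt; apply/orP; left; apply/eqP; ring.
rewrite normrM ger0_norm ?expR_ge0// -ler_pdivlMl ?expR_gt0//.
move/le_trans; apply; rewrite mulrCA -expRN -expRD ler_wpM2l// le_eqVlt.
by apply/orP; left; apply/eqP; congr expR; ring.
Qed.

End doeblin.

(** * Expectations and conditional expectations *)

Lemma eq_to_le {R : numDomainType} (x y : R) : x = y -> x <= y.
Proof. by move=> ->. Qed.

Section mean.
Context {d : measure_display} {T : measurableType d} {R : realType}.
Variable P : probability T R.
Implicit Types (f g h : T -> R) (A B : set T).

Definition mean f : R := \int[P]_w f w.

Definition itg f : Prop := P.-integrable setT (EFin \o f).

(** A class of integrable functions closed under sums and products, and whose members may multiply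
    any integrable function; it settles most integrability conditions. *)
Definition bmeas f : Prop :=
  measurable_fun setT f /\ exists M, forall w, `|f w| <= M.

Lemma bmeas_bounded f : bmeas f -> [bounded f w | w in [set: T]].
Proof.
move=> [_ [M fM]]; exists M; split; first exact: num_real.
by move=> x Mx w _ /=; apply: le_trans (fM w) (ltW Mx).
Qed.

Lemma bmeas_itg f : bmeas f -> itg f.
Proof.
move=> bf; apply: measurable_bounded_integrable => //; last exact: bmeas_bounded.
  by rewrite ltey_eq fin_num_measure.
exact: bf.1.
Qed.

Lemma bmeas_cst (c : R) : bmeas (fun=> c).
Proof. by split; [exact: measurable_cst|exists `|c|]. Qed.

Lemma bmeasD f g : bmeas f -> bmeas g -> bmeas (fun w => f w + g w).
Proof.
move=> [mf [M fM]] [mg [N gN]]; split; first exact: measurable_funD.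
by exists (M + N) => w; apply: le_trans (ler_normD _ _) _; exact: lerD.
Qed.

Lemma bmeasM f g : bmeas f -> bmeas g -> bmeas (fun w => f w * g w).
Proof.
move=> [mf [M fM]] [mg [N gN]]; split; first exact: measurable_funM.
by exists (M * N) => w; rewrite normrM ler_pM.
Qed.

Lemma bmeasN f : bmeas f -> bmeas (fun w => - f w).
Proof.
move=> bf; have := bmeasM (bmeas_cst (-1)) bf.
by congr bmeas; apply/funext => w; rewrite mulN1r.
Qed.

Lemma bmeasB f g : bmeas f -> bmeas g -> bmeas (fun w => f w - g w).
Proof. by move=> bf bg; apply: bmeasD => //; exact: bmeasN. Qed.

Lemma bmeas_indic A : measurable A -> bmeas (\1_A : T -> R).
Proof.
move=> mA; split; first exact: measurable_indic.
by exists 1 => w; rewrite indicE; case: (w \in A); rewrite ?normr1 ?normr0.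
Qed.

Lemma bmeas_sum I (r : seq I) (Q : pred I) (F : I -> T -> R) :
  (forall i, bmeas (F i)) -> bmeas (fun w => \sum_(i <- r | Q i) F i w).
Proof.
move=> bF; elim: r => [|i r IH].
  by have := bmeas_cst 0; congr bmeas; apply/funext => w; rewrite big_nil.
have [Qi|Qi] := boolP (Q i).
  have := bmeasD (bF i) IH.
  by congr bmeas; apply/funext => w; rewrite big_cons Qi.
by move: IH; congr bmeas; apply/funext => w; rewrite big_cons (negPf Qi).
Qed.

Lemma bmeas_prod I (r : seq I) (Q : pred I) (F : I -> T -> R) :
  (forall i, bmeas (F i)) -> bmeas (fun w => \prod_(i <- r | Q i) F i w).
Proof.
move=> bF; elim: r => [|i r IH].
  by have := bmeas_cst 1; congr bmeas; apply/funext => w; rewrite big_nil.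
have [Qi|Qi] := boolP (Q i).
  have := bmeasM (bF i) IH.
  by congr bmeas; apply/funext => w; rewrite big_cons Qi.
by move: IH; congr bmeas; apply/funext => w; rewrite big_cons (negPf Qi).
Qed.

Lemma bmeasX f k : bmeas f -> bmeas (fun w => f w ^+ k).
Proof.
move=> bf; elim: k => [|k IH]; first exact: bmeas_cst.
by have := bmeasM bf IH; congr bmeas; apply/funext => w; rewrite exprS.
Qed.

Lemma bmeas_abs f : bmeas f -> bmeas (fun w => `|f w|).
Proof.
move=> [mf [M fM]]; split; first exact: measurableT_comp.
by exists M => w; rewrite normr_id.
Qed.

Lemma itgD f g : itg f -> itg g -> itg (fun w => f w + g w).
Proof.
move=> If Ig; have := @integrableD _ _ _ P _ measurableT _ _ If Ig.
by apply: eq_integrable.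
Qed.

Lemma itg_cst (c : R) : itg (fun=> c).
Proof. exact/bmeas_itg/bmeas_cst. Qed.

Lemma itgM f g : bmeas f -> bmeas g -> itg (fun w => f w * g w).
Proof. by move=> bf bg; exact/bmeas_itg/bmeasM. Qed.

Lemma itg_bmeasM f g : bmeas f -> itg g -> itg (fun w => f w * g w).
Proof.
move=> bf ig; have := integrableMr measurableT bf.1 (bmeas_bounded bf) ig.
by apply: eq_integrable.
Qed.

Lemma itgZ (c : R) g : itg g -> itg (fun w => c * g w).
Proof. by move=> ig; apply: itg_bmeasM => //; exact: bmeas_cst. Qed.

Lemma itgN f : itg f -> itg (fun w => - f w).
Proof.
by move=> /(itgZ (-1)); congr itg; apply/funext => w; rewrite mulN1r.
Qed.

Lemma itgB f g : itg f -> itg g -> itg (fun w => f w - g w).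
Proof. by move=> If /itgN; exact: itgD. Qed.

Lemma itg_sum I (r : seq I) (Q : pred I) (F : I -> T -> R) :
  (forall i, itg (F i)) -> itg (fun w => \sum_(i <- r | Q i) F i w).
Proof.
move=> bF; elim: r => [|i r IH].
  by have := bmeas_itg (bmeas_cst 0); congr itg; apply/funext => w; rewrite big_nil.
have [Qi|Qi] := boolP (Q i).
  have := itgD (bF i) IH.
  by congr itg; apply/funext => w; rewrite big_cons Qi.
by move: IH; congr itg; apply/funext => w; rewrite big_cons (negPf Qi).
Qed.

Lemma itg_le f g : measurable_fun setT f -> itg g ->
  (forall w, `|f w| <= g w) -> itg f.
Proof.
move=> mf ig fg; apply: le_integrable ig => //; first exact/measurable_EFinP.
move=> w _ /=; rewrite lee_fin; apply: le_trans (fg w) _; exact: ler_norm.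
Qed.

Lemma itg_meas f : itg f -> measurable_fun setT f.
Proof. by move=> /measurable_int /measurable_EFinP. Qed.

Lemma itg_abs f : itg f -> itg (fun w => `|f w|).
Proof.
move=> If; apply: itg_le (integrable_norm If) _.
  by apply: measurableT_comp => //; exact: itg_meas.
by move=> w /=; rewrite normr_id.
Qed.

Lemma meanD f g : itg f -> itg g -> mean (fun w => f w + g w) = mean f + mean g.
Proof. exact: RintegralD. Qed.

Lemma meanB f g : itg f -> itg g -> mean (fun w => f w - g w) = mean f - mean g.
Proof. exact: RintegralB. Qed.

Lemma meanZ (c : R) f : itg f -> mean (fun w => c * f w) = c * mean f.
Proof. by move=> If; exact: RintegralZl. Qed.

Lemma mean_cst (c : R) : mean (fun=> c) = c.
Proof. by rewrite /mean Rintegral_cst//= [P _](@probability_setT _ _ _ P) mulr1. Qed.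

Lemma mean_le f g : itg f -> itg g -> (forall w, f w <= g w) -> mean f <= mean g.
Proof. by move=> If Ig fg; apply: le_Rintegral. Qed.

Lemma mean_ge0 f : (forall w, 0 <= f w) -> 0 <= mean f.
Proof. by move=> f0; apply: Rintegral_ge0. Qed.

Lemma eq_mean f g : f =1 g -> mean f = mean g.
Proof. by move=> /funext ->. Qed.

Lemma mean_norm f : itg f -> `|mean f| <= mean (fun w => `|f w|).
Proof. by move=> If; apply: le_normr_Rintegral. Qed.

Lemma mean_sum I (r : seq I) (Q : pred I) (F : I -> T -> R) :
  (forall i, itg (F i)) ->
  mean (fun w => \sum_(i <- r | Q i) F i w) = \sum_(i <- r | Q i) mean (F i).
Proof.
move=> bF; elim: r => [|i r IH].
  by rewrite [RHS]big_nil -[RHS]mean_cst; apply: eq_mean => w; rewrite big_nil.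
rewrite big_cons -IH; have [Qi|Qi] := boolP (Q i).
  rewrite -meanD//; last exact: itg_sum.
  by apply: eq_mean => w; rewrite big_cons Qi.
by apply: eq_mean => w; rewrite big_cons (negPf Qi).
Qed.

Lemma integral_mean A f : measurable A -> itg f ->
  (\int[P]_(w in A) (f w)%:E)%E = (mean (fun w => \1_A w * f w))%:E.
Proof.
move=> mA If; rewrite integral_mkcond restrict_EFin patch_indic.
rewrite /mean /Rintegral fineK.
  by apply: eq_integral => w _ /=; rewrite mulrC.
apply: integrable_fin_num => //; apply: itg_bmeasM => //.
exact: bmeas_indic.
Qed.

Lemma mean_EFin f : itg f -> (\int[P]_w (f w)%:E)%E = (mean f)%:E.
Proof. by move=> If; rewrite /mean /Rintegral fineK//; exact: integrable_fin_num. Qed.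

Lemma cond_exp_mean (G : set_system T) f g A : <<s G >> `<=` measurable ->
  is_cond_exp P G f g -> <<s G >> A ->
  mean (fun w => \1_A w * g w) = mean (fun w => \1_A w * f w).
Proof.
move=> Gm [If Ig mg H] GA; have := H A GA; have mA := Gm _ GA.
by rewrite !integral_mean// => -[].
Qed.

Lemma mean_cond_exp (G : set_system T) f g : <<s G >> `<=` measurable ->
  itg f -> itg g -> measurable_fun setT (g : g_sigma_algebraType G -> R) ->
  (forall A, <<s G >> A ->
    mean (fun w => \1_A w * g w) = mean (fun w => \1_A w * f w)) ->
  is_cond_exp P G f g.
Proof.
move=> Gm If Ig mg H; split => // A GA; have mA := Gm _ GA.
by rewrite !integral_mean// H.
Qed.

(** Dynkin's lemma: the events on which both functions have the same mean are closed under
    complements, because the total means agree, and under countable disjoint unions. *)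
Lemma pi_system_mean (G : set_system T) f g : G `<=` measurable ->
  setI_closed G -> itg f -> itg g -> mean f = mean g ->
  (forall A, G A -> mean (fun w => \1_A w * f w) = mean (fun w => \1_A w * g w)) ->
  forall A, <<s G >> A -> mean (fun w => \1_A w * f w) = mean (fun w => \1_A w * g w).
Proof.
move=> Gm GI If Ig fg H A GA.
have sGm : <<s G >> `<=` measurable by apply: smallest_sub => //; exact: sigma_algebra_measurable.
have ET (h : T -> R) : (fun w => \1_[set: T] w * h w) = h.
  by apply/funext => w; rewrite indicT mul1r.
pose Q (B : set T) := (\int[P]_(w in B) (f w)%:E = \int[P]_(w in B) (g w)%:E)%E.
have QC B : measurable B -> Q B -> Q (~` B).
  move=> mB; have mBC := measurableC mB; rewrite /Q !integral_mean//.
  move=> [QB]; congr EFin; move: fg.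
  rewrite -{1}(ET f) -{1}(ET g).
  have split1 (h : T -> R) : itg h ->
     mean (fun w => \1_[set: T] w * h w) =
     mean (fun w => \1_B w * h w) + mean (fun w => \1_(~` B) w * h w).
    move=> Ih; rewrite -meanD; last 2 first.
    - by apply: itg_bmeasM => //; exact: bmeas_indic.
    - by apply: itg_bmeasM => //; apply: bmeas_indic; exact: measurableC.
    apply: eq_mean => w; rewrite -mulrDl indicT; congr (_ * _).
    by rewrite !indicE in_setC; case: (w \in B); rewrite ?addr0 ?add0r.
  by rewrite !split1// QB => /addrI.
have QU (F : (set T)^nat) : (forall n, measurable (F n)) ->
    trivIset setT F -> (forall n, Q (F n)) -> Q (\bigcup_k F k).
  move=> mF tF QF; rewrite /Q !integral_bigcup//.
  - by apply: eq_eseriesr => i _; exact: QF.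
  - apply: integrableS Ig => //; exact: bigcupT_measurable.
  - apply: integrableS If => //; exact: bigcupT_measurable.
have mA := sGm _ GA; suff : Q A by rewrite /Q !integral_mean// => -[].
apply: (@dynkin_induction _ (g_sigma_algebraType G) G Q) => //.
- by rewrite /Q !mean_EFin// fg.
- by move=> B GB; have mB := Gm _ GB; rewrite /Q !integral_mean// H.
- by move=> B mB; apply: QC; exact: sGm.
- by move=> F mF; apply: QU => n; apply: sGm; exact: mF.
Qed.

(** The sum is the integer part of [x], written with threshold indicators so that superlevel sets
    can be substituted for them. *)
Lemma floor_sum_bounds (x : R) K : 0 <= x -> x <= K%:R ->
  x - 1 <= \sum_(k < K) (k.+1%:R <= x)%R%:R <= x.
Proof.
move=> x0; elim: K => [|K IH].
  by move=> x0'; rewrite big_ord0 x0 andbT; lra.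
move=> xK; rewrite big_ord_recr/=.
have [xlt|xge] := leP x K%:R.
  have -> : (K.+1%:R <= x) = false.
    by apply/negbTE; rewrite -ltNge (le_lt_trans xlt)// ltr_nat.
  by rewrite addr0; exact: IH.
have -> : \sum_(i < K) (i.+1%:R <= x)%R%:R = K%:R :> R.
  under eq_bigr => i _.
    have -> : i.+1%:R <= x by apply: le_trans (ltW xge); rewrite ler_nat.
    over.
  by rewrite sumr_const card_ord.
have [h|h] := leP K.+1%:R x; move: xK xge h; rewrite -!natr1 => *; apply/andP; split; rewrite ?mulr1n ?mulr0n; lra.
Qed.

(* A bounded [<<s G >>]-measurable [Z] is a uniform limit of averages of
   indicators of its superlevel sets. *)
Lemma cond_exp_mul (G : set_system T) f g (Z : T -> R) : <<s G >> `<=` measurable ->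
  is_cond_exp P G f g ->
  measurable_fun setT (Z : g_sigma_algebraType G -> R) ->
  (exists M, forall w, `|Z w| <= M) ->
  mean (fun w => Z w * g w) = mean (fun w => Z w * f w).
Proof.
move=> Gm Hfg mZ [M ZM]; have [If Ig mg _] := Hfg.
have mZ' : measurable_fun setT Z.
  by move=> mT B mB; exact: (Gm _ (mZ measurableT B mB)).
have bZ : bmeas Z by split => //; exists M.
pose N := `|M| + 1.
have N0 : 0 < N by rewrite ltr_wpDl.
(* [Z] is rescaled affinely from [-N, N] to [0, K]. The number of these sets containing [w] is the
   integer part of the rescaled value, and [ZK] below undoes the rescaling, with error at most
   2N/K. *)
pose S (K k : nat) : set T := [set w | k.+1%:R <= (Z w + N) / (2 * N) * K%:R].
have GS K k : <<s G >> (S K k).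
  have mW : measurable_fun setT
      ((fun w => (Z w + N) / (2 * N) * K%:R) : g_sigma_algebraType G -> R).
    apply: measurable_funM => //; apply: measurable_funM => //.
    by apply: measurable_funD.
  have := mW measurableT `[k.+1%:R, +oo[%classic (measurable_itv _).
  rewrite setTI; congr (<<s _ >> _); apply/funext => w /=.
  by rewrite in_itv/= andbT.
pose ZK K w := \sum_(k < K) (\1_(S K k) w : R) * (2 * N / K%:R) - N.
have mZK h K : itg h -> mean (fun w => ZK K w * h w) =
   \sum_(k < K) (2 * N / K%:R) * mean (fun w => \1_(S K k) w * h w) - N * mean h.
  move=> Ih.
  have I1 k : itg (fun w => \1_(S K k) w * h w).
    by apply: itg_bmeasM => //; apply: bmeas_indic; apply: Gm; exact: GS.
  under [in RHS]eq_bigr => k _ do rewrite -meanZ//.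
  rewrite -mean_sum; last by move=> k; exact: itgZ.
  rewrite -meanZ// -meanB; last 2 first.
  - by apply: itg_sum => k; exact: itgZ.
  - exact: itgZ.
  apply: eq_mean => w; rewrite /ZK mulrBl mulr_suml; congr (_ - _).
  by apply: eq_bigr => k _; rewrite mulrAC mulrC.
have eqK K : mean (fun w => ZK K w * g w) = mean (fun w => ZK K w * f w).
  rewrite !mZK//; congr (_ - _); last first.
    congr (_ * _).
    have := cond_exp_mean Gm Hfg (@measurableT _ (g_sigma_algebraType G)).
    by under eq_mean do rewrite indicT mul1r; under [RHS]eq_mean do rewrite indicT mul1r.
  by apply: eq_bigr => k _; rewrite (cond_exp_mean Gm Hfg (GS K k)).
have close K w : (0 < K)%N -> `|Z w - ZK K w| <= 2 * N / K%:R.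
  move=> K0; have K0' : 0 < K%:R :> R by rewrite ltr0n.
  have Zb : - N <= Z w <= N.
    have := ZM w; have := ler_norm M; rewrite ler_norml /N => h /andP[h1 h2].
    by apply/andP; split; lra.
  set x := (Z w + N) / (2 * N) * K%:R.
  have x0 : 0 <= x by apply: mulr_ge0 => //; apply: divr_ge0; lra.
  have xK : x <= K%:R.
    rewrite /x -[leRHS]mul1r ler_wpM2r// ler_pdivrMr; lra.
  have := floor_sum_bounds x0 xK.
  set s := \sum_(k < K) _ => sb.
  have -> : ZK K w = s * (2 * N / K%:R) - N.
    rewrite /ZK -mulr_suml; congr (_ * _ - _); apply: eq_bigr => k _.
    by rewrite indicE; congr ((nat_of_bool _)%:R); apply/idP/idP => [/set_mem|h]//; apply/mem_set.
  have -> : Z w = x * (2 * N / K%:R) - N.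
    rewrite /x; field.
    by rewrite !lt0r_neq0.
  set y := 2 * N / K%:R; have y0 : 0 < y by apply: divr_gt0 => //; lra.
  move: sb => /andP[s1 s2].
  have -> : x * y - N - (s * y - N) = (x - s) * y by ring.
  rewrite normrM [`|y|]gtr0_norm// ger0_norm; last by lra.
  by rewrite ler_piMl//; [exact: ltW|lra].
have bZK K : bmeas (ZK K).
  apply: bmeasB; last exact: bmeas_cst.
  apply: bmeas_sum => k; apply: bmeasM; last exact: bmeas_cst.
  by apply: bmeas_indic; apply: Gm; exact: GS.
have diff h K : itg h -> (0 < K)%N ->
    `|mean (fun w => Z w * h w) - mean (fun w => ZK K w * h w)| <=
    2 * N / K%:R * mean (fun w => `|h w|).
  move=> Ih K0; rewrite -meanB; try exact: itg_bmeasM.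
  apply: le_trans (mean_norm _) _; first by apply: itgB; exact: itg_bmeasM.
  rewrite -meanZ; last exact: itg_abs.
  apply: mean_le.
  - by apply: itg_abs; apply: itgB; exact: itg_bmeasM.
  - by apply: itgZ; exact: itg_abs.
  - by move=> w; rewrite -mulrBl normrM ler_wpM2r// close.
pose c := mean (fun w => `|g w|) + mean (fun w => `|f w|).
have c0 : 0 <= c by apply: addr_ge0; apply: mean_ge0.
have fin K : (0 < K)%N ->
    `|mean (fun w => Z w * g w) - mean (fun w => Z w * f w)| <= 2 * N * c / K%:R.
  move=> K0; have h1 := diff g K Ig K0; have h2 := diff f K If K0.
  rewrite eqK in h1.
  rewrite -(subrKA (mean (fun w => ZK K w * f w))).
  apply: le_trans (ler_normD _ _) _; rewrite (distrC (mean (fun w => ZK K w * f w))).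
  apply: le_trans (lerD h1 h2) _; rewrite -mulrDr -/c.
  by rewrite mulrAC.
apply/eqP; rewrite -subr_eq0 -normr_le0; apply/ler_addgt0Pr => e e0; rewrite add0r.
pose K := (Num.truncn (e^-1 * (2 * N * c))).+1.
apply: le_trans (fin K isT) _.
rewrite ler_pdivrMr ?ltr0n// -ler_pdivrMl//.
by apply: ltW; apply: truncnS_gt.
Qed.

(** The hypothesis is tested on the event where the conclusion fails: with [A] the set where
    [eta < Z], the nonnegative function [\1_A w * (Z w - eta)] has mean at most 0, hence vanishes
    almost everywhere. *)
Lemma ae_le_of_mean (G : set_system T) (Z : T -> R) (eta : R) : <<s G >> `<=` measurable ->
  itg Z -> measurable_fun setT (Z : g_sigma_algebraType G -> R) ->
  (forall A, <<s G >> A -> mean (fun w => \1_A w * Z w) <= eta * mean (\1_A)) ->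
  {ae P, forall w, Z w <= eta}.
Proof.
move=> Gm IZ mZ H.
pose A := [set w | eta < Z w].
have GA : <<s G >> A.
  have := mZ measurableT `]eta, +oo[%classic (measurable_itv _).
  rewrite setTI; congr (<<s _ >> _); apply/funext => w /=.
  by rewrite in_itv/= andbT.
have mA := Gm _ GA.
have b1 := bmeas_indic mA.
pose h w := \1_A w * (Z w - eta).
have h0 w : 0 <= h w.
  rewrite /h indicE; have [/set_mem/= wA|wA] := boolP (w \in A); last by rewrite mul0r.
  by rewrite mul1r subr_ge0 ltW.
have Ih : itg h by apply: itg_bmeasM => //; apply: itgB => //; exact: itg_cst.
have mh : mean h = 0.
  apply/eqP; rewrite eq_le mean_ge0// andbT.
  have -> : mean h = mean (fun w => \1_A w * Z w) - eta * mean (\1_A).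
    rewrite -meanZ; last exact: bmeas_itg.
    rewrite -meanB; [|exact: itg_bmeasM|by apply: itgZ; exact: bmeas_itg].
    by apply: eq_mean => w; rewrite /h; ring.
  by rewrite subr_le0; exact: H.
have /(ae_eq_integral_abs P measurableT) : measurable_fun setT (EFin \o h).
  by apply/measurable_EFinP; exact: itg_meas.
move=> [+ _].
rewrite (_ : (\int[P]_(x in setT) `|(EFin \o h) x|)%E = 0%E); last first.
  rewrite -[RHS]/(0%:E) -mh -mean_EFin//; apply: eq_integral => w _ /=.
  by rewrite ger0_norm.
move=> /(_ erefl); apply: filterS => w /(_ I) /= [hw].
rewrite leNgt; apply/negP => wA.
move: hw; rewrite /h indicE mem_set// mul1r => /eqP; rewrite subr_eq0 => /eqP e.
by move: wA; rewrite e ltxx.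
Qed.

End mean.

(** * Dominated convergence and Riemann sums *)

Section dominated_Rintegral.
Context {d : measure_display} {T : measurableType d} {R : realType}.
Variable mu : {measure set T -> \bar R}.

(** Integrability of the limit is part of the conclusion: this is how it is obtained for [F]
    evaluated along the limit path. *)
Lemma dominated_Rintegral (D : set T) (f_ : nat -> T -> R) (f g : T -> R) :
  measurable D -> (forall n, measurable_fun D (f_ n)) ->
  (forall x, D x -> f_ ^~ x @ \oo --> f x) ->
  mu.-integrable D (EFin \o g) ->
  (forall n x, D x -> `|f_ n x| <= g x) ->
  mu.-integrable D (EFin \o f) /\
  (fun n => \int[mu]_(x in D) f_ n x) @ \oo --> \int[mu]_(x in D) f x.
Proof.
move=> mD mf_ f_f ig fg.
have mf : measurable_fun D f by exact: measurable_fun_cvg mf_ f_f.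
have [] := @dominated_convergence _ _ _ mu _ mD (fun n => EFin \o f_ n) (EFin \o f) (EFin \o g).
- by move=> n; exact/measurable_EFinP.
- exact/measurable_EFinP.
- apply: aeW => x Dx; apply: cvg_EFin; [exact: nearW|exact: f_f].
- exact: ig.
- by apply: aeW => x n Dx /=; rewrite lee_fin fg.
move=> If _ cv; split => //.
apply: fine_cvg; rewrite /Rintegral fineK//; exact: integrable_fin_num.
Qed.

End dominated_Rintegral.

Section riemann_sums.
Context {R : realType}.
Notation mu := (@lebesgue_measure R).

Lemma cvg_harmonic_scale (c : R) : (fun K => c / K.+1%:R) @ \oo --> (0 : R).
Proof. by rewrite -(mulr0 c); apply: cvgMr; exact: cvg_harmonic. Qed.

(* The step functions taking on [x_k, x_(k+1)[ the value of [f] at the right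
   endpoint converge pointwise to a right-continuous [f]. *)
Lemma riemann_sum_cvg (f : R -> R) (a b M : R) : a < b ->
  (forall u, a <= u -> u < b -> f v @[v --> u^'+] --> f u) ->
  (forall u, a <= u -> u <= b -> `|f u| <= M) ->
  mu.-integrable `[a, b] (EFin \o f) /\
  (fun K => \sum_(k < K.+1) (b - a) / K.+1%:R * f (a + (b - a) / K.+1%:R * k.+1%:R))
    @ \oo --> \int[mu]_(u in `[a, b]) f u.
Proof.
move=> ab fr fM.
pose h (K : nat) := (b - a) / K.+1%:R.
have h0 K : 0 < h K by rewrite divr_gt0 ?subr_gt0.
have hK K : h K * K.+1%:R = b - a by rewrite divfK// pnatr_eq0.
pose x K (k : nat) := a + h K * k%:R.
have xS K k : x K k.+1 = x K k + h K by rewrite /x -natr1 mulrDr mulr1 addrA.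
have xa K k : a <= x K k by rewrite lerDl mulr_ge0// ltW.
have xb K k : (k <= K.+1)%N -> x K k <= b.
  by move=> kK; rewrite /x -lerBrDl -(hK K); apply: ler_wpM2l; [exact: ltW|rewrite ler_nat].
pose I K k := `[x K k, x K k.+1[%classic : set R.
have mI K k : measurable (I K k) by exact: measurable_itv.
pose g K (u : R) := \sum_(k < K.+1) f (x K k.+1) * \1_(I K k) u.
(* Cells are closed on the left and open on the right, so the right endpoint [v] is strictly to the
   right of [u], where right-continuity applies. *)
have gv K u : a <= u -> u < b -> exists2 v, u < v <= u + h K & g K u = f v /\ v <= b.
  move=> au ub.
  pose k0 := Num.truncn ((u - a) / h K).
  have ua0 : 0 <= (u - a) / h K by rewrite divr_ge0 ?subr_ge0// ltW.
  have /truncn_itv /andP[k0l k0u] := ua0.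
  have k0K : (k0 < K.+1)%N.
    rewrite truncn_lt_nat// ltr_pdivrMr// mulrC hK ltrD2r//.
  have I0 : I K k0 u.
    rewrite /I/= in_itv/=; apply/andP; split.
      by rewrite /x -lerBrDl mulrC -ler_pdivlMr.
    by rewrite /x -ltrBlDl mulrC -ltr_pdivrMr.
  exists (x K k0.+1).
    move: I0; rewrite /I/= in_itv/= => /andP[Il ->] /=.
    by rewrite xS lerD2r.
  split; last exact: xb.
  rewrite /g (bigD1 (Ordinal k0K))//= indicE mem_set//= mulr1 big1 ?addr0// => -[k kK] /= nk.
  rewrite indicE memNset ?mulr0// /I/= in_itv/= => /andP[ukl uku].
  move/eqP: nk; apply; apply/val_inj => /=.
  apply/esym/eqP; rewrite /k0; apply/eqP/truncn_def.
  rewrite ler_pdivlMr// ltr_pdivrMr// mulrC lerBrDl ukl/=.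
  by rewrite mulrC ltrBlDl.
have mg K : measurable_fun (`[a, b[%classic : set R) (g K).
  apply: measurable_sum => k; apply: measurable_funM; first exact: measurable_cst.
  exact: measurable_indic.
have gM K u : `[a, b[%classic u -> `|g K u| <= M.
  rewrite /= in_itv/= => /andP[au ub].
  have [v /andP[uv _] [-> vb]] := gv K _ au ub.
  by apply: fM => //; apply: le_trans au (ltW uv).
have gf u : `[a, b[%classic u -> g ^~ u @ \oo --> f u.
  rewrite /= in_itv/= => /andP[au ub].
  apply/cvgrPdist_lt => e e0.
  have /cvgrPdist_lt/(_ e e0) := fr u au ub.
  rewrite near_withinE => -[del /= del0 H].
  have /cvgrPdist_lt/(_ del del0) := cvg_harmonic_scale (b - a).
  apply: filterS => K; rewrite sub0r normrN -/(h K) gtr0_norm// => hdel.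
  have [v /andP[uv vh] [-> _]] := gv K _ au ub.
  apply: H => //=; rewrite distrC gtr0_norm ?subr_gt0//.
  by rewrite ltrBlDl (le_lt_trans vh)// ltrD2l.
have muab : (mu `[a, b[ < +oo)%E.
  by rewrite lebesgue_measure_itv/= lte_fin ab -EFinD ltry.
have IM : mu.-integrable `[a, b[ (EFin \o (cst M : R -> R)).
  apply: measurable_bounded_integrable => //.
  by exists `|M|; split; [exact: num_real|move=> y My u _ /=; exact: ltW].
have [If cv] := @dominated_Rintegral _ _ _ mu `[a, b[%classic g f (cst M)
  (measurable_itv _) mg gf IM gM.
(* The point [b] lies in no cell, so convergence is shown on the half-open interval and transferred
   to the closed one, which differs by a null set. *)
have If' : mu.-integrable `[a, b] (EFin \o f).
  have mIf := measurable_int _ If.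
  move/integrableP : If => [mf ioo]; apply/integrableP; split.
    exact: (emeasurable_fun_itv_bndo_bndcP _ _ _).1 mf.
  by rewrite -integral_itv_bndo_bndc//; exact: measurableT_comp.
split => //.
rewrite -Rintegral_itv_bndo_bndc//.
apply: cvg_trans cv; apply: near_eq_cvg; apply: nearW => K.
have Ik c k : mu.-integrable `[a, b[ (EFin \o (fun u => c * \1_(I K k) u)).
  apply: measurable_bounded_integrable => //.
    by apply: measurable_funM => //; apply: measurable_indic; exact: mI.
  exists `|c|; split; first exact: num_real.
  move=> y My u _ /=; rewrite normrM indicE; apply: le_trans (ltW My).
  by case: (u \in _); rewrite ?normr1 ?mulr1 ?normr0 ?mulr0.
rewrite /g /Rintegral.
under eq_integral do rewrite -sumEFin.
rewrite integral_sum//; last by move=> k; exact: Ik.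
rewrite -sum_fine; last by move=> k _; apply: integrable_fin_num => //; exact: Ik.
apply: eq_bigr => k _.
rewrite -[LHS]/(\int[mu]_(u in `[a, b[) (f (x K k.+1) * \1_(I K k) u)).
rewrite RintegralZl//; last first.
  by have := Ik 1 k; congr (integrable _ _ _); apply/funext => u /=; rewrite mul1r.
rewrite mulrC; congr (_ * _).
rewrite /Rintegral integral_indic//.
have -> : I K k `&` `[a, b[ = I K k.
  apply/setIidl => u; rewrite /I/= !in_itv/= => /andP[h1 h2].
  rewrite (le_trans (xa K k) h1)/=; apply: lt_le_trans h2 _.
  by apply: xb.
  have e : mu `[x K k, x K k.+1[ = (h K)%:E.
    rewrite lebesgue_measure_itv/= lte_fin xS ltrDl h0 -EFinB/=.
    by rewrite addrC addKr.
  exact: (congr1 fine e).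
exact: mI.
Qed.

End riemann_sums.

(** * Default times given the chain *)

Section generated.
Context {d : measure_display} {T : measurableType d} {R : realType}.
Implicit Types (G H : set_system T) (Z : T -> R).

Definition gmeas G Z := measurable_fun setT (Z : g_sigma_algebraType G -> R).

(** Being [bmeas] on another measurable type, it inherits the closure lemmas proved for [bmeas]. *)
Definition gbmeas G Z := bmeas (Z : g_sigma_algebraType G -> R).

Lemma sub_gen G : G `<=` <<s G >>.
Proof. exact: sub_gen_smallest. Qed.

Lemma sub_gen_sigma G H : G `<=` <<s H >> -> <<s G >> `<=` <<s H >>.
Proof. by move=> GH; apply: smallest_sub => //; exact: smallest_sigma_algebra. Qed.

Lemma gen_sigma_measurable G : G `<=` measurable -> <<s G >> `<=` (measurable : set_system T).
Proof. by move=> GH; apply: smallest_sub => //; exact: sigma_algebra_measurable. Qed.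

Lemma gmeasS G H Z : <<s G >> `<=` <<s H >> -> gmeas G Z -> gmeas H Z.
Proof. by move=> GH mZ mT B mB; exact: (GH _ (mZ measurableT B mB)). Qed.

Lemma gbmeasS G H Z : <<s G >> `<=` <<s H >> -> gbmeas G Z -> gbmeas H Z.
Proof. by move=> GH [mZ bZ]; split => //; exact: gmeasS mZ. Qed.

Lemma gmeas_meas G Z : <<s G >> `<=` measurable -> gmeas G Z -> measurable_fun setT Z.
Proof. by move=> Gm mZ mT B mB; exact: (Gm _ (mZ measurableT B mB)). Qed.

Lemma gbmeas_bmeas G Z : <<s G >> `<=` measurable -> gbmeas G Z -> bmeas Z.
Proof. by move=> Gm [mZ bZ]; split => //; exact: gmeas_meas mZ. Qed.

Lemma gen_setI G A B : <<s G >> A -> <<s G >> B -> <<s G >> (A `&` B).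
Proof. exact: (@measurableI _ (g_sigma_algebraType G)). Qed.

Lemma gen_setT G : <<s G >> setT.
Proof. exact: (@measurableT _ (g_sigma_algebraType G)). Qed.

Lemma gbmeas_indic G A : <<s G >> A -> gbmeas G (\1_A).
Proof. by move=> GA; exact: (@bmeas_indic _ (g_sigma_algebraType G)). Qed.

Lemma events_of_gmeas (I : Type) (D : set I) (Y : I -> T -> R) i G :
  events_of D Y `<=` <<s G >> -> D i -> gmeas G (Y i).
Proof.
move=> YG Di mT B mB; apply: YG; exists i => //.
by exists B => //; rewrite setTI.
Qed.

Lemma sub_events_of (I : Type) (D : set I) (Y : I -> T -> R) G :
  (forall i, D i -> gmeas G (Y i)) -> events_of D Y `<=` <<s G >>.
Proof. by move=> H A [i Di [B mB <-]]; exact: (H i Di measurableT B mB). Qed.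

Lemma sub_events_of_measurable (I : Type) (D : set I) (Y : I -> T -> R) :
  (forall i, D i -> measurable_fun setT (Y i)) -> events_of D Y `<=` measurable.
Proof. by move=> H A [i Di [B mB <-]]; exact: (H i Di measurableT B mB). Qed.

Lemma gen_eq1 G Z (c : R) : gmeas G Z -> <<s G >> [set w | Z w = c].
Proof. by move=> mZ; have := mZ measurableT [set c] (measurable_set1 c); rewrite setTI. Qed.

Lemma indic_bool (b : T -> bool) w : \1_[set w | b w] w = (b w)%:R :> R.
Proof.
by rewrite indicE; congr (nat_of_bool _)%:R; apply/idP/idP => [/set_mem|h]//; exact/mem_set.
Qed.

Lemma indic_eq (f : T -> nat) i w : \1_[set w | f w = i] w = (f w == i)%:R :> R.
Proof.
by rewrite -(indic_bool (fun v => f v == i)); congr (\1__ _); apply/seteqP; split => v /eqP.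
Qed.

Lemma indicI_mul (A B : set T) w : \1_(A `&` B) w = \1_A w * \1_B w :> R.
Proof. by rewrite indicI. Qed.

Lemma indic_bigcap (I : finType) (A : I -> set T) w :
  \1_(\bigcap_(k in [set: I]) A k) w = \prod_k \1_(A k) w :> R.
Proof.
rewrite indicE; have [/set_mem h|/negP h] := boolP (_ \in _).
  by rewrite big1// => k _; rewrite indicE mem_set//; exact: h.
have [k hk] : exists k, ~ A k w.
  by apply/existsNP => h'; apply: h; apply/mem_set => k _; exact: h'.
by rewrite (bigD1 k)//= indicE memNset// mul0r.
Qed.

End generated.

Section default_identities.
Context {R : realType} {m n : nat} {d : measure_display} {T : measurableType d}.
Variables (P : probability T R) (Q : 'M[R]_m) (lam : 'cV[R]_m).
Hypothesis lam0 : forall k, 0 <= lam k 0.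
Variables (X : R -> T -> 'cV[R]_m) (hX : markov_chain P Q X).
Variables (a : R) (a0 : 0 < a) (tau : 'I_n -> T -> \bar R).
Hypothesis ht : default_times P lam X a tau.

Local Notation Y := (speed_up X a).
Local Notation FX := (chain_events X `[0, +oo[).
Local Notation GY s := (chain_events Y `[0, s]).
Local Notation Fa s := (default_filtration X a tau s).

Lemma Y_entry t w k : 0 <= t -> Y t w k 0 = 0 \/ Y t w k 0 = 1.
Proof.
move=> t0; have [i ->] : exists i, Y t w = delta_mx i 0.
  by apply: (chain_values hX); rewrite mulr_ge0// ltW.
by rewrite mxE eqxx andbT; case: eqP; [right|left].
Qed.

Lemma Y_eqE t w i : 0 <= t -> (Y t w = delta_mx i 0) <-> (Y t w i 0 = 1).
Proof.
move=> t0; have [j ->] : exists i, Y t w = delta_mx i 0.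
  by apply: (chain_values hX); rewrite mulr_ge0// ltW.
rewrite mxE eqxx andbT; split; first by move=> /matrixP/(_ i 0); rewrite !mxE !eqxx andbT => ->.
by case: eqP => [->//|_] /eqP; rewrite eq_sym oner_eq0.
Qed.

Lemma indic_Y t w i : 0 <= t -> \1_[set w | Y t w = delta_mx i 0] w = Y t w i 0.
Proof.
move=> t0; rewrite indicE; have [h|h] := boolP (_ \in _).
  by move/set_mem : h => /= /(Y_eqE w i t0) ->.
case: (Y_entry w i t0) => [->//|/(Y_eqE w i t0) e].
by case/negP: h; apply/mem_set.
Qed.

Lemma sum_Y t w : 0 <= t -> \sum_k Y t w k 0 = 1.
Proof.
move=> t0; have [j ->] : exists i, Y t w = delta_mx i 0.
  by apply: (chain_values hX); rewrite mulr_ge0// ltW.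
rewrite (bigD1 j)//= mxE !eqxx big1 ?addr0// => i /negPf ij.
by rewrite mxE ij.
Qed.

Lemma chain_events_measurable D : D `<=` `[0, +oo[ ->
  <<s chain_events X D >> `<=` measurable.
Proof.
move=> D0; apply: gen_sigma_measurable => A [k _]; apply: sub_events_of_measurable.
by move=> u /D0; rewrite /= in_itv/= andbT => u0; exact: (chain_measurable hX).
Qed.

Lemma FX_measurable : <<s FX >> `<=` measurable.
Proof. exact: chain_events_measurable. Qed.

Lemma GYE s : GY s = chain_events X `[0, a * s].
Proof.
apply/seteqP; split => A [k _ [u]]; rewrite /= in_itv/= => /andP[u0 us] [B mB <-].
  exists k => //; exists (a * u); last by exists B.
  by rewrite /= in_itv/= mulr_ge0/= ?ler_wpM2l// ltW.
exists k => //; exists (u / a).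
  by rewrite /= in_itv/= divr_ge0/= ?ler_pdivrMr// 1?mulrC// ltW.
by exists B => //; rewrite /speed_up mulrC divfK// lt0r_neq0.
Qed.

Lemma GY_FX s : <<s GY s >> `<=` <<s FX >>.
Proof.
apply: sub_gen_sigma; apply: subset_trans (@sub_gen _ _ _).
rewrite GYE => A [k _ [u us uA]]; exists k => //; exists u => //.
by move: us; rewrite /= !in_itv/= => /andP[->].
Qed.

Lemma GY_mono s t : s <= t -> <<s GY s >> `<=` <<s GY t >>.
Proof.
move=> st; apply: sub_gen_sigma; apply: subset_trans (@sub_gen _ _ _).
move=> A [k _ [u us uA]]; exists k => //; exists u => //.
by move: us; rewrite /= !in_itv/= => /andP[->]/= /le_trans; apply.
Qed.

Lemma gbmeas_Y t s k : 0 <= t -> t <= s -> gbmeas (GY s) (fun w => Y t w k 0).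
Proof.
move=> t0 ts; split.
  apply: (@events_of_gmeas _ _ _ _ `[0, s]%classic (fun u w => Y u w k 0)).
    by move=> A HA; apply: sub_gen; exists k.
  by rewrite /= in_itv/= t0.
by exists 1 => w; case: (Y_entry w k t0) => ->; rewrite ?normr0 ?normr1.
Qed.

Definition rate u w := (lam^T *m Y u w) 0 0.

Lemma rateE u w : rate u w = \sum_k lam k 0 * Y u w k 0.
Proof. by rewrite /rate mxE; apply: eq_bigr => k _; rewrite mxE. Qed.

Let L := \sum_k lam k 0.

Lemma rate_bounds u w : 0 <= u -> 0 <= rate u w <= L.
Proof.
move=> u0; rewrite rateE; apply/andP; split.
  by apply: sumr_ge0 => k _; case: (Y_entry w k u0) => ->; rewrite ?mulr0 ?mulr1.
by apply: ler_sum => k _; case: (Y_entry w k u0) => ->; rewrite ?mulr0 ?mulr1.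
Qed.

Lemma gbmeas_rate t s : 0 <= t -> t <= s -> gbmeas (GY s) (rate t).
Proof.
move=> t0 ts; have -> : rate t = fun w => \sum_k lam k 0 * Y t w k 0.
  by apply/funext => w; exact: rateE.
apply: bmeas_sum => k; apply: bmeasM; first exact: bmeas_cst.
exact: gbmeas_Y.
Qed.

Lemma rate_right w u : 0 <= u -> rate v w @[v --> u^'+] --> rate u w.
Proof.
move=> u0.
have Xc k : X v w k 0 @[v --> (a * u)^'+] --> X (a * u) w k 0.
  apply: (@cvg_comp _ _ _ (X ^~ w) (fun M : 'cV[R]_m => M k 0)); last first.
    exact: coord_continuous.
  by apply: (chain_cadlag hX w).1; rewrite mulr_ge0// ltW.
have ac : (fun v => a * v) @ u^'+ --> (a * u)^'+.
  move=> A [e /= e0 H]; have : \forall v \near u^'+, A (a * v); last by [].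
  near=> v; have uv : u < v by near: v; exact: nbhs_right_gt.
  apply: H => /=; last by rewrite ltr_pM2l.
  rewrite -mulrBr normrM gtr0_norm// mulrC -ltr_pdivlMr//.
  rewrite distrC gtr0_norm ?subr_gt0// ltrBlDl.
  by near: v; apply: nbhs_right_lt; rewrite ltrDl divr_gt0.
have -> : rate ^~ w = fun v => \sum_k lam k 0 * Y v w k 0.
  by apply/funext => v; exact: rateE.
rewrite rateE; apply: cvg_big => [|k _]; first exact: add_continuous.
apply: cvgMr.
exact: (cvg_comp _ _ ac (Xc k)).
Unshelve. all: by end_near. Qed.

Definition hazard s t w := \int[lebesgue_measure]_(u in `[s, t]) rate u w.

Lemma integrable_rate s t w : 0 <= s ->
  lebesgue_measure.-integrable `[s, t] (EFin \o rate ^~ w).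
Proof.
move=> s0; have [st|] := ltP s t.
  apply: (@riemann_sum_cvg _ _ _ _ L st _ _).1.
    by move=> u su _; apply: rate_right; exact: le_trans su.
  move=> u su _; have /andP[h1 h2] := rate_bounds w (le_trans s0 su).
  by rewrite ger0_norm.
rewrite le_eqVlt => /predU1P[->|ts].
  rewrite set_itv1; apply/integrableP; split; first exact: measurable_fun_set1.
  by rewrite integral_set1.
by rewrite set_itv_ge ?integrable_set0// bnd_simp -ltNge.
Qed.

Lemma hazard_riemann s t w : 0 <= s -> s < t ->
  (fun K => \sum_(k < K.+1) (t - s) / K.+1%:R *
     rate (s + (t - s) / K.+1%:R * k.+1%:R) w) @ \oo --> hazard s t w.
Proof.
move=> s0 st; apply: (@riemann_sum_cvg _ (rate ^~ w) _ _ L st _ _).2.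
  by move=> u su _; apply: rate_right; exact: le_trans su.
move=> u su _; have /andP[h1 h2] := rate_bounds w (le_trans s0 su).
by rewrite ger0_norm.
Qed.

Lemma hazard_refl s w : hazard s s w = 0.
Proof. by rewrite /hazard set_itv1 Rintegral_set1. Qed.

Lemma hazard_bounds s t w : 0 <= s -> s <= t -> 0 <= hazard s t w <= L * (t - s).
Proof.
move=> s0 st; apply/andP; split.
  apply: Rintegral_ge0 => u; rewrite /= in_itv/= => /andP[su _].
  by have /andP[] := rate_bounds w (le_trans s0 su).
have -> : L * (t - s) = \int[lebesgue_measure]_(u in `[s, t]) (cst L u).
  rewrite Rintegral_cst//; congr (_ * _).
  have : lebesgue_measure `[s, t] = (t - s)%:E.
    rewrite lebesgue_measure_itv/= lte_fin; case: ltP => [_|ts]; first by rewrite -EFinB.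
    by congr EFin; apply/esym/eqP; rewrite subr_eq0 eq_le st ts.
  by move=> h; exact: (esym (congr1 fine h)).
apply: le_Rintegral => //; first exact: integrable_rate.
  have muab : (lebesgue_measure (`[s, t]%classic : set R) < +oo)%E.
    by rewrite lebesgue_measure_itv; case: ifP => _; rewrite /= ?ltry//; exact: ltry.
  apply: measurable_bounded_integrable => //.
  by exists `|L|; split; [exact: num_real|move=> y My u _ /=; exact: ltW].
move=> u; rewrite /= in_itv/= => /andP[su _].
by have /andP[] := rate_bounds w (le_trans s0 su).
Qed.

Lemma hazardD s t w : 0 <= s -> s <= t -> hazard 0 t w = hazard 0 s w + hazard s t w.
Proof.
move=> s0 st; have I0 := @integrable_rate 0 t w (lexx _).
have := @Rintegral_itvB _ (rate ^~ w) (BLeft 0) (BRight t) s I0.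
rewrite !bnd_simp => /(_ s0 st); rewrite -/(hazard 0 t w) -/(hazard 0 s w).
rewrite Rintegral_itv_obnd_cbnd; first by rewrite -/(hazard s t w) => <-; rewrite addrC subrK.
apply: integrableS (integrable_rate t w s0) => //.
by apply: subset_itvr; rewrite bnd_simp.
Qed.

(** Measurability in [w] of the time integral comes from its being a pointwise limit of Riemann
    sums, which involve the chain at finitely many times up to [t]. *)
Lemma gmeas_hazard s t : 0 <= s -> s <= t -> gmeas (GY t) (hazard s t).
Proof.
move=> s0; rewrite le_eqVlt => /predU1P[->|st].
  by have -> : hazard t t = cst 0; [apply/funext => w; exact: hazard_refl|exact: measurable_cst].
apply: (@measurable_fun_cvg _ (g_sigma_algebraType (GY t)) _ _ (fun K w => \sum_(k < K.+1) (t - s) / K.+1%:R *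
     rate (s + (t - s) / K.+1%:R * k.+1%:R) w)).
  move=> K; apply: measurable_sum => k; apply: measurable_funM => //.
  apply: (@gbmeas_rate _ _ _ _).1.
    by rewrite addr_ge0// mulr_ge0// divr_ge0// subr_ge0 ltW.
  have ts : 0 <= t - s by rewrite subr_ge0 ltW.
  rewrite -lerBrDl -mulrA ler_piMr// mulrC ler_pdivrMr// mul1r ler_nat.
  exact: ltn_ord.
by move=> w _; exact: hazard_riemann.
Qed.

Definition surv s t w := expR (- hazard s t w).

Lemma surv01 s t w : 0 <= s -> s <= t -> 0 <= surv s t w <= 1.
Proof.
move=> s0 st; rewrite expR_ge0/= expR_le1 oppr_le0.
by have /andP[] := hazard_bounds w s0 st.
Qed.

Lemma survM s t w : 0 <= s -> s <= t -> surv 0 t w = surv 0 s w * surv s t w.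
Proof. by move=> s0 st; rewrite /surv -expRD -opprD -hazardD. Qed.

Lemma gbmeas_surv s t u : 0 <= s -> s <= t -> t <= u -> gbmeas (GY u) (surv s t).
Proof.
move=> s0 st tu; split.
  apply: (measurableT_comp (@measurable_expR R)); apply: measurableT_comp => //.
  by apply: gmeasS (GY_mono tu) _; exact: gmeas_hazard.
exists 1 => w; have /andP[h1 h2] := surv01 w s0 st.
by rewrite ger0_norm.
Qed.

Lemma measurable_le_ereal (v : \bar R) : measurable [set x : \bar R | (x <= v)%E].
Proof.
rewrite (_ : [set _ | _] = `]-oo, v]%classic); first exact: emeasurable_itv.
by apply/seteqP; split=> x /=; rewrite in_itv.
Qed.

Lemma measurable_gt_ereal (v : \bar R) : measurable [set x : \bar R | (v < x)%E].
Proof.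
rewrite (_ : [set _ | _] = `]v, +oo[%classic); first exact: emeasurable_itv.
by apply/seteqP; split=> x /=; rewrite in_itv/= andbT.
Qed.

Lemma measurable_tau k (B : set (\bar R)) : measurable B -> measurable (tau k @^-1` B).
Proof.
by move=> mB; have := default_measurable ht k measurableT mB; rewrite setTI.
Qed.

Lemma measurable_tau_gt k (v : \bar R) : measurable [set w | (v < tau k w)%E].
Proof. exact: (@measurable_tau k _ (measurable_gt_ereal v)). Qed.

Lemma measurable_tau_le k (v : \bar R) : measurable [set w | (tau k w <= v)%E].
Proof. exact: (@measurable_tau k _ (measurable_le_ereal v)). Qed.

Definition le_prob (v : \bar R) w : R := if v is r%:E then 1 - surv 0 r w else 1.

(** For [level t v], the conditional probability given the chain of [tau] lying in
    [le_gt_set b t v]. When [b] holds and [v] is finite, the constraints t < tau and tau <= v <= t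
    contradict each other, hence the value 0. *)
Definition le_gt_prob (b : bool) (t : R) (v : \bar R) w : R :=
  if b then (if v is r%:E then 0 else surv 0 t w) else le_prob v w.

Definition le_gt_set (b : bool) (t : R) (v : \bar R) : set (\bar R) :=
  [set x | (x <= v)%E] `&` (if b then [set x | (t%:E < x)%E] else setT).

(** The threshold [+oo] stands for no constraint: every default time then carries exactly one
    threshold, and intersections amount to minima of thresholds. *)
Definition level (s : R) (v : \bar R) :=
  v = +oo%E \/ exists r : R, [/\ 0 <= r, r <= s & v = r%:E].

Lemma measurable_le_gt_set b t v : measurable (le_gt_set b t v).
Proof.
apply: measurableI; first exact: measurable_le_ereal.
by case: b => //; exact: measurable_gt_ereal.
Qed.

Lemma gbmeas_surv_FX t : 0 <= t -> gbmeas FX (surv 0 t).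
Proof. by move=> t0; apply: gbmeasS (@GY_FX t) _; exact: gbmeas_surv. Qed.

Lemma cond_prob_le_gt k b t v : 0 <= t -> level t v ->
  is_cond_prob P FX (tau k @^-1` le_gt_set b t v) (le_gt_prob b t v).
Proof.
move=> t0 lv.
have mB := measurable_tau k (measurable_le_gt_set b t v).
have gp : gbmeas FX (le_gt_prob b t v).
  case: lv => [->|[r [r0 rt ->]]]; rewrite /le_gt_prob /le_prob; case: b {mB}.
  - exact: gbmeas_surv_FX.
  - exact: bmeas_cst.
  - exact: bmeas_cst.
  - by apply: bmeasB; [exact: bmeas_cst|exact: gbmeas_surv_FX].
apply: (mean_cond_exp FX_measurable).
- by apply: bmeas_itg; exact: bmeas_indic.
- by apply: bmeas_itg; apply: gbmeas_bmeas gp; exact: FX_measurable.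
- exact: gp.1.
move=> A GA; have mA := FX_measurable GA.
case: lv mB gp => [->|[r [r0 rt ->]]] mB gp; rewrite /le_gt_prob /le_prob; case: b mB gp => mB gp.
- rewrite (cond_exp_mean FX_measurable (default_survival ht k t0) GA).
  apply: eq_mean => w; congr (_ * _); rewrite !indicE; congr (nat_of_bool _)%:R.
  by apply/idP/idP => /set_mem h; apply/mem_set; rewrite /le_gt_set/= ?leey//; case: h.
- apply: eq_mean => w; congr (_ * _); rewrite indicE mem_set//.
  by rewrite /le_gt_set/= leey.
- apply: eq_mean => w; congr (_ * _); rewrite indicE memNset// => -[/= h1 h2].
  have := lt_le_trans h2 h1; rewrite lte_fin => tr.
  by have := lt_le_trans tr rt; rewrite ltxx.
have e := cond_exp_mean FX_measurable (default_survival ht k r0) GA.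
have b1 := bmeas_indic (R := R) mA.
have Ib1 := bmeas_itg P b1.
have Is : itg P (fun w => \1_A w * surv 0 r w).
  by apply: itgM => //; apply: gbmeas_bmeas (gbmeas_surv_FX r0); exact: FX_measurable.
have It : itg P (fun w => \1_A w * \1_[set w | (r%:E < tau k w)%E] w).
  by apply: itgM => //; apply: bmeas_indic; exact: measurable_tau_gt.
transitivity (mean P (\1_A) - mean P (fun w => \1_A w * surv 0 r w)).
  by rewrite -meanB//; apply: eq_mean => w; rewrite mulrBr mulr1.
rewrite e -meanB//; apply: eq_mean => w.
rewrite -[X in X - _]mulr1 -mulrBr; congr (_ * _); rewrite !indicE.
have [rt'|rt'] := ltP r%:E (tau k w).
  rewrite [in X in _ - X]mem_set// subrr memNset//.
  by rewrite /le_gt_set/= => -[h _]; move: rt'; rewrite ltNge h.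
rewrite [in X in _ - X]memNset ?subr0 ?mem_set// /le_gt_set//=.
by rewrite ltNge rt'.
Qed.

Lemma joint_default (Z : T -> R) (B : 'I_n -> set (\bar R)) (p : 'I_n -> T -> R) :
  gbmeas FX Z -> (forall k, measurable (B k)) ->
  (forall k, is_cond_prob P FX (tau k @^-1` B k) (p k)) ->
  mean P (fun w => Z w * \prod_k \1_(tau k @^-1` B k) w) =
  mean P (fun w => Z w * \prod_k p k w).
Proof.
move=> [mZ bZ] mB Bp.
rewrite (cond_exp_mul FX_measurable (default_independent ht mB Bp) mZ bZ).
by apply: eq_mean => w; rewrite indic_bigcap.
Qed.

(** A pi-system whose sigma-algebra contains [Fa s], in a product form to which conditional
    independence of the default times applies. *)
Definition rect (s : R) : set_system T := [set A | exists (AX : set T) (v : 'I_n -> \bar R),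
  [/\ <<s GY s >> AX, (forall k, level s (v k)) &
    A = AX `&` \bigcap_(k in [set: 'I_n]) (tau k @^-1` [set x | (x <= v k)%E])]].

Lemma rect_measurable s : rect s `<=` measurable.
Proof.
move=> A [AX [v [HAX _ ->]]]; apply: measurableI.
  by apply: FX_measurable; exact: GY_FX HAX.
apply: fin_bigcap_measurable; first exact: finite_finset.
by move=> k _; exact: measurable_tau_le.
Qed.

Lemma rect_setI s : setI_closed (rect s).
Proof.
move=> _ _ [A [v [GA lv ->]]] [A' [v' [GA' lv' ->]]].
exists (A `&` A'), (fun k => Order.min (v k) (v' k)); split.
- exact: gen_setI.
- move=> k; case: (lv k) => [->|[r [r0 rs ->]]]; case: (lv' k) => [->|[r' [r'0 r's ->]]].
  + by left; rewrite minxx.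
  + by right; exists r'; rewrite minEle leye_eq.
  + by right; exists r; rewrite minEle leey.
  + right; exists (Order.min r r'); split; rewrite ?EFin_min//.
      by rewrite le_min r0.
    by rewrite ge_min rs.
- rewrite setIACA; congr (_ `&` _); apply/seteqP; split => w /=.
    by move=> [h h'] k _ /=; rewrite le_min h ?h'.
  by move=> h; split => k _ /=; have := h k I; rewrite /= le_min => /andP[].
Qed.

Lemma sub_Fa_rect s : 0 <= s -> <<s Fa s >> `<=` <<s rect s >>.
Proof.
move=> s0; apply: sub_gen_sigma => A [HA|[k _ HA]].
  apply: sub_gen; exists A, (fun=> +oo%E); split; [exact: sub_gen|by left|].
  by apply/seteqP; split => [w Aw|w []//]; split => // k _ /=; rewrite leey.
move: A HA; apply: sub_events_of => u; rewrite /= in_itv/= => /andP[u0 us].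
have -> : (fun w => (tau k w <= u%:E)%E%:R) = \1_[set w | (tau k w <= u%:E)%E] :> (T -> R).
  by apply/funext => w; rewrite indic_bool.
apply: (gbmeas_indic _).1; apply: sub_gen.
exists setT, (fun j => if j == k then u%:E else +oo%E); split.
- exact: gen_setT.
- by move=> j; case: eqP => _; [right; exists u|left].
- rewrite setTI; apply/seteqP; split => w /=.
    by move=> h j _ /=; case: eqP => [->//|_]; exact: leey.
  by move/(_ k I) => /=; rewrite eqxx.
Qed.

Lemma Fa_measurable s : 0 <= s -> <<s Fa s >> `<=` measurable.
Proof.
move=> s0; apply: subset_trans (sub_Fa_rect s0) _; apply: gen_sigma_measurable.
exact: rect_measurable.
Qed.

Lemma rectT s : rect s setT.
Proof.
exists setT, (fun=> +oo%E); split; [exact: gen_setT|by left|].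
by apply/seteqP; split => // w _; split => // k _ /=; rewrite leey.
Qed.

Lemma Fa_mean_ext s (f g : T -> R) : 0 <= s -> itg P f -> itg P g ->
  (forall A, rect s A -> mean P (fun w => \1_A w * f w) = mean P (fun w => \1_A w * g w)) ->
  forall A, <<s Fa s >> A -> mean P (fun w => \1_A w * f w) = mean P (fun w => \1_A w * g w).
Proof.
move=> s0 If Ig H A /(sub_Fa_rect s0).
apply: pi_system_mean => //; [exact: rect_measurable|exact: rect_setI|].
have := H _ (rectT s).
by under eq_mean do rewrite indicT mul1r; under [RHS]eq_mean do rewrite indicT mul1r.
Qed.

Lemma prod_indic_le_gt (K : {set 'I_n}) t (v : 'I_n -> \bar R) w :
  \1_(\bigcap_(k in [set: 'I_n]) (tau k @^-1` [set x | (x <= v k)%E])) w *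
    \prod_(k in K) \1_[set w | (t%:E < tau k w)%E] w =
  \prod_k \1_(tau k @^-1` le_gt_set (k \in K) t (v k)) w :> R.
Proof.
rewrite indic_bigcap [\prod_(k in K) _]big_mkcond -big_split/=; apply: eq_bigr => k _.
rewrite /le_gt_set preimage_setI indicI_mul; congr (_ * _).
by case: ifP => _ //; rewrite preimage_setT indicT.
Qed.

(** On a rectangle, an obligor of [K] with a finite threshold contributes 0 at both times. One with
    threshold [+oo] contributes [surv 0 t] at time [t] and [surv 0 s] at time [s]; by
    multiplicativity each obligor of [K] accounts for one factor [surv s t]. The event [B] may
    concern the chain after [s]; it will carry the state at [t]. *)
Lemma surv_identity s t (K : {set 'I_n}) A B : 0 <= s -> s <= t ->
  <<s Fa s >> A -> <<s FX >> B ->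
  mean P (fun w => \1_A w * (\1_B w * \prod_(k in K) \1_[set w | (t%:E < tau k w)%E] w)) =
  mean P (fun w => \1_A w * (\1_B w * (surv s t w ^+ #|K| *
    \prod_(k in K) \1_[set w | (s%:E < tau k w)%E] w))).
Proof.
move=> s0 st HA HB; have mB := FX_measurable HB.
have t0 := le_trans s0 st.
have gs : gbmeas FX (surv s t) by apply: gbmeasS (@GY_FX t) _; exact: gbmeas_surv.
have bs := gbmeas_bmeas FX_measurable gs.
have bpr u : bmeas (fun w => \prod_(k in K) \1_[set w | (u%:E < tau k w)%E] w : R).
  by apply: bmeas_prod => k; apply: bmeas_indic; exact: measurable_tau_gt.
apply: (Fa_mean_ext s0 _ _ _ HA).
- by apply: itgM => //; exact: bmeas_indic.
- apply: itgM; first exact: bmeas_indic.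
  by apply: bmeasM => //; exact: bmeasX.
move=> _ [AX [v [HAX lv ->]]].
have lvt k : level t (v k).
  case: (lv k) => [->|[r [r0 rs ->]]]; [by left|right; exists r; split => //].
  exact: le_trans st.
have gAX := gbmeas_indic (R := R) (GY_FX HAX).
have gB := gbmeas_indic (R := R) HB.
transitivity (mean P (fun w => (\1_AX w * \1_B w) *
    \prod_k \1_(tau k @^-1` le_gt_set (k \in K) t (v k)) w)).
  by apply: eq_mean => w; rewrite -prod_indic_le_gt indicI_mul; ring.
rewrite (@joint_default _ _ (fun k => le_gt_prob (k \in K) t (v k))); last 3 first.
- exact: bmeasM.
- by move=> k; exact: measurable_le_gt_set.
- by move=> k; exact: cond_prob_le_gt.
transitivity (mean P (fun w => (\1_AX w * \1_B w * surv s t w ^+ #|K|) *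
    \prod_k le_gt_prob (k \in K) s (v k) w)).
  apply: eq_mean => w; rewrite -[RHS]mulrA; congr (_ * _).
  rewrite -prodr_const [\prod_(k in K) _]big_mkcond -big_split/=; apply: eq_bigr => k _.
  case: (k \in K); last exact/esym/mul1r.
  rewrite /le_gt_prob; case: (v k) => [r||]; first exact/esym/mulr0.
    exact: etrans (survM w s0 st) (mulrC _ _).
  exact: etrans (survM w s0 st) (mulrC _ _).
(* Conditional independence is used backwards, now at time [s]. *)
rewrite -(@joint_default _ (fun k => le_gt_set (k \in K) s (v k))); last 3 first.
- by apply: bmeasM; [exact: bmeasM|exact: bmeasX].
- by move=> k; exact: measurable_le_gt_set.
- by move=> k; exact: cond_prob_le_gt.
by apply: eq_mean => w; rewrite -prod_indic_le_gt indicI_mul; ring.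
Qed.

(** The chain remains Markov when defaults up to [s] are also observed: given the chain, a rectangle
    has a probability depending only on the chain up to [s], so it may serve as a weight in the
    Markov property of [X]. *)
Lemma markov_identity s t i A : 0 <= s -> s <= t -> <<s Fa s >> A ->
  mean P (fun w => \1_A w * Y t w i 0) =
  mean P (fun w => \1_A w * (expmx ((a * (t - s)) *: Q) *m Y s w) i 0).
Proof.
move=> s0 st HA; have t0 := le_trans s0 st.
have gE : gbmeas (GY s) (fun w => (expmx ((a * (t - s)) *: Q) *m Y s w) i 0).
  have -> : (fun w => (expmx ((a * (t - s)) *: Q) *m Y s w) i 0) =
     fun w => \sum_k expmx ((a * (t - s)) *: Q) i k * Y s w k 0.
    by apply/funext => w; rewrite mxE.
  by apply: bmeas_sum => k; apply: bmeasM; [exact: bmeas_cst|exact: gbmeas_Y].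
have gEX := gbmeasS (@GY_FX s) gE.
have gYt := gbmeasS (@GY_FX t) (gbmeas_Y i t0 (lexx t)).
apply: (Fa_mean_ext s0 _ _ _ HA).
- by apply: bmeas_itg; apply: gbmeas_bmeas gYt; exact: FX_measurable.
- by apply: bmeas_itg; apply: gbmeas_bmeas gEX; exact: FX_measurable.
move=> _ [AX [v [HAX lv ->]]].
have gAX := gbmeas_indic (R := R) (GY_FX HAX).
pose p k := le_gt_prob false s (v k).
have red (Z : T -> R) : gbmeas FX Z ->
    mean P (fun w => \1_(AX `&` \bigcap_(k in [set: 'I_n]) (tau k @^-1` [set x | (x <= v k)%E])) w * Z w)
    = mean P (fun w => (\1_AX w * \prod_k p k w) * Z w).
  move=> gZ; transitivity (mean P (fun w => (\1_AX w * Z w) *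
      \prod_k \1_(tau k @^-1` le_gt_set false s (v k)) w)).
    apply: eq_mean => w; rewrite indicI_mul indic_bigcap mulrAC; congr (_ * _).
    by apply: eq_bigr => k _; rewrite /le_gt_set setIT.
  rewrite (@joint_default _ _ p).
  - by apply: eq_mean => w; rewrite mulrAC.
  - exact: bmeasM.
  - by move=> k; exact: measurable_le_gt_set.
  - by move=> k; exact: cond_prob_le_gt.
rewrite !red//.
have gp : gbmeas (GY s) (fun w => \1_AX w * \prod_k p k w).
  apply: bmeasM; first exact: gbmeas_indic.
  apply: bmeas_prod => k; rewrite /p /le_gt_prob /le_prob.
  case: (lv k) => [->|[r [r0 rs ->]]]; first exact: bmeas_cst.
  by apply: bmeasB; [exact: bmeas_cst|exact: gbmeas_surv].
have as0 : 0 <= a * s by rewrite mulr_ge0// ltW.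
have ast : a * s <= a * t by rewrite ler_wpM2l// ltW.
have := chain_markov hX i as0 ast; rewrite -GYE => ce.
have := cond_exp_mul (subset_trans (@GY_FX s) FX_measurable) ce gp.1 gp.2.
rewrite -mulrBr => ->; apply: eq_mean => w; congr (_ * _).
by rewrite -/(Y t w) (@indic_Y t w i).
Qed.

End default_identities.

(** * Binomial weights and elementary inequalities *)

Section binomial_tools.
Context {R : realType}.
Implicit Types (x y : R).

(** The probability that, of n - j obligors surviving independently with probability [y], exactly n
    - i survive: the transition from [j] to [i] defaults. *)
Definition binomial_weight (n i j : nat) (y : R) : R :=
  'C(n - j, n - i)%:R * (y ^+ (n - i) * (1 - y) ^+ ((n - j) - (n - i))).

Lemma gtransE n l i j r : (i <= n)%N -> (j <= n)%N ->
  gtrans n l i j r = binomial_weight n i j (expR (- l * r)).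
Proof.
move=> ni nj; rewrite /gtrans /binomial_weight; case: ifPn => ji.
  rewrite mulrA -expRM_natl; congr (_ * expR _ * _ ^+ _); last by lia.
  by rewrite !mulrA mulrN !mulNr.
by rewrite bin_small ?mul0r//; rewrite -ltnNge in ji; lia.
Qed.

Lemma bin_trinomial M q j : (q <= M)%N -> (j <= M - q)%N ->
  ('C(M, q + j) * 'C(q + j, q) = 'C(M, q) * 'C(M - q, j))%N.
Proof.
move=> qM jM.
have h1 : (q + j <= M)%N by lia.
have := bin_fact h1; have := bin_fact (leq_addr j q); have := bin_fact qM; have := bin_fact jM.
have -> : (q + j - q = j)%N by lia.
have -> : (M - q - j = M - (q + j))%N by lia.
move: (fact_gt0 q) (fact_gt0 j) (fact_gt0 (M - (q + j))) => f1 f2 f3.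
set a := 'C(M, _); set b := 'C(_, q); set c := 'C(M, q); set e := 'C(M - q, j).
move=> h2 h3 h4 h5.
have f0 : (0 < q`! * j`! * (M - (q + j))`!)%N by rewrite !muln_gt0 f1 f2 f3.
apply/eqP; rewrite -(eqn_pmul2r f0); apply/eqP.
transitivity (M`!); first by rewrite -h5 -h4; ring.
by rewrite -h3 -h2; ring.
Qed.

(* Inverts the relation between factorial moments and point probabilities. *)
Lemma binomial_inversion n M q y : (M <= n)%N ->
  \sum_(k < n.+1) (if (q <= k)%N then (-1) ^+ (k - q) * 'C(k, q)%:R else 0) *
     (y ^+ k * 'C(M, k)%:R) =
  'C(M, q)%:R * (y ^+ q * (1 - y) ^+ (M - q)).
Proof.
move=> Mn; rewrite -(big_mkord xpredT (fun k => (if (q <= k)%N then (-1) ^+ (k - q) * 'C(k, q)%:R else 0) *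
     (y ^+ k * 'C(M, k)%:R))).
have [Mq|qM] := ltnP M q.
  rewrite bin_small// mul0r big1// => k _; case: ifP => qk; last by rewrite mul0r.
  by rewrite (@bin_small M k) ?mulr0//; lia.
have hq : (q <= n.+1)%N by lia.
have hq' : (q <= M.+1)%N by lia.
have hM : (M.+1 <= n.+1)%N by lia.
rewrite (@big_cat_nat _ _ _ q)//=.
rewrite big_nat big1 ?add0r; last by move=> k /andP[_ kq]; rewrite leqNgt kq mul0r.
rewrite (@big_cat_nat _ _ _ M.+1)//=.
rewrite [X in _ + X]big_nat [X in _ + X]big1 ?addr0; last first.
  by move=> k /andP[Mk _]; rewrite (@bin_small M k)// !mulr0.
rewrite -{1}[q]add0n big_addn subSn// big_mkord.
rewrite [1 - y]addrC addrC exprDn !mulr_sumr; apply: eq_bigr => -[j jM] _ /=.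
rewrite leq_addl addnK expr1n mul1r.
have := @bin_trinomial M q j qM (ltnSE jM); rewrite addnC => /(congr1 (fun i : nat => i%:R : R)).
rewrite !natrM => e.
transitivity ((-1) ^+ j * y ^+ j * y ^+ q * ('C(M, j + q)%:R * 'C(j + q, q)%:R)).
  by rewrite exprD; ring.
rewrite e -[- y]mulN1r exprMn -[X in _ = _ * (_ * X)]mulr_natr.
by ring.
Qed.

Lemma norm_exprB_le x y k : 0 <= x <= 1 -> 0 <= y <= 1 ->
  `|x ^+ k - y ^+ k| <= k%:R * `|x - y|.
Proof.
move=> /andP[x0 x1] /andP[y0 y1]; elim: k => [|k IH].
  by rewrite !expr0 subrr normr0 mul0r.
have -> : x ^+ k.+1 - y ^+ k.+1 = x * (x ^+ k - y ^+ k) + (x - y) * y ^+ k.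
  by rewrite !exprS; ring.
apply: le_trans (ler_normD _ _) _; rewrite !normrM -natr1 mulrDl mul1r.
rewrite (ger0_norm x0); apply: lerD.
  by apply: le_trans (ler_piMl _ _) _.
by apply: ler_piMr => //; rewrite normrX ger0_norm// exprn_ile1.
Qed.

(** Summing the binomial coefficients over all [j] makes the constant independent of [j], which will
    be the random count at time [s]. *)
Lemma binomial_weight_lipschitz n i j x y : (j <= n)%N ->
  0 <= x <= 1 -> 0 <= y <= 1 ->
  `|binomial_weight n i j x - binomial_weight n i j y| <=
    (\sum_(j < n.+1) 'C(n - j, n - i)%:R) * (2 * n%:R) * `|x - y|.
Proof.
move=> jn x01 y01; rewrite /binomial_weight -mulrBr normrM.
set p := (n - i)%N; set q := (n - j - (n - i))%N.
rewrite -mulrA; apply: ler_pM => //.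
  rewrite ger0_norm// (bigD1 (inord j : 'I_n.+1))//= inordK// lerDl.
  by apply: sumr_ge0.
have onem01 (z : R) : 0 <= z <= 1 -> 0 <= 1 - z <= 1 by move=> /andP[h1 h2]; apply/andP; split; lra.
have -> : x ^+ p * (1 - x) ^+ q - y ^+ p * (1 - y) ^+ q =
   (x ^+ p - y ^+ p) * (1 - x) ^+ q + y ^+ p * ((1 - x) ^+ q - (1 - y) ^+ q) by ring.
apply: le_trans (ler_normD _ _) _; rewrite !normrM.
have e1 : `|(1 - x) ^+ q| <= 1.
  have /andP[h1 h2] := onem01 _ x01; by rewrite normrX ger0_norm// exprn_ile1.
have e2 : `|y ^+ p| <= 1.
  have /andP[h1 h2] := y01; by rewrite normrX ger0_norm// exprn_ile1.
have n1 := norm_exprB_le p x01 y01.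
have := norm_exprB_le q (onem01 _ x01) (onem01 _ y01).
have -> : 1 - x - (1 - y) = - (x - y) by ring.
rewrite normrN => n2.
have pn : p%:R * `|x - y| <= n%:R * `|x - y| by rewrite ler_wpM2r// ler_nat leq_subr.
have qn : q%:R * `|x - y| <= n%:R * `|x - y|
  by rewrite ler_wpM2r// ler_nat (leq_trans (leq_subr _ _) (leq_subr _ _)).
apply: (@le_trans _ _ (n%:R * `|x - y| + n%:R * `|x - y|)); last by lra.
apply: lerD.
  by apply: le_trans (ler_piMr _ e1) _ => //; exact: le_trans n1 pn.
by apply: le_trans (ler_piMl _ e2) _ => //; exact: le_trans n2 qn.
Qed.

Lemma binomial_weight_bounds n i j y : (j <= n)%N -> 0 <= y <= 1 ->
  0 <= binomial_weight n i j y <= \sum_(j < n.+1) 'C(n - j, n - i)%:R.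
Proof.
move=> jn /andP[y0 y1]; have y1' : 0 <= 1 - y by lra.
rewrite /binomial_weight !mulr_ge0 ?exprn_ge0//=.
apply: (@le_trans _ _ ('C(n - j, n - i)%:R)).
  apply: ler_piMr => //; apply: mulr_ile1; rewrite ?exprn_ge0 ?exprn_ile1//; lra.
by rewrite (bigD1 (inord j : 'I_n.+1))//= inordK// lerDl; exact: sumr_ge0.
Qed.

Lemma geometric_sum_le (rho : R) k : 0 <= rho -> rho < 1 ->
  \sum_(0 <= i < k) rho ^+ i <= (1 - rho)^-1.
Proof.
move=> r0 r1; have r1' : 0 < 1 - rho by rewrite subr_gt0.
rewrite -[leRHS]mul1r ler_pdivlMr// big_mkord.
have := subrX1 rho k; set s := \sum_(i < k) _ => e.
have rk : 0 <= rho ^+ k by exact: exprn_ge0.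
have -> : s * (1 - rho) = 1 - rho ^+ k by rewrite -[RHS]opprB e; ring.
by rewrite lerBlDr lerDl.
Qed.

(** With truncated subtraction the exponent is the distance of [j] and [k]; each side of [j]
    contributes at most one geometric series. *)
Lemma sum_geometric_dist_le (rho : R) K j : 0 <= rho -> rho < 1 -> (j < K)%N ->
  \sum_(0 <= k < K) rho ^+ ((j - k) + (k - j)) <= 2 / (1 - rho).
Proof.
move=> r0 r1 jK; rewrite (@big_cat_nat _ _ _ j)//=; last exact: ltnW.
rewrite mulr_natl mulr2n; apply: lerD.
  rewrite big_nat_rev/= add0n; apply: le_trans (geometric_sum_le j r0 r1).
  rewrite !big_nat; apply: ler_sum => k /andP[_ kj].
  by apply: ler_wiXn2l => //; [exact: ltW|lia].
rewrite -{1}[j]add0n big_addn; apply: le_trans (geometric_sum_le (K - j) r0 r1).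
apply: ler_sum => k _; apply: ler_wiXn2l => //; [exact: ltW|lia].
Qed.

Lemma expR_lip x y : 0 <= x -> 0 <= y -> `|expR (- x) - expR (- y)| <= `|x - y|.
Proof.
wlog xy : x y / x <= y.
  move=> H x0 y0; have [|/ltW] := leP x y => h; first exact: H.
  by rewrite distrC [leRHS]distrC; apply: H.
move=> x0 y0; rewrite ger0_norm ?subr_ge0 ?ler_expR ?lerN2//.
rewrite distrC ger0_norm ?subr_ge0//.
have -> : expR (- y) = expR (- x) * expR (- (y - x)) by rewrite -expRD; congr expR; ring.
rewrite -{1}[expR (- x)]mulr1 -mulrBr.
apply: (@le_trans _ _ (1 - expR (- (y - x)))).
  apply: ler_piMl; last by rewrite expR_le1 oppr_le0.
  by rewrite subr_ge0 expR_le1 oppr_le0 subr_ge0.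
by have := expR_ge1Dx (- (y - x)); lra.
Qed.

(** For x = kappa a h, multiplication by [h] gives h + 1/(kappa a), which stays bounded as the mesh
    [h] tends to 0. *)
Lemma step_over_onem_exp x : 0 < x -> (1 - expR (- x))^-1 <= 1 + x^-1.
Proof.
move=> x0; have e : expR (- x) <= (1 + x)^-1.
  by rewrite expRN lef_pV2 ?posrE ?expR_gt0 ?addr_gt0//; exact: expR_ge1Dx.
have -> : 1 + x^-1 = (x / (1 + x))^-1.
  by rewrite invf_div mulrDl mul1r divff ?lt0r_neq0// addrC.
have h : x / (1 + x) = 1 - (1 + x)^-1.
  by field; rewrite lt0r_neq0// addr_gt0.
have p : 0 < x / (1 + x) by rewrite divr_gt0// addr_gt0.
rewrite lef_pV2 ?posrE//; first by rewrite h; lra.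
by apply: lt_le_trans p _; rewrite h; lra.
Qed.

End binomial_tools.

(** Serves the model with the random survival probability [y = surv s t] and the limit process with
    a constant [y]. The event is expressed by the truncated differences since [U] may exceed [n] in
    the second case. *)
Lemma law_of_factorial_moments {R : realType} {d : measure_display} {T : measurableType d}
    (P : probability T R) n i (U V : T -> nat) (Z y : T -> R) :
  bmeas Z -> bmeas y ->
  (forall k, bmeas (fun w => 'C(n - U w, k)%:R : R)) ->
  (forall k, bmeas (fun w => 'C(n - V w, k)%:R : R)) ->
  (forall k, mean P (fun w => Z w * 'C(n - U w, k)%:R) =
     mean P (fun w => Z w * (y w ^+ k * 'C(n - V w, k)%:R))) ->
  mean P (fun w => Z w * ((n - U w)%N == (n - i)%N)%:R) =
  mean P (fun w => Z w * binomial_weight n i (V w) (y w)).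
Proof.
move=> bZ by_ bU bV fm; pose q := (n - i)%N.
pose co k : R := if (q <= k)%N then (-1) ^+ (k - q) * 'C(k, q)%:R else 0.
have IU k : itg P (fun w => Z w * 'C(n - U w, k)%:R) by exact: itgM.
have IV k : itg P (fun w => Z w * (y w ^+ k * 'C(n - V w, k)%:R)).
  by apply: itgM => //; apply: bmeasM => //; exact: bmeasX.
transitivity (\sum_(k < n.+1) co k * mean P (fun w => Z w * 'C(n - U w, k)%:R)).
  under [RHS]eq_bigr => k _ do rewrite -meanZ//.
  rewrite -mean_sum; last by move=> k; exact: itgZ.
  apply: eq_mean => w.
  (* Binomial inversion at y = 1: the power of 1 - y leaves the indicator of [n - U w = q]. *)
  transitivity (Z w * \sum_(k < n.+1) co k * (1 ^+ k * 'C(n - U w, k)%:R)).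
    rewrite binomial_inversion ?leq_subr// subrr expr1n mul1r expr0n -/q; congr (_ * _).
    have [->|Ni] := eqVneq (n - U w)%N q; first by rewrite subnn eqxx binn mulr1.
    have [nN|nN] := ltnP (n - U w) q; first by rewrite bin_small// mul0r.
    have -> : ((n - U w - q)%N == 0%N) = false; last by rewrite mulr0.
    by apply/negbTE/eqP; move/eqP: Ni; lia.
  by rewrite mulr_sumr; apply: eq_bigr => k _; rewrite expr1n; ring.
under eq_bigr => k _ do rewrite fm -meanZ//.
rewrite -mean_sum; last by move=> k; exact: itgZ.
apply: eq_mean => w; rewrite /binomial_weight -(@binomial_inversion _ n _ q) ?leq_subr//.
by rewrite mulr_sumr; apply: eq_bigr => k _; rewrite -/(co k); ring.
Qed.

(** * Averaging of the hazard rate *)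

Section default_estimate.
Context {R : realType} {m n : nat} {d : measure_display} {T : measurableType d}.
Variables (P : probability T R) (Q : 'M[R]_m) (lam pi : 'cV[R]_m).
Hypothesis lam0 : forall k, 0 <= lam k 0.
Hypothesis pi0 : forall k, 0 <= pi k 0.
Hypothesis pi1 : \sum_k pi k 0 = 1.
Variables (X : R -> T -> 'cV[R]_m) (hX : markov_chain P Q X).
Variables (C kappa : R) (C0 : 0 <= C) (kappa0 : 0 < kappa).
Hypothesis ergodic : forall r, 0 <= r -> forall i j,
  `|expmx (r *: Q) i j - pi i 0| <= C * expR (- (kappa * r)).
Variables (a : R) (a0 : 0 < a) (tau : 'I_n -> T -> \bar R).
Hypothesis ht : default_times P lam X a tau.

Local Notation Y := (speed_up X a).
Local Notation FX := (chain_events X `[0, +oo[).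
Local Notation GY s := (chain_events Y `[0, s]).
Local Notation Fa s := (default_filtration X a tau s).
Local Notation Na := (default_count tau).
Local Notation linf := ((lam^T *m pi) 0 0).

Lemma alive_count t w :
  (n - Na t w)%N = #|[set k : 'I_n | (t%:E < tau k w)%E]%SET|.
Proof.
set S := [set k | _]%SET; suff e : (Na t w + #|S| = n)%N by have := addKn (Na t w) #|S|; rewrite e.
rewrite /default_count -sum1_card [X in (_ + X)%N]big_mkcond -big_split/=.
rewrite -[RHS]card_ord -sum1_card; apply: eq_bigr => k _.
by rewrite /S inE; case: leP.
Qed.

Lemma default_count_le t w : (Na t w <= n)%N.
Proof.
rewrite /default_count -[leqRHS]card_ord -sum1_card; apply: leq_sum => k _.
by case: (_ <= _)%E.
Qed.

(** The binomial coefficient counts the k-subsets of the surviving obligors; products of survival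
    indicators are what conditional independence evaluates. *)
Lemma factorial_moment t k w :
  'C(n - Na t w, k)%:R = \sum_(K : {set 'I_n} | #|K| == k)
    \prod_(j in K) \1_[set w | (t%:E < tau j w)%E] w :> R.
Proof.
rewrite alive_count -cards_draws -sum1_card natr_sum [RHS]big_mkcond [LHS]big_mkcond.
apply: eq_bigr => K _; rewrite inE; case: (#|K| == k); rewrite ?andbF ?andbT//.
case: ifPn => [/fintype.subsetP KA|/subsetPn[j jK jA]].
  by rewrite big1// => j /KA; rewrite inE => h; rewrite indicE mem_set.
by rewrite (bigD1 j)//= indicE memNset ?mul0r//=; move: jA; rewrite inE => /negP.
Qed.

Lemma gmeas_count_le (k : 'I_n) u s : 0 <= u -> u <= s ->
  gbmeas (Fa s) (fun w => (tau k w <= u%:E)%E%:R : R).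
Proof.
move=> u0 us; split; last by exists 1 => w; case: (_ <= _)%E; rewrite ?normr0 ?normr1.
apply: (@events_of_gmeas _ _ _ _ `[0, s]%classic (fun u w => (tau k w <= u%:E)%E%:R)).
  by move=> A HA; apply: sub_gen; right; exists k.
by rewrite /= in_itv/= u0.
Qed.

Lemma gbmeas_count u s : 0 <= u -> u <= s -> gbmeas (Fa s) (fun w => (Na u w)%:R : R).
Proof.
move=> u0 us; have -> : (fun w => (Na u w)%:R : R) = fun w => \sum_k (tau k w <= u%:E)%E%:R :> R.
  by apply/funext => w; rewrite /default_count natr_sum.
by apply: bmeas_sum => k; exact: gmeas_count_le.
Qed.

Lemma gbmeas_fun_count (f : nat -> R) u s : 0 <= u -> u <= s ->
  gbmeas (Fa s) (fun w => f (Na u w)).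
Proof.
move=> u0 us.
have -> : (fun w => f (Na u w)) = fun w => \sum_(j < n.+1) f j * \1_[set w | (Na u w)%:R = j%:R :> R] w.
  apply/funext => w; rewrite (bigD1 (inord (Na u w) : 'I_n.+1))//=.
  rewrite inordK ?ltnS ?default_count_le// indicE mem_set// mulr1 big1 ?addr0//.
  move=> j jN; rewrite indicE memNset ?mulr0//= => /eqP; rewrite eqr_nat => /eqP e.
  by move/negP : jN; apply; apply/eqP/val_inj; rewrite /= inordK ?ltnS ?default_count_le// e.
apply: bmeas_sum => j; apply: bmeasM; first exact: bmeas_cst.
by apply: gbmeas_indic; apply: gen_eq1; exact: (gbmeas_count u0 us).1.
Qed.

Lemma FaS s t : s <= t -> <<s Fa s >> `<=` <<s Fa t >>.
Proof.
move=> st; apply: sub_gen_sigma => A [[k _ [u us uA]]|[k _ [u us uA]]]; apply: sub_gen.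
  left; exists k => //; exists u => //.
  by move: us; rewrite /= !in_itv/= => /andP[->]/= /le_trans; apply.
right; exists k => //; exists u => //.
by move: us; rewrite /= !in_itv/= => /andP[->]/= /le_trans; apply.
Qed.

Lemma GY_Fa s : <<s GY s >> `<=` <<s Fa s >>.
Proof. by apply: sub_gen_sigma => A HA; apply: sub_gen; left. Qed.

Let Fam s (s0 : 0 <= s) := Fa_measurable hX a0 ht s0.

Lemma gbmeas_Fa_bmeas s (Z : T -> R) : 0 <= s -> gbmeas (Fa s) Z -> bmeas Z.
Proof. by move=> s0; exact/gbmeas_bmeas/Fam. Qed.

Lemma bmeas_Y t k : 0 <= t -> bmeas (fun w => Y t w k 0).
Proof.
move=> t0; apply: (@gbmeas_bmeas _ _ _ (GY t)); last exact: (gbmeas_Y hX a0).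
by move=> A HA; apply: (FX_measurable hX); exact: (GY_FX a0) HA.
Qed.

Lemma count_identity s t i A B : 0 <= s -> s <= t -> (i <= n)%N ->
  <<s Fa s >> A -> <<s FX >> B ->
  mean P (fun w => \1_A w * (\1_B w * (Na t w == i)%:R)) =
  mean P (fun w => \1_A w * (\1_B w * binomial_weight n i (Na s w) (surv lam X a s t w))).
Proof.
move=> s0 st ni HA HB; have t0 := le_trans s0 st.
have mA := Fam s0 HA; have mB := FX_measurable hX HB.
have bs : bmeas (surv lam X a s t).
  apply: (@gbmeas_bmeas _ _ _ (GY t)); last exact: (gbmeas_surv lam0 hX a0).
  by move=> D HD; apply: (FX_measurable hX); exact: (GY_FX a0) HD.
have bA : bmeas (\1_A : T -> R) by exact: bmeas_indic.
have bB : bmeas (\1_B : T -> R) by exact: bmeas_indic.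
have bp (K : {set 'I_n}) u : bmeas (fun w => \prod_(j in K) \1_[set w | (u%:E < tau j w)%E] w : R).
  by apply: bmeas_prod => k; apply: bmeas_indic; exact: (measurable_tau_gt ht).
have fm k : mean P (fun w => \1_A w * (\1_B w * 'C(n - Na t w, k)%:R)) =
    mean P (fun w => \1_A w * (\1_B w * (surv lam X a s t w ^+ k * 'C(n - Na s w, k)%:R))).
  transitivity (\sum_(K : {set 'I_n} | #|K| == k) mean P (fun w => \1_A w * (\1_B w *
      \prod_(j in K) \1_[set w | (t%:E < tau j w)%E] w))).
    rewrite -mean_sum; last first.
      by move=> K; apply: itgM => //; apply: bmeasM.
    by apply: eq_mean => w; rewrite factorial_moment !mulr_sumr.
  under eq_bigr => K /eqP Kk do rewrite (surv_identity lam0 hX a0 ht K s0 st HA HB) Kk.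
  rewrite -mean_sum; last first.
    move=> K; apply: itgM => //; apply: bmeasM => //.
    by apply: bmeasM => //; exact: bmeasX.
  by apply: eq_mean => w; rewrite factorial_moment !mulr_sumr.
have bC u k : 0 <= u -> bmeas (fun w => 'C(n - Na u w, k)%:R : R).
  move=> u0; apply: (gbmeas_Fa_bmeas u0).
  exact: (gbmeas_fun_count (fun j => 'C(n - j, k)%:R) u0 (lexx u)).
transitivity (mean P (fun w => \1_A w * \1_B w * ((n - Na t w)%N == (n - i)%N)%:R)).
  apply: eq_mean => w; rewrite mulrA; congr (_ * (nat_of_bool _)%:R).
  by have Nn := default_count_le t w; apply/eqP/eqP; lia.
under [RHS]eq_mean do rewrite mulrA.
apply: law_of_factorial_moments => //; try exact: bmeasM; try by move=> k; exact: bC.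
by move=> k; under eq_mean do rewrite -mulrA; rewrite fm; apply: eq_mean => w; rewrite mulrA.
Qed.

Let L := \sum_k lam k 0.

Let L0 : 0 <= L. Proof. exact: sumr_ge0. Qed.

Lemma linfE : linf = \sum_k lam k 0 * pi k 0.
Proof. by rewrite mxE; apply: eq_bigr => k _; rewrite mxE. Qed.

Lemma linf_bounds : 0 <= linf <= L.
Proof.
rewrite linfE; apply/andP; split; first by apply: sumr_ge0 => k _; exact: mulr_ge0.
apply: ler_sum => k _; apply: ler_piMr => //.
by rewrite -pi1 (bigD1 k)//= lerDl; exact: sumr_ge0.
Qed.

Lemma cond_exp_Y u v k : 0 <= u -> u <= v ->
  is_cond_exp P (Fa u) (fun w => Y v w k 0)
    (fun w => (expmx ((a * (v - u)) *: Q) *m Y u w) k 0).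
Proof.
move=> u0 uv; have v0 := le_trans u0 uv.
have gE : gbmeas (Fa u) (fun w => (expmx ((a * (v - u)) *: Q) *m Y u w) k 0).
  apply: gbmeasS (@GY_Fa u) _.
  have -> : (fun w => (expmx ((a * (v - u)) *: Q) *m Y u w) k 0) =
     fun w => \sum_j expmx ((a * (v - u)) *: Q) k j * Y u w j 0.
    by apply/funext => w; rewrite mxE.
  by apply: bmeas_sum => j; apply: bmeasM; [exact: bmeas_cst|exact: (gbmeas_Y hX a0)].
apply: (mean_cond_exp (Fam u0)).
- by apply: bmeas_itg; exact: bmeas_Y.
- by apply: bmeas_itg; exact: gbmeas_Fa_bmeas gE.
- exact: gE.1.
by move=> A HA; rewrite (markov_identity lam0 hX a0 ht k u0 uv HA).
Qed.

Lemma cond_Y_close u v k w : 0 <= u -> u <= v ->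
  `|(expmx ((a * (v - u)) *: Q) *m Y u w) k 0 - pi k 0| <=
    C * expR (- (kappa * (a * (v - u)))).
Proof.
move=> u0 uv; rewrite mxE -[pi k 0]mulr1 -(sum_Y hX a0 w u0) mulr_sumr -sumrB.
apply: le_trans (ler_norm_sum _ _ _) _.
rewrite -[leRHS]mulr1 -(sum_Y hX a0 w u0) mulr_sumr; apply: ler_sum => j _.
have Yj0 : 0 <= Y u w j 0 by case: (Y_entry hX a0 w j u0) => ->.
rewrite -mulrBl normrM (ger0_norm Yj0) ler_wpM2r//; apply: ergodic.
by rewrite mulr_ge0 ?subr_ge0// ltW.
Qed.

(** [Y v] may be replaced by its conditional expectation given [Fa u], which is uniformly close to
    [pi]. Bounding [Z] by [B * \1_A] rather than by [B] preserves the factor P(A). *)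
Lemma mean_Y_close Z B u v k (A : set T) : 0 <= u -> u <= v -> <<s Fa u >> A ->
  gbmeas (Fa u) Z -> (forall w, `|Z w| <= B * \1_A w) ->
  `|mean P (fun w => Z w * (Y v w k 0 - pi k 0))| <=
    B * (C * expR (- (kappa * (a * (v - u))))) * mean P (\1_A).
Proof.
move=> u0 uv HA gZ ZB; have v0 := le_trans u0 uv.
have bZ := gbmeas_Fa_bmeas u0 gZ.
have ce := cond_exp_Y k u0 uv.
set E := (fun w => (expmx _ *m Y u w) k 0) in ce.
have IE : itg P E by case: ce.
have e : mean P (fun w => Z w * (Y v w k 0 - pi k 0)) = mean P (fun w => Z w * (E w - pi k 0)).
  transitivity (mean P (fun w => Z w * Y v w k 0) - mean P (fun w => Z w * pi k 0)).
    rewrite -meanB; first by apply: eq_mean => w; rewrite mulrBr.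
      by apply: itgM => //; exact: bmeas_Y.
    by apply: itgM => //; exact: bmeas_cst.
  rewrite -(cond_exp_mul (Fam u0) ce gZ.1 gZ.2) -meanB; first by apply: eq_mean => w; rewrite mulrBr.
    exact: itg_bmeasM.
  by apply: itgM => //; exact: bmeas_cst.
rewrite e.
have IZ : itg P (fun w => Z w * (E w - pi k 0)).
  by apply: itg_bmeasM => //; apply: itgB => //; exact: itg_cst.
apply: le_trans (mean_norm IZ) _.
have I1 : itg P (\1_A) by apply: bmeas_itg; apply: bmeas_indic; exact: Fam HA.
rewrite -meanZ//; apply: mean_le; [exact: itg_abs|exact: itgZ|].
move=> w; rewrite normrM mulrAC; apply: ler_pM => //.
exact: cond_Y_close.
Qed.

Let f u w := rate lam X a u w - linf.

Let fE u w : f u w = \sum_k lam k 0 * (Y u w k 0 - pi k 0).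
Proof.
by rewrite /f rateE linfE -sumrB; apply: eq_bigr => k _; rewrite mulrBr.
Qed.

Let f_bound u w : 0 <= u -> `|f u w| <= L.
Proof.
move=> u0; have /andP[r1 r2] := rate_bounds lam0 hX a0 w u0; have /andP[l1 l2] := linf_bounds.
rewrite -/L in r2 l2; rewrite ler_norml /f; apply/andP; split; move: r1 r2 l1 l2.
  by move: (rate _ _ _ _ _) linf => x y; lra.
by move: (rate _ _ _ _ _) linf => x y; lra.
Qed.

Let gbmeas_f u v : 0 <= u -> u <= v -> gbmeas (Fa v) (f u).
Proof.
move=> u0 uv; apply: gbmeasS (@GY_Fa v) _; apply: bmeasB; last exact: bmeas_cst.
exact: (gbmeas_rate lam hX a0).
Qed.

(** Condition at the earlier time [u]: there [\1_A] and [f u] are known, bounded by [L], and the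
    conditional mean of [f v] decays exponentially in a(v - u). *)
Lemma covariance_bound s u v A : 0 <= s -> s <= u -> u <= v -> <<s Fa s >> A ->
  `|mean P (fun w => \1_A w * (f u w * f v w))| <=
     L ^+ 2 * C * expR (- (kappa * a * (v - u))) * mean P (\1_A).
Proof.
move=> s0 su uv HA; have u0 := le_trans s0 su; have v0 := le_trans u0 uv.
have HAu := FaS su HA.
have bA : bmeas (\1_A : T -> R) by apply: bmeas_indic; exact: Fam HA.
have gZ : gbmeas (Fa u) (fun w => \1_A w * f u w).
  by apply: bmeasM; [exact: gbmeas_indic|exact: gbmeas_f].
have bZ := gbmeas_Fa_bmeas u0 gZ.
have ZL w : `|\1_A w * f u w| <= L * \1_A w.
  have i0 : 0 <= \1_A w :> R by rewrite indicE.
  rewrite normrM (ger0_norm i0) [leLHS]mulrC; apply: ler_wpM2r => //.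
  exact: f_bound.
have -> : mean P (fun w => \1_A w * (f u w * f v w)) =
    \sum_k lam k 0 * mean P (fun w => (\1_A w * f u w) * (Y v w k 0 - pi k 0)).
  have I1 k : itg P (fun w => (\1_A w * f u w) * (Y v w k 0 - pi k 0)).
    apply: itgM => //; apply: bmeasB; last exact: bmeas_cst.
    exact: bmeas_Y.
  under eq_bigr => k _ do rewrite -meanZ//.
  rewrite -mean_sum; last by move=> k; exact: itgZ.
  apply: eq_mean => w; rewrite mulrA [f v w]fE mulr_sumr.
  by apply: eq_bigr => k _; rewrite mulrCA.
apply: le_trans (ler_norm_sum _ _ _) _.
rewrite expr2 -!mulrA {1}/L mulr_suml; apply: ler_sum => k _.
rewrite normrM ger0_norm// ler_wpM2l//.
have := mean_Y_close k u0 uv HAu gZ ZL.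
by rewrite !mulrA.
Qed.

Let mean1 A : 0 <= mean P (\1_A).
Proof. by apply: mean_ge0 => w; rewrite indicE. Qed.

(** After squaring, covariances of grid points at distance d decay like [rho ^+ d], so each row of
    the double sum costs a geometric series. The product [h / (1 - rho)] is at most h + 1/(kappa a),
    a bound that survives the limit [h -> 0] and produces the order 1/a. *)
Lemma riemann_second_moment s t K A : 0 <= s -> s < t -> <<s Fa s >> A ->
  mean P (fun w => \1_A w * (\sum_(k < K.+1) (t - s) / K.+1%:R *
     f (s + (t - s) / K.+1%:R * k.+1%:R) w) ^+ 2) <=
  2 * L ^+ 2 * C * (t - s) * ((t - s) / K.+1%:R + (kappa * a)^-1) * mean P (\1_A).
Proof.
move=> s0 st HA; set h := (t - s) / _.
have h0 : 0 < h by rewrite divr_gt0// subr_gt0.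
have ka0 : 0 < kappa * a by rewrite mulr_gt0.
pose x (k : nat) := s + h * k.+1%:R.
have sx k : s <= x k by rewrite lerDl mulr_ge0// ltW.
have x0 k : 0 <= x k by apply: le_trans (sx k).
have bA : bmeas (\1_A : T -> R) by apply: bmeas_indic; exact: Fam HA.
have bf k : bmeas (f (x k)).
  by apply: (@gbmeas_Fa_bmeas (x k)) => //; exact: gbmeas_f.
pose rho := expR (- (kappa * a * h)).
have rho0 : 0 <= rho by exact: expR_ge0.
have rho1 : rho < 1 by rewrite expR_lt1 oppr_lt0 mulr_gt0.
have cov (j k : nat) : mean P (fun w => \1_A w * (f (x j) w * f (x k) w)) <=
    L ^+ 2 * C * rho ^+ ((j - k) + (k - j)) * mean P (\1_A).
  wlog jk : j k / (j <= k)%N.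
    move=> H; have [|/ltnW] := leqP j k; first exact: H.
    by move/H; rewrite addnC; under eq_mean do rewrite [f _ _ * _]mulrC.
  have xjk : x j <= x k by rewrite lerD2l ler_wpM2l ?ler_nat ?ltnS// ltW.
  apply: le_trans (ler_norm _) _; apply: le_trans (covariance_bound s0 (sx j) xjk HA) _.
  have -> : (j - k + (k - j) = k - j)%N by rewrite (eqP jk) add0n.
  rewrite ler_wpM2r// ler_wpM2l// ?mulr_ge0// ?sqr_ge0//; apply: eq_to_le.
  rewrite /rho -expRM_natl; congr expR.
  have e : x k - x j = h * (k - j)%:R.
    rewrite natrB// /x -!natr1; ring.
  by rewrite e; ring.
have I2 (j k : nat) : itg P (fun w => \1_A w * (f (x j) w * f (x k) w)).
  by apply: itgM => //; exact: bmeasM.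
have -> : mean P (fun w => \1_A w * (\sum_(k < K.+1) h * f (x k) w) ^+ 2) =
    \sum_(j < K.+1) \sum_(k < K.+1) h ^+ 2 * mean P (fun w => \1_A w * (f (x j) w * f (x k) w)).
  under eq_bigr => j _ do under eq_bigr => k _ do rewrite -meanZ//.
  under eq_bigr => j _ do (rewrite -mean_sum; last by move=> k; exact: itgZ).
  rewrite -mean_sum; last by move=> j; apply: itg_sum => k; exact: itgZ.
  apply: eq_mean => w; rewrite expr2 mulr_suml mulr_sumr; apply: eq_bigr => j _.
  by rewrite mulr_sumr mulr_sumr; apply: eq_bigr => k _; ring.
apply: (@le_trans _ _ (\sum_(j < K.+1) h ^+ 2 * (L ^+ 2 * C * mean P (\1_A) * (2 / (1 - rho))))).
  apply: ler_sum => j _; rewrite -mulr_sumr ler_wpM2l ?sqr_ge0//.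
  apply: le_trans (_ : \sum_(k < K.+1) L ^+ 2 * C * mean P (\1_A) * rho ^+ ((j - k) + (k - j)) <= _).
    by apply: ler_sum => k _; rewrite [leRHS]mulrAC; exact: cov.
  rewrite -mulr_sumr ler_wpM2l//; first by rewrite !mulr_ge0// sqr_ge0.
  rewrite -(big_mkord xpredT (fun k => rho ^+ (j - k + (k - j)))).
  by apply: sum_geometric_dist_le.
rewrite sumr_const card_ord -[X in X <= _]mulr_natl.
have hK : K.+1%:R * h = t - s by rewrite mulrC divfK// pnatr_eq0.
have hr : h / (1 - rho) <= h + (kappa * a)^-1.
  have := step_over_onem_exp (mulr_gt0 ka0 h0); rewrite -/rho => sx'.
  apply: le_trans (ler_wpM2l (ltW h0) sx') _; apply: eq_to_le.
  by field; rewrite !lt0r_neq0.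
have -> : K.+1%:R * (h ^+ 2 * (L ^+ 2 * C * mean P (\1_A) * (2 / (1 - rho)))) =
   2 * L ^+ 2 * C * (K.+1%:R * h) * (h / (1 - rho)) * mean P (\1_A) by ring.
rewrite hK; apply: ler_wpM2r => //; apply: ler_wpM2l => //.
by rewrite !mulr_ge0// ?sqr_ge0// subr_ge0 ltW.
Qed.

Lemma hazard_second_moment s t A : 0 <= s -> s < t -> <<s Fa s >> A ->
  mean P (fun w => \1_A w * (hazard lam X a s t w - linf * (t - s)) ^+ 2) <=
  2 * L ^+ 2 * C * (t - s) / (kappa * a) * mean P (\1_A).
Proof.
move=> s0 st HA.
have ts : 0 < t - s by rewrite subr_gt0.
pose h (K : nat) := (t - s) / K.+1%:R.
pose D K w := \sum_(k < K.+1) h K * f (s + h K * k.+1%:R) w.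
have hK K : K.+1%:R * h K = t - s by rewrite mulrC divfK// pnatr_eq0.
have h0 K : 0 < h K by rewrite divr_gt0.
have DE K w : D K w = \sum_(k < K.+1) h K * rate lam X a (s + h K * k.+1%:R) w - linf * (t - s).
  rewrite /D; under eq_bigr do rewrite mulrBr.
  rewrite sumrB sumr_const card_ord -[X in _ - X]mulr_natl mulrA hK.
  by congr (_ - _); exact: mulrC.
have x0 K k : 0 <= s + h K * k.+1%:R by rewrite addr_ge0// mulr_ge0// ltW.
have bA : bmeas (\1_A : T -> R) by apply: bmeas_indic; exact: Fam HA.
have bD K : bmeas (D K).
  apply: bmeas_sum => k; apply: bmeasM; first exact: bmeas_cst.
  by apply: (@gbmeas_Fa_bmeas (s + h K * k.+1%:R)) => //; exact: gbmeas_f.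
have DL K w : `|D K w| <= L * (t - s).
  apply: le_trans (ler_norm_sum _ _ _) _.
  apply: (@le_trans _ _ (\sum_(k < K.+1) h K * L)).
    apply: ler_sum => k _; rewrite normrM (ger0_norm (ltW (h0 K))).
    by apply: ler_wpM2l; [exact: ltW|exact: f_bound].
  by rewrite sumr_const card_ord -mulr_natl mulrA hK mulrC.
have Dcv w : D ^~ w @ \oo --> hazard lam X a s t w - linf * (t - s).
  have -> : D ^~ w = fun K => \sum_(k < K.+1) h K * rate lam X a (s + h K * k.+1%:R) w - linf * (t - s).
    by apply/funext => K; exact: DE.
  by apply: cvgB; [exact: (hazard_riemann lam0 hX a0)|exact: cvg_cst].
have [_ cv] : P.-integrable setT (EFin \o (fun w => \1_A w * (hazard lam X a s t w - linf * (t - s)) ^+ 2)) /\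
    (fun K => mean P (fun w => \1_A w * D K w ^+ 2)) @ \oo -->
    mean P (fun w => \1_A w * (hazard lam X a s t w - linf * (t - s)) ^+ 2).
  apply: (@dominated_Rintegral _ _ _ P setT _ _ (fun=> (L * (t - s)) ^+ 2)) => //.
  - by move=> K; apply: (bmeasM bA (bmeasX 2 (bD K))).1.
  - move=> w _; apply: cvgMr; rewrite expr2.
    by under eq_fun do rewrite expr2; apply: cvgM.
  - by apply: (bmeas_itg P); exact: bmeas_cst.
  - move=> K w _; rewrite normrM normrX indicE.
    apply: (@le_trans _ _ (`|D K w| ^+ 2)).
      by apply: ler_piMl; rewrite ?exprn_ge0//; case: (w \in A); rewrite ?normr1 ?normr0.
    by rewrite lerXn2r// nnegrE// mulr_ge0// ltW.
have cv2 : (fun K => 2 * L ^+ 2 * C * (t - s) * (h K + (kappa * a)^-1) * mean P (\1_A)) @ \oo -->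
    2 * L ^+ 2 * C * (t - s) * (0 + (kappa * a)^-1) * mean P (\1_A).
  apply: cvgMl; apply: cvgMr; apply: cvgD; last exact: cvg_cst.
  exact: cvg_harmonic_scale.
rewrite add0r in cv2.
by apply: (ler_cvg_to cv cv2); apply: nearW => K; exact: riemann_second_moment.
Qed.

(* Young's inequality turns the second moment of the hazard into a first moment,
   at the price of the free parameter [theta]. *)
Lemma mean_surv_close s t A theta : 0 <= s -> s < t -> <<s Fa s >> A -> 0 < theta ->
  mean P (fun w => \1_A w * `|surv lam X a s t w - expR (- (linf * (t - s)))|) <=
  (theta / 2 + L ^+ 2 * C * (t - s) / (kappa * a) / theta) * mean P (\1_A).
Proof.
move=> s0 st HA th0; have st' := ltW st; have t0 := le_trans s0 st'.
have bA : bmeas (\1_A : T -> R) by apply: bmeas_indic; exact: Fam HA.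
have mY D : <<s GY t >> D -> measurable D.
  by move=> HD; apply: (FX_measurable hX); exact: (GY_FX a0) HD.
pose Del w := hazard lam X a s t w - linf * (t - s).
have bDel : bmeas Del.
  apply: bmeasB; last exact: bmeas_cst.
  split; first by apply: (gmeas_meas mY); exact: (gmeas_hazard lam0 hX a0 s0 (ltW st)).
  exists (L * (t - s)) => w; have /andP[h1 h2] := hazard_bounds lam0 hX a0 w s0 (ltW st).
  by rewrite ger0_norm.
have bs : bmeas (surv lam X a s t).
  by apply: (gbmeas_bmeas mY); exact: (gbmeas_surv lam0 hX a0).
have I1 := bmeas_itg P bA.
have I2 : itg P (fun w => \1_A w * Del w ^+ 2).
  by apply: itgM => //; exact: bmeasX.
apply: (@le_trans _ _ (mean P (fun w => (theta / 2) * \1_A w + (2 * theta)^-1 * (\1_A w * Del w ^+ 2)))).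
  apply: mean_le.
  - apply: itgM => //; apply: bmeas_abs.
    by apply: bmeasB => //; exact: bmeas_cst.
  - by apply: itgD; exact: itgZ.
  - move=> w; rewrite mulrCA mulrC -[X in _ <= X + _]mulrC -mulrDr [leLHS]mulrC.
    apply: ler_wpM2l; first by rewrite indicE.
    have /andP[z1 _] := hazard_bounds lam0 hX a0 w s0 (ltW st).
    have l0 : 0 <= linf * (t - s) by have /andP[l0 _] := linf_bounds; rewrite mulr_ge0// subr_ge0 ltW.
    apply: le_trans (expR_lip z1 l0) _; rewrite -/(Del w) -[Del w ^+ 2]real_normK ?num_real//.
    set z := `|Del w|.
    have -> : theta / 2 + (2 * theta)^-1 * z ^+ 2 = z + (z - theta) ^+ 2 / (2 * theta).
      by field; rewrite lt0r_neq0.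
    by rewrite lerDl divr_ge0 ?sqr_ge0// mulr_ge0// ltW.
rewrite meanD; [|exact: itgZ|exact: itgZ].
rewrite (meanZ _ I1) (meanZ _ I2) [leRHS]mulrDl; apply: lerD => //.
apply: le_trans (ler_wpM2l _ (hazard_second_moment s0 st HA)) _; first by rewrite invr_ge0 mulr_ge0// ltW.
by apply: eq_to_le; field; rewrite !lt0r_neq0.
Qed.

Let H i : R := \sum_(j < n.+1) 'C(n - j, n - i)%:R.

(** Two replacements are estimated separately. The random survival probability is replaced by its
    limit while the state at [t] is carried along as a factor in [0, 1]; then the state is replaced
    by [pi] against the weight [g], which is known at time [s]. *)
Lemma default_estimate s t i k A theta : 0 <= s -> s < t -> (i <= n)%N ->
  <<s Fa s >> A -> 0 < theta ->
  `|mean P (fun w => \1_A w * ((Na t w == i)%:R * Y t w k 0 - gtrans n linf i (Na s w) (t - s) * pi k 0))|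
  <= (H i * (2 * n%:R) * (theta / 2 + L ^+ 2 * C * (t - s) / (kappa * a) / theta) +
      H i * (C * expR (- (kappa * (a * (t - s)))))) * mean P (\1_A).
Proof.
move=> s0 st ni HA th0; have st' := ltW st; have t0 := le_trans s0 st'.
set y := expR (- (linf * (t - s))).
have l0 : 0 <= linf * (t - s) by have /andP[l0 _] := linf_bounds; rewrite mulr_ge0// subr_ge0 ltW.
have y01 : 0 <= y <= 1 by rewrite expR_ge0/= expR_le1 oppr_le0.
have gE w : gtrans n linf i (Na s w) (t - s) = binomial_weight n i (Na s w) y.
  by rewrite gtransE ?default_count_le// mulNr.
pose g w := binomial_weight n i (Na s w) y.
have gg : gbmeas (Fa s) g.
  by exact: (gbmeas_fun_count (fun j => binomial_weight n i j y) s0 (lexx s)).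
have bg := gbmeas_Fa_bmeas s0 gg.
pose u w := surv lam X a s t w.
have u01 w : 0 <= u w <= 1 by exact: (surv01 lam0 hX a0).
have mY D : <<s GY t >> D -> measurable D.
  by move=> HD; apply: (FX_measurable hX); exact: (GY_FX a0) HD.
have bu : bmeas u by apply: (gbmeas_bmeas mY); exact: (gbmeas_surv lam0 hX a0).
have gA : gbmeas (Fa s) (\1_A : T -> R) by exact: gbmeas_indic.
have bA := gbmeas_Fa_bmeas s0 gA.
have bYt := bmeas_Y k t0.
have bi : bmeas (fun w => (Na t w == i)%:R : R).
  apply: (gbmeas_Fa_bmeas t0).
  exact: (gbmeas_fun_count (fun j => (j == i)%:R) t0 (lexx t)).
pose h w := binomial_weight n i (Na s w) (u w).
have bh : bmeas h.
  have -> : h = fun w => 'C(n - Na s w, n - i)%:R * (u w ^+ (n - i) * (1 - u w) ^+ (n - Na s w - (n - i))).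
    by apply/funext.
  (* Splitting by the value of the count makes the exponents constant, leaving polynomials in
     [u]. *)
  have -> : (fun w => 'C(n - Na s w, n - i)%:R * (u w ^+ (n - i) * (1 - u w) ^+ (n - Na s w - (n - i)))) =
     fun w => \sum_(j < n.+1) (Na s w == j)%:R * ('C(n - j, n - i)%:R * (u w ^+ (n - i) * (1 - u w) ^+ (n - j - (n - i)))).
    apply/funext => w; rewrite (bigD1 (inord (Na s w) : 'I_n.+1))//=.
    rewrite inordK ?ltnS ?default_count_le// eqxx mul1r big1 ?addr0// => j jN.
    case: eqP => e; last by rewrite mul0r.
    by move/negP : jN; case; apply/eqP/val_inj; rewrite /= inordK ?ltnS ?default_count_le// e.
  apply: bmeas_sum => j; apply: bmeasM.
    apply: (gbmeas_Fa_bmeas s0).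
    exact: (gbmeas_fun_count (fun i => (i == j)%:R) s0 (lexx s)).
  apply: bmeasM; first exact: bmeas_cst.
  by apply: bmeasM; apply: bmeasX => //; apply: bmeasB => //; exact: bmeas_cst.
have HB : <<s FX >> [set w | Y t w = delta_mx k 0].
  rewrite (_ : [set _ | _] = [set w | Y t w k 0 = 1]); last first.
    by apply/seteqP; split => w /= /(Y_eqE hX a0 w k t0).
  by apply: gen_eq1; apply: gmeasS (@GY_FX _ _ _ _ _ _ a0 t) _; exact: (gbmeas_Y hX a0 k t0 (lexx t)).1.
have step1 : mean P (fun w => \1_A w * ((Na t w == i)%:R * Y t w k 0)) =
    mean P (fun w => \1_A w * (Y t w k 0 * h w)).
  have := count_identity s0 st' ni HA HB.
  under eq_mean do rewrite (indic_Y hX a0)//; under [RHS]eq_mean do rewrite (indic_Y hX a0)//.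
  by move=> <-; apply: eq_mean => w; rewrite [_%:R * _]mulrC.
have split2 : mean P (fun w => \1_A w * ((Na t w == i)%:R * Y t w k 0 - gtrans n linf i (Na s w) (t - s) * pi k 0)) =
    mean P (fun w => \1_A w * (Y t w k 0 * (h w - g w))) + mean P (fun w => (\1_A w * g w) * (Y t w k 0 - pi k 0)).
  transitivity (mean P (fun w => \1_A w * ((Na t w == i)%:R * Y t w k 0)) - mean P (fun w => \1_A w * (g w * pi k 0))).
    rewrite -meanB; first by apply: eq_mean => w; rewrite gE mulrBr.
      by apply: itgM => //; exact: bmeasM.
    by apply: itgM => //; apply: bmeasM => //; exact: bmeas_cst.
  rewrite step1 -meanD; first rewrite -meanB.
  - by apply: eq_mean => w; ring.
  - by apply: itgM => //; exact: bmeasM.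
  - by apply: itgM => //; apply: bmeasM => //; exact: bmeas_cst.
  - by apply: itgM => //; apply: bmeasM => //; exact: bmeasB.
  - apply: itgM; first exact: bmeasM.
    by apply: bmeasB => //; exact: bmeas_cst.
rewrite split2; apply: le_trans (ler_normD _ _) _; rewrite mulrDl; apply: lerD.
  have I3 : itg P (fun w => \1_A w * (Y t w k 0 * (h w - g w))).
    by apply: itgM => //; apply: bmeasM => //; exact: bmeasB.
  have I4 : itg P (fun w => \1_A w * `|u w - y|).
    apply: itgM => //; apply: bmeas_abs.
    by apply: bmeasB => //; exact: bmeas_cst.
  apply: le_trans (mean_norm I3) _.
  have HnN : 0 <= H i * (2 * n%:R) by rewrite mulr_ge0 ?mulr_ge0// sumr_ge0.
  rewrite -[leRHS]mulrA; apply: le_trans (ler_wpM2l HnN (mean_surv_close s0 st HA th0)).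
  rewrite -/y -meanZ//; apply: mean_le; [exact: itg_abs|exact: itgZ|].
  move=> w; rewrite normrM mulrCA ger0_norm ?indicE//; apply: ler_wpM2l => //.
  rewrite normrM; apply: le_trans (_ : `|h w - g w| <= _).
    apply: ler_piMl => //.
    by case: (Y_entry hX a0 w k t0) => ->; rewrite ?normr0 ?normr1.
  by apply: binomial_weight_lipschitz => //; exact: default_count_le.
apply: mean_Y_close => //.
  by apply: bmeasM => //.
move=> w; have /andP[g1 g2] := binomial_weight_bounds i (default_count_le s w) y01.
by rewrite normrM mulrC (ger0_norm g1) ger0_norm ?indicE// ler_wpM2r.
Qed.

End default_estimate.

Lemma ereal_cvg0 {R : realType} (f : R -> \bar R) :
  (forall e, 0 < e -> \forall a \near +oo, (0 <= f a <= e%:E)%E) ->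
  f a @[a --> +oo] --> 0%E.
Proof.
move=> H; apply/fine_cvgP; split.
  have := H 1 ltr01; apply: filterS => a /andP[h1 h2].
  by rewrite ge0_fin_numE//; apply: le_lt_trans h2 (ltry _).
apply/cvgrPdist_le => e e0; have := H e e0; apply: filterS => a /andP[h1 h2].
have fa : f a \is a fin_num by rewrite ge0_fin_numE//; apply: le_lt_trans h2 (ltry _).
rewrite sub0r normrN ger0_norm; last by apply: fine_ge0.
by rewrite -lee_fin fineK.
Qed.

Lemma Lnorm_infty_bounds {R : realType} {d : measure_display} {T : measurableType d}
    (P : probability T R) (f : T -> R) (e : R) :
  {ae P, forall w, `|f w| <= e} -> (0 <= Lnorm P +oo (fun w => (f w)%:E) <= e%:E)%E.
Proof.
move=> H; rewrite Lnorm_ge0/= unlock.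
have -> : (0 < P [set: T])%E = true.
  have -> : P [set: T] = 1%E by exact: probability_setT.
  by rewrite lte01.
by apply/ess_supP; move: H; apply: filterS => w /= h; rewrite lee_fin.
Qed.

(** * Bounds uniform over the past, and essential suprema *)

Section uniform_estimates.
Context {R : realType} {m n : nat} {d : measure_display} {T : measurableType d}.
Variables (P : probability T R) (Q : 'M[R]_m) (lam pi : 'cV[R]_m).
Hypothesis hQ : transition_matrix Q.
Hypothesis hirr : irreducible Q.
Hypothesis hpi : invariant_probability Q pi.
Hypothesis lam0 : forall k, 0 <= lam k 0.
Variables (X : R -> T -> 'cV[R]_m) (hX : markov_chain P Q X).
Variable (tau : R -> 'I_n -> T -> \bar R).
Hypothesis htau : forall a : R, 0 < a -> default_times P lam X a (tau a).

Local Notation linf := ((lam^T *m pi) 0 0).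
Local Notation Na a := (default_count (tau a)).
Local Notation Fa a s := (default_filtration X a (tau a) s).

Lemma uniform_estimate s t i e : 0 <= s -> s < t -> (i <= n)%N -> 0 < e ->
  exists2 a1, 0 < a1 & forall a, a1 <= a -> forall k A, <<s Fa a s >> A ->
  `|mean P (fun w => \1_A w * ((Na a t w == i)%:R * speed_up X a t w k 0 -
     gtrans n linf i (Na a s w) (t - s) * pi k 0))| <= e * mean P (\1_A).
Proof.
move=> s0 st ni e0; have [pi0 pi1 _] := hpi.
have [C [kappa [C0 kappa0 erg]]] := expmx_ergodic hQ hirr hpi.
set H : R := \sum_(j < n.+1) 'C(n - j, n - i)%:R.
have H0 : 0 <= H by exact: sumr_ge0.
set c := H * (2 * n%:R).
have c0 : 0 <= c by rewrite mulr_ge0// mulr_ge0.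
have ts : 0 < t - s by rewrite subr_gt0.
(* Brings the term [c * th / 2] below e/2; the summand 1 covers [c = 0], which occurs for
   [n = 0]. *)
pose th := e / (c + 1).
have th0 : 0 < th by rewrite divr_gt0// ltr_wpDl.
have cth : c * th <= e.
  by rewrite /th mulrCA ler_piMr ?(ltW e0)// ler_pdivrMr ?ltr_wpDl// mul1r lerDl.
pose L := \sum_k lam k 0.
have L0 : 0 <= L by exact: sumr_ge0.
(* [W / a] bounds the second moment term together with the exponential one, the latter through
   exp(-x) <= 1/x. *)
pose W := c * (L ^+ 2 * C * (t - s) / kappa / th) + H * C / (kappa * (t - s)).
have W0 : 0 <= W.
  rewrite addr_ge0//; last by rewrite divr_ge0 ?mulr_ge0// ltW// mulr_gt0.
  by rewrite mulr_ge0// divr_ge0 ?(ltW th0)// divr_ge0 ?(ltW kappa0)// !mulr_ge0 ?sqr_ge0 ?(ltW ts).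
exists (2 * W / e + 1); first by rewrite ltr_wpDl// divr_ge0 ?(ltW e0)// mulr_ge0.
move=> a aW k A HA.
have a0 : 0 < a by apply: lt_le_trans aW; rewrite ltr_wpDl// divr_ge0 ?(ltW e0)// mulr_ge0.
have := default_estimate lam0 pi0 pi1 hX C0 kappa0 erg a0 (htau a0) k s0 st ni HA th0.
move/le_trans; apply; apply: ler_wpM2r; first by apply: mean_ge0 => w; rewrite indicE.
have Wa : W / a <= e / 2.
  rewrite ler_pdivrMr// mulrAC ler_pdivlMr//.
  have : 2 * W / e <= a by apply: le_trans aW; rewrite lerDl.
  by rewrite ler_pdivrMr// => h; rewrite mulrC (mulrC e).
have ex : expR (- (kappa * (a * (t - s)))) <= (kappa * (t - s) * a)^-1.
  rewrite expRN lef_pV2 ?posrE ?expR_gt0 ?mulr_gt0//.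
  apply: le_trans (expR_ge1Dx _); rewrite (_ : kappa * (a * (t - s)) = kappa * (t - s) * a); last by ring.
  by rewrite lerDr.
rewrite -/H -/c -/L.
apply: (@le_trans _ _ (c * th / 2 + W / a)); last by lra.
rewrite mulrDr -addrA; apply: lerD; first by rewrite mulrA.
rewrite /W mulrDl; apply: lerD.
  apply: eq_to_le; field.
  by rewrite !lt0r_neq0// ltr_wpDl.
rewrite -!mulrA; apply: ler_wpM2l => //; apply: ler_wpM2l => //.
by rewrite -invfM.
Qed.

Lemma sum_pi : \sum_k pi k 0 = 1. Proof. by case: hpi. Qed.

(** Sum of the previous estimate over the states, as the coordinates of both the chain and [pi] add
    up to 1. *)
Lemma count_estimate s t i e : 0 <= s -> s < t -> (i <= n)%N -> 0 < e ->
  exists2 a1, 0 < a1 & forall a, a1 <= a -> forall A, <<s Fa a s >> A ->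
  `|mean P (fun w => \1_A w * ((Na a t w == i)%:R -
     gtrans n linf i (Na a s w) (t - s)))| <= e * mean P (\1_A).
Proof.
move=> s0 st ni e0; have t0 := le_trans s0 (ltW st).
have e0' : 0 < e / m.+1%:R by exact: divr_gt0.
have [a1 a10 H] := uniform_estimate s0 st ni e0'.
exists a1 => // a aa1 A HA; have a0 := lt_le_trans a10 aa1.
have mA := Fa_measurable hX a0 (htau a0) s0 HA.
have bA : bmeas (\1_A : T -> R) by exact: bmeas_indic.
have bi : bmeas (fun w => (Na a t w == i)%:R : R).
  apply: (gbmeas_Fa_bmeas hX a0 (htau a0) t0).
  exact: (gbmeas_fun_count X a (tau a) (fun j => (j == i)%:R) t0 (lexx t)).
have bg : bmeas (fun w => gtrans n linf i (Na a s w) (t - s)).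
  apply: (gbmeas_Fa_bmeas hX a0 (htau a0) s0).
  exact: (gbmeas_fun_count X a (tau a) (fun j => gtrans n linf i j (t - s)) s0 (lexx s)).
have -> : mean P (fun w => \1_A w * ((Na a t w == i)%:R - gtrans n linf i (Na a s w) (t - s))) =
  \sum_k mean P (fun w => \1_A w * ((Na a t w == i)%:R * speed_up X a t w k 0 -
     gtrans n linf i (Na a s w) (t - s) * pi k 0)).
  rewrite -mean_sum; last first.
    move=> k; apply: itgM => //; apply: bmeasB.
      by apply: bmeasM => //; exact: (bmeas_Y hX a0 k t0).
    by apply: bmeasM => //; exact: bmeas_cst.
  apply: eq_mean => w; rewrite -mulr_sumr sumrB -!mulr_sumr (sum_Y hX a0)//.
  by rewrite sum_pi !mulr1.
apply: le_trans (ler_norm_sum _ _ _) _.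
apply: (@le_trans _ _ (\sum_(k < m) e / m.+1%:R * mean P (\1_A))).
  by apply: ler_sum => k _; exact: H.
rewrite sumr_const card_ord -[leLHS]mulr_natl mulrA ler_wpM2r//.
  by apply: mean_ge0 => w; rewrite indicE.
by rewrite mulrCA ler_piMr ?(ltW e0)// ler_pdivrMr// mul1r ler_nat.
Qed.

Lemma cond_exp_close (G : set_system T) (f g z : T -> R) e :
  <<s G >> `<=` measurable -> gbmeas G g -> is_cond_exp P G f z ->
  (forall A, <<s G >> A -> `|mean P (fun w => \1_A w * (f w - g w))| <= e * mean P (\1_A)) ->
  {ae P, forall w, `|z w - g w| <= e}.
Proof.
move=> Gm gg ce H; have bg := gbmeas_bmeas Gm gg.
have [If Iz mz _] := ce.
have Izg : itg P (fun w => z w - g w) by apply: itgB => //; exact: bmeas_itg.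
have mzg : gmeas G (fun w => z w - g w) by apply: measurable_funB => //; exact: gg.1.
have E A : <<s G >> A -> mean P (fun w => \1_A w * (z w - g w)) = mean P (fun w => \1_A w * (f w - g w)).
  move=> HA; have bA := bmeas_indic (R := R) (Gm _ HA).
  have sp (h : T -> R) : itg P h -> mean P (fun w => \1_A w * (h w - g w)) =
      mean P (fun w => \1_A w * h w) - mean P (fun w => \1_A w * g w).
    move=> Ih; rewrite -meanB; first by apply: eq_mean => w; rewrite mulrBr.
      exact: itg_bmeasM.
    by apply: itg_bmeasM => //; exact: bmeas_itg.
  by rewrite !sp// (cond_exp_mean Gm ce HA).
have h1 : {ae P, forall w, z w - g w <= e}.
  apply: (ae_le_of_mean Gm Izg mzg) => A HA; rewrite E//.
  by apply: le_trans (ler_norm _) _; exact: H.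
have h2 : {ae P, forall w, - (z w - g w) <= e}.
  apply: (@ae_le_of_mean _ _ _ P G (fun w => - (z w - g w)) e Gm).
  - exact: itgN.
  - by apply: measurableT_comp => //; exact: measurable_oppr.
  - move=> A HA; rewrite (_ : mean _ _ = - mean P (fun w => \1_A w * (z w - g w))).
      by rewrite E//; apply: le_trans (ler_norm _) _; rewrite normrN; exact: H.
    rewrite -[RHS]mulN1r -meanZ; first by apply: eq_mean => w; ring.
    by apply: itg_bmeasM => //; apply: bmeas_indic; exact: Gm.
by apply: filterS2 h1 h2 => w w1 w2; rewrite ler_norml lerNl w2 w1.
Qed.

Lemma near_pinfty_ge (a1 : R) : \forall a \near +oo, a1 <= a.
Proof. by apply: nbhs_pinfty_ge; exact: num_real. Qed.

Theorem conditional_law_and_state s t i : 0 <= s -> s < t -> (i <= n)%N ->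
  forall zeta : R -> T -> 'cV[R]_m,
    (forall (a : R) (k : 'I_m), 0 < a ->
       is_cond_exp P (Fa a s)
         (fun w => \1_[set w | Na a t w = i] w * speed_up X a t w k 0)
         (fun w => zeta a w k 0)) ->
    Lnorm P +oo%E (fun w =>
       (`|zeta a w - gtrans n linf i (Na a s w) (t - s) *: pi|%R)%:E)%E
      @[a --> +oo] --> 0%E.
Proof.
move=> s0 st ni zeta hz; apply: ereal_cvg0 => e e0.
have [a1 a10 H] := uniform_estimate s0 st ni e0.
apply: filterS (near_pinfty_ge a1) => a aa1; have a0 := lt_le_trans a10 aa1.
apply: Lnorm_infty_bounds.
have K (k : 'I_m) : {ae P, forall w, `|zeta a w k 0 - gtrans n linf i (Na a s w) (t - s) * pi k 0| <= e}.
  apply: (cond_exp_close (Fa_measurable hX a0 (htau a0) s0) _ (hz a k a0)).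
    exact: (gbmeas_fun_count X a (tau a) (fun j => gtrans n linf i j (t - s) * pi k 0) s0 (lexx s)).
  move=> A HA; apply: le_trans (H a aa1 k A HA); apply: eq_to_le.
  congr (`|_|); apply: eq_mean => w; congr (_ * (_ * _ - _)).
  exact: indic_eq.
have : {ae P, forall w, forall k, `|zeta a w k 0 - gtrans n linf i (Na a s w) (t - s) * pi k 0| <= e}.
  by apply: filter_forall => k; exact: K.
apply: filterS => w h; rewrite normr_id.
rewrite /Num.Def.normr/= mx_normrE; apply/bigmax_leP; split; first exact: ltW.
move=> [k j] _ /=; move: h; set l := linf => h.
by rewrite !mxE !(ord1 j); exact: h.
Qed.

Theorem conditional_law s t i : 0 <= s -> s < t -> (i <= n)%N ->
  forall p : R -> T -> R,
    (forall a : R, 0 < a ->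
       is_cond_prob P (Fa a s) [set w | Na a t w = i] (p a)) ->
    Lnorm P +oo%E (fun w =>
       (p a w - gtrans n linf i (Na a s w) (t - s))%:E)%E
      @[a --> +oo] --> 0%E.
Proof.
move=> s0 st ni p hp; apply: ereal_cvg0 => e e0.
have [a1 a10 H] := count_estimate s0 st ni e0.
apply: filterS (near_pinfty_ge a1) => a aa1; have a0 := lt_le_trans a10 aa1.
apply: Lnorm_infty_bounds.
apply: (cond_exp_close (Fa_measurable hX a0 (htau a0) s0) _ (hp a a0)).
  exact: (gbmeas_fun_count X a (tau a) (fun j => gtrans n linf i j (t - s)) s0 (lexx s)).
move=> A HA; apply: le_trans (H a aa1 A HA); apply: eq_to_le.
congr (`|_|); apply: eq_mean => w; congr (_ * (_ - _)).
exact: indic_eq.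
Qed.

End uniform_estimates.

(** * The limit process *)

Section counting_paths.
Context {R : realType}.
Implicit Types x : R -> nat.

Definition counting_path x : Prop :=
  (forall s t, 0 <= s -> s <= t -> (x s <= x t)%N) /\ cadlag (fun t => (x t)%:R : R).

(** Natural numbers at distance less than 1 are equal, so right-continuity means being locally
    constant to the right. *)
Lemma counting_path_right x z : counting_path x -> 0 <= z ->
  exists2 e, 0 < e & forall v, z <= v -> v < z + e -> x v = x z.
Proof.
move=> [_ [xr _]] z0; have /cvgrPdist_lt/(_ 1 ltr01) := xr z z0.
rewrite near_withinE => -[e /= e0 H]; exists e => // v.
rewrite le_eqVlt => /predU1P[->//|zv] ve.
have := H v; rewrite /= distrC gtr0_norm ?subr_gt0// ltrBlDl => /(_ ve zv).
rewrite ltr_distl => /andP[h1 h2].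
have : (x z)%:R < (x v).+1%:R :> R by rewrite -natr1; lra.
have : (x v)%:R < (x z).+1%:R :> R by rewrite -natr1; lra.
by rewrite !ltr_nat !ltnS => h3 h4; apply/eqP; rewrite eqn_leq h3.
Qed.

(* Lebesgue's number lemma, each point having a neighbourhood in which a path
   with unit jumps grows by at most 1. *)
Lemma unit_jump_modulus x (b : R) : counting_path x ->
  (forall t, 0 < t -> \forall u \near t^'-, (x t <= (x u).+1)%N) ->
  exists2 e, 0 < e &
    forall u v, 0 <= u -> u <= b -> u <= v -> v <= u + e -> (x v <= (x u).+1)%N.
Proof.
move=> xc xj; have [xm _] := xc.
have := (compact_near_coveringP (`[0, b]%classic : set R)).1 (@segment_compact R 0 b).
pose Q (e u : R) := 0 <= u -> forall v, u <= v -> v <= u + e -> (x v <= (x u).+1)%N.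
move=> /(_ R (0 : R)^'+ Q _); case.
  move=> z; rewrite /= in_itv/= => /andP[z0 zb].
  have [e1 e10 xr] := counting_path_right xc z0.
  have [e2 e20 xl] : exists2 e2, 0 < e2 & forall u, 0 <= u -> z - e2 < u -> u < z -> (x z <= (x u).+1)%N.
    move: z0; rewrite le_eqVlt => /predU1P[<-|z0].
      by exists 1 => // u u0 _; rewrite ltNge u0.
    have := xj z z0; rewrite near_withinE => -[e /= e0 H]; exists e => // u u0 zu uz.
    by apply: H => //=; rewrite gtr0_norm ?subr_gt0//; lra.
  pose e := Num.min e1 e2.
  have e0 : 0 < e by rewrite lt_min e10.
  have e0' : 0 < e / 2 by rewrite divr_gt0.
  exists (ball z (e / 2), [set y | 0 < y < e / 2]).
    split; first exact: nbhsx_ballx.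
    exists (e / 2) => //= y /=.
    by rewrite sub0r normrN => + y0; rewrite y0/= gtr0_norm.
  move=> [u y] /= [+ /andP[y0 ye]] u0 v uv vy.
  rewrite /ball/= ltr_distl => /andP[zu uz].
  have ee1 : e <= e1 by rewrite ge_min lexx.
  have ee2 : e <= e2 by rewrite ge_min lexx orbT.
  have vz : (x v <= x z)%N.
    have [vz|zv] := leP v z; first by apply: xm => //; exact: le_trans uv.
    rewrite (xr v (ltW zv))//; lra.
  apply: leq_trans vz _.
  have [zu'|uz'] := leP z u; first by apply: leqW; exact: xm.
  by apply: xl => //; lra.
move=> e /= e0 H.
exists (e / 2); first by rewrite divr_gt0.
move=> u v u0 ub uv vu; apply: (H (e / 2) _ _ u) => //=.
- by rewrite sub0r normrN gtr0_norm ?divr_gt0//; lra.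
- by rewrite divr_gt0.
- by rewrite in_itv/= u0.
Qed.

End counting_paths.

Section binomial_process.
Context {R : realType} {d : measure_display} {T : measurableType d}.
Variables (P : probability T R) (n : nat) (l : R) (l0 : 0 <= l).
Variables (N : R -> T -> nat) (hN : counting_process (R := R) N).
Hypothesis hint : binomial_intensity P n l N.

Local Notation F s := (count_filtration N s).

Let Nc w : counting_path (N ^~ w).
Proof.
split; last exact: (counting_cadlag hN).
by move=> s t s0 st; exact: (counting_nondecreasing hN).
Qed.

Lemma F_measurable s : <<s F s >> `<=` measurable.
Proof.
apply: gen_sigma_measurable; apply: sub_events_of_measurable => u.
by rewrite /= in_itv/= => /andP[u0 _]; exact: (counting_measurable hN).
Qed.

Lemma F_mono s t : s <= t -> <<s F s >> `<=` <<s F t >>.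
Proof.
move=> st; apply: sub_gen_sigma => A [u us uA]; apply: sub_gen; exists u => //.
by move: us; rewrite /= !in_itv/= => /andP[->]/= /le_trans; apply.
Qed.

Lemma gmeas_N u s : 0 <= u -> u <= s -> gmeas (F s) (fun w => (N u w)%:R : R).
Proof.
move=> u0 us; apply: (@events_of_gmeas _ _ _ _ `[0, s]%classic (fun u w => (N u w)%:R)).
  exact: sub_gen.
by rewrite /= in_itv/= u0.
Qed.

Lemma gen_N u s j : 0 <= u -> u <= s -> <<s F s >> [set w | N u w = j].
Proof.
move=> u0 us; rewrite (_ : [set _ | _] = [set w | (N u w)%:R = j%:R :> R]).
  by apply: gen_eq1; exact: gmeas_N.
by apply/seteqP; split => w /=; [move=> ->|move=> /eqP; rewrite eqr_nat => /eqP].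
Qed.

Lemma gmeas_funN (f : nat -> R) u s : 0 <= u -> u <= s -> gmeas (F s) (fun w => f (N u w)).
Proof.
move=> u0 us.
apply: (@measurable_fun_cvg _ (g_sigma_algebraType (F s)) R setT
  (fun K w => \sum_(j < K) f j * \1_[set w | N u w = j] w)).
  move=> K; apply: measurable_sum => j; apply: measurable_funM; first exact: measurable_cst.
  by apply: (gbmeas_indic _).1; exact: gen_N.
move=> w _; apply: cvg_near_cst; near=> K.
have NK : (N u w < K)%N by near: K; exists (N u w).+1.
rewrite (bigD1 (Ordinal NK))//= indicE mem_set// mulr1 big1 ?addr0// => j jN.
rewrite indicE memNset ?mulr0//= => e; move/negP : jN; apply.
by apply/eqP/val_inj; rewrite /= e.
Unshelve. all: by end_near. Qed.

Lemma meas_funN (f : nat -> R) u : 0 <= u -> measurable_fun setT (fun w => f (N u w)).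
Proof.
by move=> u0; apply: (gmeas_meas (@F_measurable u)); exact: gmeas_funN.
Qed.

Definition intensity u w : R := l * (n%:R - (N u w)%:R).

Definition compensator s t w : R := \int[lebesgue_measure]_(u in `[s, t]) intensity u w.

Lemma intensity_right w u : 0 <= u -> intensity v w @[v --> u^'+] --> intensity u w.
Proof.
move=> u0; apply: cvgMr; apply: cvgB; first exact: cvg_cst.
by have [_ [h _]] := Nc w; exact: h.
Qed.

(** At this point [N] may exceed [n] and the intensity may be negative, so the bound depends on the
    path. *)
Lemma intensity_norm u b w : 0 <= u -> u <= b -> `|intensity u w| <= l * (n%:R + (N b w)%:R).
Proof.
move=> u0 ub; rewrite /intensity normrM (ger0_norm l0) ler_wpM2l//.
apply: le_trans (ler_normB _ _) _; rewrite !normr_nat lerD2l ler_nat.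
by have [h _] := Nc w; exact: h.
Qed.

Lemma integrable_intensity s t w : 0 <= s ->
  lebesgue_measure.-integrable `[s, t] (EFin \o intensity ^~ w).
Proof.
move=> s0; have [st|] := ltP s t.
  apply: (@riemann_sum_cvg _ _ _ _ (l * (n%:R + (N t w)%:R)) st _ _).1.
    by move=> u su _; apply: intensity_right; exact: le_trans su.
  by move=> u su ut; apply: intensity_norm => //; exact: le_trans su.
rewrite le_eqVlt => /predU1P[->|ts].
  rewrite set_itv1; apply/integrableP; split; first exact: measurable_fun_set1.
  by rewrite integral_set1.
by rewrite set_itv_ge ?integrable_set0// bnd_simp -ltNge.
Qed.

Lemma compensatorD s t w : 0 <= s -> s <= t ->
  compensator 0 t w = compensator 0 s w + compensator s t w.
Proof.
move=> s0 st; have I0 := @integrable_intensity 0 t w (lexx _).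
have := @Rintegral_itvB _ (intensity ^~ w) (BLeft 0) (BRight t) s I0.
rewrite !bnd_simp => /(_ s0 st); rewrite -/(compensator 0 t w) -/(compensator 0 s w).
rewrite Rintegral_itv_obnd_cbnd; first by rewrite -/(compensator s t w) => <-; rewrite addrC subrK.
apply: integrableS (integrable_intensity t w s0) => //.
by apply: subset_itvr; rewrite bnd_simp.
Qed.

Lemma Rintegral_itv_cst (c s t : R) : s <= t ->
  \int[lebesgue_measure]_(u in `[s, t]) (cst c u) = c * (t - s).
Proof.
move=> st; rewrite Rintegral_cst//; congr (_ * _).
have : lebesgue_measure (`[s, t]%classic : set R) = (t - s)%:E.
  rewrite lebesgue_measure_itv/= lte_fin; case: ltP => [_|ts]; first by rewrite -EFinB.
  by congr EFin; apply/esym/eqP; rewrite subr_eq0 eq_le st ts.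
by move=> h; exact: (congr1 fine h).
Qed.

Lemma integrable_itv_cst (c s t : R) :
  lebesgue_measure.-integrable `[s, t] (EFin \o cst c).
Proof.
have muab : (lebesgue_measure (`[s, t]%classic : set R) < +oo)%E.
  by rewrite lebesgue_measure_itv; case: ifP => _; rewrite /= ?ltry//; exact: ltry.
apply: measurable_bounded_integrable => //.
by exists `|c|; split; [exact: num_real|move=> y My u _ /=; exact: ltW].
Qed.

Lemma compensator_bounds s t w : 0 <= s -> s <= t ->
  l * (t - s) * (n%:R - (N t w)%:R) <= compensator s t w <= l * (t - s) * (n%:R - (N s w)%:R).
Proof.
move=> s0 st; have [Nm _] := Nc w; have Ii := integrable_intensity t w s0.
have ic c := integrable_itv_cst c s t.
have E c : l * (t - s) * c = \int[lebesgue_measure]_(u in `[s, t]) (cst (l * c) u).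
  by rewrite Rintegral_itv_cst//; ring.
rewrite !E; apply/andP; split; apply: le_Rintegral => // u; rewrite /= in_itv/= => /andP[su ut].
  by rewrite ler_wpM2l// lerD2l lerN2 ler_nat; apply: Nm => //; exact: le_trans su.
by rewrite ler_wpM2l// lerD2l lerN2 ler_nat; apply: Nm.
Qed.

Let M t w : R := (N t w)%:R - compensator 0 t w.

Let martM s t : 0 <= s -> s <= t -> is_cond_exp P (F s) (M t) (M s).
Proof. exact: hint. Qed.

(** Integrability is inherited from the martingale: as [N] is nonnegative, the compensator is at
    most l t n. *)
Lemma itgN_count t : 0 <= t -> itg P (fun w => (N t w)%:R).
Proof.
move=> t0; have IM : itg P (M t) by case: (martM t0 (lexx t)).
apply: (@itg_le _ _ _ P _ (fun w => `|M t w| + l * t * n%:R)).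
- exact: (counting_measurable hN).
- by apply: itgD; [exact: itg_abs|exact: itg_cst].
move=> w; rewrite normr_nat; have := ler_norm (M t w).
have /andP[_] := compensator_bounds w (lexx 0) t0.
rewrite /M subr0 (counting0 hN) subr0; lra.
Qed.

Lemma martingale_increment (Z : T -> R) u v : 0 <= u -> u <= v -> gbmeas (F u) Z ->
  mean P (fun w => Z w * ((N v w)%:R - (N u w)%:R)) = mean P (fun w => Z w * compensator u v w) /\
  itg P (fun w => Z w * compensator u v w).
Proof.
move=> u0 uv gZ; have v0 := le_trans u0 uv.
have bZ := gbmeas_bmeas (@F_measurable u) gZ.
have ce := martM u0 uv; have [IMv IMu _ _] := ce.
have e := cond_exp_mul (@F_measurable u) ce gZ.1 gZ.2.
have Cmp w : compensator u v w = ((N v w)%:R - (N u w)%:R) - (M v w - M u w).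
  by rewrite /M (compensatorD w u0 uv); ring.
have IdN : itg P (fun w => Z w * ((N v w)%:R - (N u w)%:R)).
  exact: (itg_bmeasM bZ (itgB (itgN_count v0) (itgN_count u0))).
have IdM : itg P (fun w => Z w * (M v w - M u w)).
  exact: (itg_bmeasM bZ (itgB IMv IMu)).
have e0 : mean P (fun w => Z w * (M v w - M u w)) = 0.
  transitivity (mean P (fun w => Z w * M v w) - mean P (fun w => Z w * M u w)).
    by rewrite -meanB; [apply: eq_mean => w; rewrite mulrBr|exact: itg_bmeasM|exact: itg_bmeasM].
  by rewrite e subrr.
have E : (fun w => Z w * compensator u v w) =
    (fun w => Z w * ((N v w)%:R - (N u w)%:R) - Z w * (M v w - M u w)).
  by apply/funext => w; rewrite Cmp mulrBr.
by rewrite E; split; [rewrite (meanB IdN IdM) e0 subr0|exact: (itgB IdN IdM)].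
Qed.

(** * Exponential decay of the means of eigenfunctions *)

Section functional.
Variables (phi : nat -> R) (B c : R).
Hypotheses (c0 : 0 <= c).
Hypothesis phiB : forall j, `|phi j.+1 - phi j| <= B.
Hypothesis phiE : forall j, (n%:R - j%:R) * (phi j.+1 - phi j) = - c * phi j.

Let B0 : 0 <= B. Proof. exact: le_trans (phiB 0). Qed.

Lemma phi_lip i j : `|phi (i + j)%N - phi i| <= B * j%:R.
Proof.
elim: j => [|j IH]; first by rewrite addn0 subrr normr0 mulr0.
rewrite addnS -natr1 mulrDr mulr1 -(subrKA (phi (i + j)%N)) addrC.
by apply: le_trans (ler_normD _ _) _; apply: lerD.
Qed.

Lemma itg_phi t : 0 <= t -> itg P (fun w => phi (N t w)).
Proof.
move=> t0; apply: (@itg_le _ _ _ P _ (fun w => `|phi 0%N| + B * (N t w)%:R)).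
- exact: meas_funN.
- apply: itgD; first exact: itg_cst.
  by apply: itgZ; exact: itgN_count.
move=> w; rewrite -[phi (N t w)](subrK (phi 0%N)) addrC.
by apply: le_trans (ler_normD _ _) _; rewrite lerD2l; have := phi_lip 0 (N t w); rewrite add0n.
Qed.

Let J u v w : R := if (N v w <= (N u w).+1)%N then 0 else (N v w)%:R - (N u w)%:R.

Let J_bounds u v w : 0 <= u -> u <= v -> 0 <= J u v w <= (N v w)%:R - (N u w)%:R.
Proof.
move=> u0 uv; have [Nm _] := Nc w; have := Nm _ _ u0 uv; rewrite -(ler_nat R) => h.
by rewrite /J; case: ifP => _; rewrite ?lexx ?subr_ge0 ?h.
Qed.

Let J_meas u v : 0 <= u -> u <= v -> measurable_fun setT (J u v).
Proof.
move=> u0 uv; have v0 := le_trans u0 uv.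
rewrite (_ : J u v = fun w => (((N v w)%:R - (N u w)%:R) *
  \1_[set w | (1 : R) < (N v w)%:R - (N u w)%:R] w)); last first.
  apply/funext => w; rewrite /J indicE; have [Nm _] := Nc w; have Nuv := Nm _ _ u0 uv.
  have E : ((1 : R) < (N v w)%:R - (N u w)%:R) = ~~ (N v w <= (N u w).+1)%N.
    by rewrite ltrBrDl natr1 ltr_nat ltnNge.
  case: ifPn => h; first by rewrite memNset ?mulr0//= E h.
  by rewrite mem_set ?mulr1//= E.
have mD : measurable_fun setT (fun w => (N v w)%:R - (N u w)%:R : R).
  by apply: measurable_funB; exact: (counting_measurable hN).
apply: measurable_funM => //; apply: measurable_indic.
have := mD measurableT `]1, +oo[%classic (measurable_itv _).
rewrite setTI; congr measurable; apply/funext => w /=.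
by rewrite in_itv/= andbT.
Qed.

Let J_itg u v : 0 <= u -> u <= v -> itg P (J u v).
Proof.
move=> u0 uv; have v0 := le_trans u0 uv.
apply: (@itg_le _ _ _ P _ (fun w => (N v w)%:R - (N u w)%:R)).
- exact: J_meas.
- by apply: itgB; exact: itgN_count.
- by move=> w; have /andP[h1 h2] := J_bounds w u0 uv; rewrite ger0_norm.
Qed.

(* [phiE] makes [phi] an eigenfunction of the generator; it only sees unit jumps,
   and [J] collects the remaining ones, negligible on a fine grid. *)
Lemma one_step s u v A : 0 <= s -> s <= u -> u <= v -> <<s F s >> A ->
  `|mean P (fun w => \1_A w * phi (N v w)) -
    expR (- (c * l * (v - u))) * mean P (fun w => \1_A w * phi (N u w))| <=
  2 * B * mean P (J u v) + B * (l * (v - u)) * mean P (fun w => (N v w)%:R - (N u w)%:R) +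
  (c * l * (v - u)) ^+ 2 * `|mean P (fun w => \1_A w * phi (N u w))|.
Proof.
move=> s0 su uv HA; have u0 := le_trans s0 su; have v0 := le_trans u0 uv.
have gA : gbmeas (F u) (\1_A : T -> R) by apply: gbmeas_indic; exact: F_mono HA.
have bA := gbmeas_bmeas (@F_measurable u) gA.
have A01 w : 0 <= (\1_A w : R) <= 1 by rewrite indicE; case: (w \in A); rewrite ?lexx ?ler01.
pose D j := phi j.+1 - phi j.
have gZ : gbmeas (F u) (fun w => \1_A w * D (N u w)).
  apply: bmeasM => //; split; first exact: (gmeas_funN D u0 (lexx u)).
  by exists B => w; exact: phiB.
have bZ := gbmeas_bmeas (@F_measurable u) gZ.
have ZB w : `|\1_A w * D (N u w)| <= B.
  have /andP[a0 a1] := A01 w; rewrite normrM (ger0_norm a0).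
  by apply: le_trans (ler_piMl _ a1) (phiB _).
set h := v - u; have h0 : 0 <= h by rewrite subr_ge0.
set dN := fun w => (N v w)%:R - (N u w)%:R : R.
have IdN : itg P dN by apply: itgB; exact: itgN_count.
have dN0 w : 0 <= dN w by rewrite subr_ge0 ler_nat; have [Nm _] := Nc w; exact: Nm.
have [e1 IZc] := martingale_increment u0 uv gZ.
(* Remainder of the first-order expansion; it vanishes for increments 0 and 1. *)
pose r w := \1_A w * (phi (N v w) - phi (N u w) - D (N u w) * dN w).
have Ir : itg P r.
  apply: itg_bmeasM => //; apply: itgB; first by apply: itgB; exact: itg_phi.
  apply: itg_bmeasM => //; split; first exact: meas_funN.
  by exists B => w; exact: phiB.
have rJ w : `|r w| <= 2 * B * J u v w.
  have /andP[a0 a1] := A01 w; rewrite normrM (ger0_norm a0).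
  apply: le_trans (ler_piMl _ a1) _ => //.
  have [Nm _] := Nc w; have Nuv := Nm _ _ u0 uv.
  rewrite /J /dN; case: ifP => h1.
    have [->|->] : N v w = N u w \/ N v w = (N u w).+1.
      move: h1; rewrite leq_eqVlt ltnS => /predU1P[->|h1]; [by right|left].
      by apply/eqP; rewrite eqn_leq h1.
      by rewrite !(subrr, mulr0, normr0).
    have -> : (N u w).+1%:R - (N u w)%:R = 1 :> R by rewrite -natr1; ring.
    by rewrite /D !(mulr1, subrr, mulr0, normr0).
  apply: le_trans (ler_normB _ _) _.
  have -> : 2 * B * ((N v w)%:R - (N u w)%:R) = B * ((N v w)%:R - (N u w)%:R) + B * ((N v w)%:R - (N u w)%:R) by ring.
  rewrite -natrB//; apply: lerD.
    by have := phi_lip (N u w) (N v w - N u w); rewrite subnKC.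
  by rewrite normrM normr_nat; apply: ler_wpM2r; [exact: ler0n|exact: phiB].
(* Error of freezing the intensity at time [u]; as [N] is monotone, it is controlled by l h times
   the increment. *)
pose q w := \1_A w * D (N u w) * (compensator u v w - l * h * (n%:R - (N u w)%:R)).
have In : itg P (fun w => n%:R - (N u w)%:R).
  by apply: itgB; [exact: itg_cst|exact: itgN_count].
have IZn : itg P (fun w => \1_A w * D (N u w) * (l * h * (n%:R - (N u w)%:R))).
  by apply: itg_bmeasM => //; exact: itgZ.
have qE : q = fun w => \1_A w * D (N u w) * compensator u v w - \1_A w * D (N u w) * (l * h * (n%:R - (N u w)%:R)).
  by apply/funext => w; rewrite /q mulrBr.
have Iq : itg P q by rewrite qE; exact: itgB.
have qN w : `|q w| <= B * (l * h) * dN w.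
  rewrite normrM -[leRHS]mulrA; apply: ler_pM => //.
  have /andP[h1 h2] := compensator_bounds w u0 uv.
  rewrite -/h in h1 h2; rewrite ler_norml; apply/andP; split.
    move: h1; rewrite /dN.
    move: (compensator u v w) ((N v w)%:R : R) ((N u w)%:R : R) (l * h) (n%:R : R) => x y z k n'.
    by lra.
  apply: (@le_trans _ _ 0); first by rewrite subr_le0.
  by rewrite !mulr_ge0// ?dN0.
set Gu := mean P (fun w => \1_A w * phi (N u w)).
set Gv := mean P (fun w => \1_A w * phi (N v w)).
have IA t : 0 <= t -> itg P (fun w => \1_A w * phi (N t w)).
  by move=> t0; apply: itg_bmeasM => //; exact: itg_phi.
have E : Gv = Gu + (- (c * l * h) * Gu + mean P q) + mean P r.
  have -> : - (c * l * h) * Gu + mean P q = mean P (fun w => \1_A w * D (N u w) * dN w).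
    rewrite e1 qE meanB//.
    suff -> : mean P (fun w => \1_A w * D (N u w) * (l * h * (n%:R - (N u w)%:R))) = - (c * l * h) * Gu.
      by rewrite addrC subrK.
    rewrite -meanZ; last exact: IA.
    apply: eq_mean => w.
    have -> : \1_A w * D (N u w) * (l * h * (n%:R - (N u w)%:R)) =
      \1_A w * (l * h) * ((n%:R - (N u w)%:R) * D (N u w)) by ring.
    by rewrite /D phiE; ring.
  rewrite -meanD; [|exact: IA|by apply: itg_bmeasM].
  rewrite -meanD//; last by apply: itgD; [exact: IA|exact: itg_bmeasM].
  by apply: eq_mean => w; rewrite /r; ring.
have -> : Gv - expR (- (c * l * h)) * Gu =
    mean P r + mean P q + (1 - c * l * h - expR (- (c * l * h))) * Gu by rewrite E; ring.
apply: le_trans (ler_normD _ _) _; apply: lerD; last first.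
  rewrite normrM; apply: ler_wpM2r => //.
  (* For x >= 0, 1 - x <= exp(-x) <= 1/(1 + x) <= 1 - x + x^2. *)
  set x := c * l * h; have x0 : 0 <= x by rewrite !mulr_ge0.
  have := expR_ge1Dx (- x); have : expR (- x) <= (1 + x)^-1.
    by rewrite expRN lef_pV2 ?posrE ?expR_gt0 ?ltr_wpDr//; exact: expR_ge1Dx.
  have : (1 + x)^-1 <= 1 - x + x ^+ 2.
    rewrite -[leLHS]mul1r ler_pdivrMr ?ltr_wpDr//.
    have : 0 <= x ^+ 3 by exact: exprn_ge0.
    by rewrite !exprS; lra.
  by move=> h1 h2 h3; rewrite ler_norml; apply/andP; split; have := sqr_ge0 x; lra.
apply: le_trans (ler_normD _ _) _; apply: lerD.
  apply: le_trans (mean_norm Ir) _; rewrite -meanZ; last exact: J_itg.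
  by apply: mean_le => //; [exact: itg_abs|by apply: itgZ; exact: J_itg].
apply: le_trans (mean_norm Iq) _; rewrite -meanZ//.
by apply: mean_le => //; [exact: itg_abs|exact: itgZ].
Qed.

(** On each path the sum is 0 as soon as the mesh is finer than the modulus of [unit_jump_modulus],
    and by telescoping it is dominated by the integrable [N t]. *)
Lemma jump_sum_cvg s t : 0 <= s -> s < t ->
  (fun K => mean P (fun w => \sum_(i < K.+1)
     J (s + (t - s) / K.+1%:R * i%:R) (s + (t - s) / K.+1%:R * i.+1%:R) w)) @ \oo --> (0 : R).
Proof.
move=> s0 st; have t0 := le_trans s0 (ltW st).
pose h (K : nat) := (t - s) / K.+1%:R.
have h0 K : 0 < h K by rewrite divr_gt0// subr_gt0.
pose u K (i : nat) := s + h K * i%:R.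
have u0 K i : 0 <= u K i by rewrite addr_ge0// mulr_ge0// ltW.
have uS K i : u K i.+1 = u K i + h K by rewrite /u -natr1 mulrDr mulr1 addrA.
have uu K i : u K i <= u K i.+1 by rewrite uS lerDl ltW.
have uK K : u K K.+1 = t by rewrite /u /h divfK ?pnatr_eq0// addrC subrK.
have ut K i : (i <= K.+1)%N -> u K i <= t.
  by move=> iK; rewrite -(uK K) /u lerD2l ler_wpM2l ?ler_nat// ltW.
have [_ cv] : P.-integrable setT (EFin \o (fun=> 0 : R)) /\
    (fun K => mean P (fun w => \sum_(i < K.+1) J (u K i) (u K i.+1) w)) @ \oo --> mean P (fun=> 0 : R).
  apply: (@dominated_Rintegral _ _ _ P setT
    (fun K w => \sum_(i < K.+1) J (u K i) (u K i.+1) w) (fun=> 0) (fun w => (N t w)%:R)) => //.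
  - by move=> K; apply: measurable_sum => i; exact: J_meas.
  - move=> w _; apply: cvg_near_cst.
    have [e e0 He] := unit_jump_modulus t (Nc w) (counting_unit_jumps hN w).
    have /cvgrPdist_lt/(_ e e0) := cvg_harmonic_scale (t - s).
    apply: filterS => K; rewrite sub0r normrN -/(h K) (gtr0_norm (h0 K)) => hK.
    apply: big1 => i _; rewrite /J He//; first by apply: ut; exact: ltnW.
    by rewrite uS lerD2l ltW.
  - exact: itgN_count.
  - move=> K w _; rewrite ger0_norm; last first.
      by apply: sumr_ge0 => i _; have /andP[] := J_bounds w (u0 K i) (uu K i).
    apply: (@le_trans _ _ (\sum_(0 <= i < K.+1) ((N (u K i.+1) w)%:R - (N (u K i) w)%:R))).
      rewrite big_mkord; apply: ler_sum => i _.
      by have /andP[] := J_bounds w (u0 K i) (uu K i).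
    rewrite telescope_sumr// uK lerBlDr lerDl//.
by rewrite mean_cst in cv.
Qed.

(** [one_step] is iterated along a grid. The exponential factors multiply to the exact one and are
    at most 1, so earlier errors are not amplified and the errors simply add up. *)
Lemma mean_functional s t A : 0 <= s -> s <= t -> <<s F s >> A ->
  mean P (fun w => \1_A w * phi (N t w)) =
  expR (- (c * l * (t - s))) * mean P (fun w => \1_A w * phi (N s w)).
Proof.
move=> s0 + HA; rewrite le_eqVlt => /predU1P[<-|st].
  by rewrite subrr mulr0 oppr0 expR0 mul1r.
have t0 := le_trans s0 (ltW st).
have bA : bmeas (\1_A : T -> R) by apply: bmeas_indic; exact: F_measurable HA.
pose G u := mean P (fun w => \1_A w * phi (N u w)).
pose Gm := `|phi 0%N| + B * mean P (fun w => (N t w)%:R).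
have Gle u : 0 <= u -> u <= t -> `|G u| <= Gm.
  move=> u0 ut; have Iu : itg P (fun w => \1_A w * phi (N u w)) by exact: (itg_bmeasM bA (itg_phi u0)).
  apply: le_trans (mean_norm Iu) _.
  have -> : Gm = mean P (fun w => `|phi 0%N| + B * (N t w)%:R).
    rewrite meanD ?mean_cst ?meanZ//; first exact: itgN_count.
      exact: itg_cst.
    by apply: itgZ; exact: itgN_count.
  apply: mean_le; first exact: itg_abs.
    apply: itgD; first exact: itg_cst.
    by apply: itgZ; exact: itgN_count.
  move=> w; rewrite normrM.
  apply: (@le_trans _ _ `|phi (N u w)|).
    by apply: ler_piMl => //; rewrite indicE; case: (w \in A); rewrite ?normr1 ?normr0.
  rewrite -[phi (N u w)](subrK (phi 0%N)) addrC.
  apply: le_trans (ler_normD _ _) _; rewrite lerD2l.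
  have := phi_lip 0 (N u w); rewrite add0n => /le_trans; apply.
  by rewrite ler_wpM2l// ler_nat; have [Nm _] := Nc w; exact: Nm.
pose h (K : nat) := (t - s) / K.+1%:R.
have h0 K : 0 < h K by rewrite divr_gt0// subr_gt0.
pose u K (i : nat) := s + h K * i%:R.
have su K i : s <= u K i by rewrite lerDl mulr_ge0// ltW.
have u0 K i : 0 <= u K i by apply: le_trans (su K i).
have uS K i : u K i.+1 = u K i + h K by rewrite /u -natr1 mulrDr mulr1 addrA.
have uu K i : u K i <= u K i.+1 by rewrite uS lerDl ltW.
have uK K : u K K.+1 = t by rewrite /u /h divfK ?pnatr_eq0// addrC subrK.
have ut K i : (i <= K.+1)%N -> u K i <= t.
  by move=> iK; rewrite -(uK K) /u lerD2l ler_wpM2l ?ler_nat// ltW.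
pose err K i := 2 * B * mean P (J (u K i) (u K i.+1)) +
  B * (l * h K) * mean P (fun w => (N (u K i.+1) w)%:R - (N (u K i) w)%:R) +
  (c * l * h K) ^+ 2 * Gm.
have stepK K i : (i <= K.+1)%N ->
    `|G (u K i) - expR (- (c * l * (h K * i%:R))) * G s| <= \sum_(0 <= j < i) err K j.
  elim: i => [|i IH] iK.
    by rewrite big_nil /u mulr0 addr0 mulr0 oppr0 expR0 mul1r subrr normr0.
  rewrite big_nat_recr//= addrC.
  have -> : G (u K i.+1) - expR (- (c * l * (h K * i.+1%:R))) * G s =
     (G (u K i.+1) - expR (- (c * l * h K)) * G (u K i)) +
     expR (- (c * l * h K)) * (G (u K i) - expR (- (c * l * (h K * i%:R))) * G s).
    have -> : expR (- (c * l * (h K * i.+1%:R))) = expR (- (c * l * h K)) * expR (- (c * l * (h K * i%:R))).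
      by rewrite -expRD; congr expR; rewrite -natr1; ring.
    by ring.
  apply: le_trans (ler_normD _ _) _; apply: lerD.
    have := one_step s0 (su K i) (uu K i) HA.
    have -> : u K i.+1 - u K i = h K by rewrite uS; ring.
    move/le_trans; apply; rewrite /err lerD2l ler_wpM2l ?sqr_ge0//.
    by apply: Gle => //; apply: ut; exact: ltnW.
  rewrite normrM ger0_norm ?expR_ge0//.
  apply: le_trans (IH (ltnW iK)); apply: ler_piMl => //.
  by rewrite expR_le1 oppr_le0; apply: mulr_ge0; [exact: mulr_ge0|exact: ltW].
(* The summed errors: multiple jumps vanish in mean with the mesh, the increments telescope and keep
   a factor [h K], and so do the quadratic terms. *)
pose E K := 2 * B * mean P (fun w => \sum_(i < K.+1) J (u K i) (u K i.+1) w) +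
  B * l * mean P (fun w => (N t w)%:R - (N s w)%:R) * h K + (c * l) ^+ 2 * Gm * (t - s) * h K.
have sumE K : \sum_(0 <= j < K.+1) err K j = E K.
  rewrite /err !big_split/= -!mulr_sumr; congr (_ * _ + _ + _).
  - by rewrite mean_sum ?big_mkord// => i; exact: J_itg.
  - rewrite big_mkord -mean_sum; last by move=> i; apply: itgB; exact: itgN_count.
    rewrite (_ : mean P (fun w => \sum_(i < K.+1) _) = mean P (fun w => (N t w)%:R - (N s w)%:R)); first by ring.
    apply: eq_mean => w.
    rewrite -(big_mkord xpredT (fun i => (N (u K i.+1) w)%:R - (N (u K i) w)%:R)).
    by rewrite (telescope_sumr (fun i => (N (u K i) w)%:R))// uK /u mulr0 addr0.
  - rewrite big_const_nat subn0 iter_addr addr0 -[Gm *+ _]mulr_natl.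
    have hK : K.+1%:R * h K = t - s by rewrite mulrC divfK// pnatr_eq0.
    by rewrite -hK; ring.
have Ecv : E @ \oo --> (2 * B * 0 + B * l * mean P (fun w => (N t w)%:R - (N s w)%:R) * 0 + (c * l) ^+ 2 * Gm * (t - s) * 0).
  apply: cvgD; first apply: cvgD.
  - by apply: cvgMr; exact: jump_sum_cvg.
  - by apply: cvgMr; exact: cvg_harmonic_scale.
  - by apply: cvgMr; exact: cvg_harmonic_scale.
apply/eqP; rewrite -subr_eq0 -normr_le0.
rewrite !mulr0 !addr0 in Ecv.
apply: (ler_cvg_to (cvg_cst _) Ecv); apply: nearW => K; rewrite -sumE.
have := stepK K K.+1 (leqnn _); rewrite uK.
by rewrite /h divfK ?pnatr_eq0.
Qed.

End functional.

Lemma measurable_overflow t : 0 <= t -> measurable [set w | (n < N t w)%N].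
Proof.
move=> t0; rewrite (_ : [set _ | _] = [set w | (n%:R : R) < (N t w)%:R]); last first.
  by apply/seteqP; split => w /=; rewrite ltr_nat.
have mN : measurable_fun setT (fun w => (N t w)%:R : R) by exact: (counting_measurable hN).
have := mN measurableT `](n%:R : R), +oo[%classic (measurable_itv _).
rewrite setTI; congr measurable; apply/funext => w /=.
by rewrite in_itv/= andbT.
Qed.

(** Both n - j and its truncation at 0 satisfy [phiE] with c = 1, and both start from [n], so they
    have the same mean at [t]. Their difference is nonnegative and at least 1 where [N t] exceeds
    [n]. *)
Lemma mean_overflow0 t : 0 <= t -> mean P (\1_[set w | (n < N t w)%N]) = 0.
Proof.
move=> t0.
have mS := measurable_overflow t0.
have e1 : mean P (fun w => \1_[set: T] w * (n%:R - (N t w)%:R)) =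
    expR (- (1 * l * (t - 0))) * mean P (fun w => \1_[set: T] w * (n%:R - (N 0 w)%:R)).
  apply: (@mean_functional (fun j => n%:R - j%:R) 1 1) => //.
  - by move=> j; rewrite -natr1 ler_norml; apply/andP; split; lra.
  - by move=> j; rewrite -natr1; ring.
  - exact: gen_setT.
have e2 : mean P (fun w => \1_[set: T] w * (n - N t w)%:R) =
    expR (- (1 * l * (t - 0))) * mean P (fun w => \1_[set: T] w * (n - N 0 w)%:R).
  apply: (@mean_functional (fun j => (n - j)%:R) 1 1) => //.
  - move=> j; rewrite ler_norml; apply/andP.
    have : (n - j.+1 <= n - j)%N by lia.
    have : (n - j <= (n - j.+1).+1)%N by lia.
    by rewrite -!(ler_nat R) -natr1; split; lra.
  - move=> j; have [jn|nj] := ltnP j n.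
      by rewrite !natrB// ?(ltnW jn)// -natr1; ring.
    have -> : (n - j = 0)%N by lia.
    have -> : (n - j.+1 = 0)%N by lia.
    by rewrite subrr !mulr0.
  - exact: gen_setT.
have I1 : itg P (fun w => n%:R - (N t w)%:R).
  by apply: itgB; [exact: itg_cst|exact: itgN_count].
have I2 : itg P (fun w => (n - N t w)%:R).
  apply: bmeas_itg; split; first exact: (meas_funN (fun j => (n - j)%:R) t0).
  by exists n%:R => w; rewrite normr_nat ler_nat leq_subr.
have eq12 : mean P (fun w => n%:R - (N t w)%:R) = mean P (fun w => (n - N t w)%:R).
  have E (f : T -> R) : mean P (fun w => \1_[set: T] w * f w) = mean P f.
    by apply: eq_mean => w; rewrite indicT mul1r.
  rewrite -E e1 -[RHS]E e2; congr (_ * _); apply: eq_mean => w.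
  by rewrite (counting0 hN) subr0 subn0.
apply/eqP; rewrite eq_le mean_ge0 ?andbT; last by move=> w; rewrite indicE.
have -> : 0 = mean P (fun w => (n - N t w)%:R - (n%:R - (N t w)%:R)) by rewrite meanB// eq12 subrr.
apply: mean_le; [by apply: bmeas_itg; exact: bmeas_indic|exact: itgB|].
move=> w; rewrite indicE; have [/set_mem/= h|/negP h] := boolP (_ \in _).
  have -> : (n - N t w = 0)%N by lia.
  by move: h; rewrite -(ler_nat R) -natr1 => h; lra.
have h' : (N t w <= n)%N by rewrite leqNgt; apply/negP => h'; apply: h; apply/mem_set.
by rewrite natrB// subrr.
Qed.

Lemma mean_eq_off_overflow t (f g : T -> R) : 0 <= t -> bmeas f -> bmeas g ->
  (forall w, (N t w <= n)%N -> f w = g w) -> mean P f = mean P g.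
Proof.
move=> t0 bf bg fg; apply/eqP; rewrite -subr_eq0 -meanB; [|exact: bmeas_itg|exact: bmeas_itg].
have bfg := bmeasB bf bg; have [_ [C fgC]] := bfg.
rewrite -normr_le0; apply: le_trans (mean_norm (bmeas_itg P bfg)) _.
have mS := measurable_overflow t0.
have b1 : bmeas (\1_[set w | (n < N t w)%N] : T -> R) by exact: bmeas_indic.
have -> : 0 = mean P (fun w => C * \1_[set w | (n < N t w)%N] w).
  by rewrite meanZ ?mean_overflow0 ?mulr0//; exact: bmeas_itg.
apply: mean_le; [by apply: itg_abs; exact: bmeas_itg|by apply: itgZ; exact: bmeas_itg|].
move=> w; rewrite indicE; have [h|h] := leqP (N t w) n.
  by rewrite fg// subrr normr0 memNset ?mulr0//= ltnNge h.
by rewrite mem_set// mulr1.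
Qed.

Lemma bmeas_funN (f : nat -> R) t M' : 0 <= t -> (forall j, `|f j| <= M') -> bmeas (fun w => f (N t w)).
Proof. by move=> t0 fM; split; [exact: meas_funN|exists M' => w; exact: fM]. Qed.

(** With M = n - j, the identity M C(M-1, k) = (M - k) C(M, k) says that j |-> C(n - j, k) satisfies
    [phiE] with c = k. Its mean thus decays by the factor [y ^+ k], as the inversion of factorial
    moments requires. *)
Lemma survivor_law s t i A : 0 <= s -> s <= t -> (i <= n)%N -> <<s F s >> A ->
  mean P (fun w => \1_A w * ((n - N t w)%N == (n - i)%N)%:R) =
  mean P (fun w => \1_A w * binomial_weight n i (N s w) (expR (- l * (t - s)))).
Proof.
move=> s0 st ni HA; have t0 := le_trans s0 st; set y := expR _.
have bA : bmeas (\1_A : T -> R) by apply: bmeas_indic; exact: F_measurable HA.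
have bC u k : 0 <= u -> bmeas (fun w => 'C(n - N u w, k)%:R : R).
  move=> u0; apply: (bmeas_funN (f := fun j => 'C(n - j, k)%:R) (M' := 'C(n, k)%:R) u0) => j.
  by rewrite normr_nat ler_nat leq_bin2l// leq_subr.
have fm k : mean P (fun w => \1_A w * 'C(n - N t w, k)%:R) =
    y ^+ k * mean P (fun w => \1_A w * 'C(n - N s w, k)%:R).
  have -> : y ^+ k = expR (- (k%:R * l * (t - s))).
    by rewrite /y -expRM_natl; congr expR; ring.
  apply: (@mean_functional (fun j => 'C(n - j, k)%:R) 'C(n, k)%:R k%:R) => //.
  - move=> j.
    have h1 : ('C(n - j.+1, k) <= 'C(n - j, k))%N by apply: leq_bin2l; lia.
    have h2 : ('C(n - j, k) <= 'C(n, k))%N by apply: leq_bin2l; lia.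
    move: h1 h2; rewrite -!(ler_nat R) => h1 h2.
    have h3 : 0 <= 'C(n - j.+1, k)%:R :> R by [].
    by rewrite ler_norml; apply/andP; split; lra.
  - move=> j; have [jn|nj] := ltnP j n; last first.
      have -> : (n - j = 0)%N by lia.
      have -> : (n - j.+1 = 0)%N by lia.
      by case: (k) => [|k']; rewrite ?bin0n ?subrr !(mulr0, mul0r, oppr0).
    rewrite -natrB ?(ltnW jn)//.
    have -> : (n - j.+1 = (n - j).-1)%N by lia.
    set M' := (n - j)%N.
    rewrite mulrBr -!natrM mul_bin_down.
    have [kM|Mk] := leqP k M'; last by rewrite bin_small// !muln0 subrr mulr0.
    by rewrite !natrM natrB//; ring.
have IC k : itg P (fun w => \1_A w * 'C(n - N s w, k)%:R).
  by apply: itgM => //; exact: bC.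
apply: law_of_factorial_moments => //; try by move=> k; exact: bC.
  exact: bmeas_cst.
by move=> k; rewrite fm -meanZ//; apply: eq_mean => w; rewrite mulrCA.
Qed.

Let y01 r : 0 <= r -> 0 <= expR (- l * r) <= 1.
Proof. by move=> r0; rewrite expR_ge0 expR_le1 mulNr oppr_le0 mulr_ge0. Qed.

Lemma bmeas_gtrans s r i : 0 <= s -> 0 <= r -> (i <= n)%N ->
  bmeas (fun w => gtrans n l i (N s w) r).
Proof.
move=> s0 r0 ni.
apply: (bmeas_funN (f := fun j => gtrans n l i j r) (M' := \sum_(j < n.+1) 'C(n - j, n - i)%:R) s0) => j.
have [jn|nj] := leqP j n.
  have /andP[h1 h2] := binomial_weight_bounds i jn (y01 r0).
  by rewrite gtransE// ger0_norm.
rewrite /gtrans ifF ?normr0; first exact: sumr_ge0.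
by apply/negbTE; rewrite -ltnNge; exact: leq_ltn_trans nj.
Qed.

Lemma count_law s t i A : 0 <= s -> s <= t -> (i <= n)%N -> <<s F s >> A ->
  mean P (fun w => \1_A w * (N t w == i)%:R) =
  mean P (fun w => \1_A w * gtrans n l i (N s w) (t - s)).
Proof.
move=> s0 st ni HA; have t0 := le_trans s0 st.
have ts0 : 0 <= t - s by rewrite subr_ge0.
have bA : bmeas (\1_A : T -> R) by apply: bmeas_indic; exact: F_measurable HA.
have bb (b : nat -> bool) : bmeas (fun w => (b (N t w))%:R : R).
  apply: (bmeas_funN (f := fun j => (b j)%:R) (M' := 1) t0) => j.
  by case: (b j); rewrite ?normr1 ?normr0.
transitivity (mean P (fun w => \1_A w * ((n - N t w)%N == (n - i)%N)%:R)).
  apply: (mean_eq_off_overflow t0).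
  - by apply: bmeasM => //; exact: (bb (fun j => j == i)).
  - by apply: bmeasM => //; exact: (bb (fun j => (n - j)%N == (n - i)%N)).
  - move=> w Nn; congr (_ * (nat_of_bool _)%:R); apply/eqP/eqP => [->//|]; lia.
rewrite (survivor_law s0 st ni HA); apply: (mean_eq_off_overflow s0).
- apply: bmeasM => //.
  pose M' : R := \sum_(j < n.+1) 'C(n - j, n - i)%:R.
  apply: (bmeas_funN (f := fun j => binomial_weight n i j (expR (- l * (t - s)))) (M' := M' + 1) s0) => j.
  have [jn|nj] := leqP j n.
    have /andP[h1 h2] := binomial_weight_bounds i jn (y01 ts0).
    by rewrite ger0_norm//; apply: le_trans h2 _; rewrite lerDl.
  have -> : binomial_weight n i j (expR (- l * (t - s))) = binomial_weight n i n (expR (- l * (t - s))).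
    by rewrite /binomial_weight subnn (_ : (n - j = 0)%N)//; lia.
  have /andP[h1 h2] := binomial_weight_bounds i (leqnn n) (y01 ts0).
  by rewrite ger0_norm//; apply: le_trans h2 _; rewrite lerDl.
- by apply: bmeasM => //; exact: bmeas_gtrans.
- by move=> w Nn; rewrite gtransE.
Qed.

Lemma increment_law s t k : 0 <= s -> s < t ->
  is_cond_prob P (F s) [set w | (N t w - N s w)%N = k]
    (fun w => binomial_pmf (n - N s w) (1 - expR (- l * (t - s))) k).
Proof.
move=> s0 st; have st' := ltW st; have t0 := le_trans s0 st'.
have ts0 : 0 <= t - s by rewrite subr_ge0.
set y := expR _; have /andP[y0 y1] : 0 <= y <= 1 by exact: y01.
have mE : measurable [set w | (N t w - N s w)%N = k].
  rewrite (_ : [set _ | _] = [set w | (N t w)%:R - (N s w)%:R = k%:R :> R]); last first.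
    apply/seteqP; split => w /=; have [Nm _] := Nc w; have h := Nm _ _ s0 st'.
      by move=> <-; rewrite natrB.
    by rewrite -natrB// => /eqP; rewrite eqr_nat => /eqP.
  have mD : measurable_fun setT (fun w => (N t w)%:R - (N s w)%:R : R).
    by apply: measurable_funB; exact: (counting_measurable hN).
  by have := mD measurableT [set k%:R] (measurable_set1 _); rewrite setTI.
have pmfE j : (j <= n)%N -> binomial_pmf (n - j) (1 - y) k =
    if (j + k <= n)%N then gtrans n l (j + k) j (t - s) else 0.
  move=> jn; rewrite /binomial_pmf /unstable.onem subKr; case: leqP => jk; last first.
    by rewrite bin_small ?mulr0n//; lia.
  rewrite gtransE// /binomial_weight -/y -mulr_natl.
  have -> : (n - (j + k) = n - j - k)%N by lia.
  rewrite bin_sub; last by lia.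
  have -> : (n - j - (n - j - k) = k)%N by lia.
  by rewrite [_ ^+ k * _]mulrC.
pose pmf j := binomial_pmf (n - j) (1 - y) k.
have pmfB j : `|pmf j| <= 'C(n, k)%:R.
  rewrite /pmf /binomial_pmf /unstable.onem subKr -mulr_natl normrM normr_nat.
  apply: (@le_trans _ _ ('C(n - j, k)%:R)); last by rewrite ler_nat leq_bin2l// leq_subr.
  apply: ler_piMr => //; rewrite normrM !normrX mulr_ile1 ?exprn_ge0//.
    by rewrite exprn_ile1// ger0_norm; lra.
  by rewrite exprn_ile1// ger0_norm.
have gp : gbmeas (F s) (fun w => pmf (N s w)).
  by split; [exact: gmeas_funN|exists 'C(n, k)%:R => w; exact: pmfB].
have bp := gbmeas_bmeas (@F_measurable s) gp.
apply: (mean_cond_exp (@F_measurable s)).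
- by apply: bmeas_itg; exact: bmeas_indic.
- exact: bmeas_itg.
- exact: gp.1.
move=> A HA.
have bA : bmeas (\1_A : T -> R) by apply: bmeas_indic; exact: F_measurable HA.
(* An increment [k] leads to the value N_s + k; fixing the value of N_s makes this target
   deterministic. *)
pose Aj (j : nat) := A `&` [set w | N s w = j].
have HAj j : <<s F s >> (Aj j) by apply: gen_setI => //; exact: gen_N.
have bAj j : bmeas (\1_(Aj j) : T -> R) by apply: bmeas_indic; exact: F_measurable (HAj j).
have bt j : bmeas (fun w => (N t w == j)%:R : R).
  apply: (bmeas_funN (f := fun i => (i == j)%:R) (M' := 1) t0) => i.
  by case: (i == j); rewrite ?normr1 ?normr0.
have AjE j w : \1_(Aj j) w = \1_A w * (N s w == j)%:R :> R.
  by rewrite indicI_mul indic_eq.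
transitivity (\sum_(j < n.+1) mean P (fun w => \1_(Aj j) w * pmf j)).
  rewrite -mean_sum; last by move=> j; apply: itgM => //; exact: bmeas_cst.
  apply: (mean_eq_off_overflow s0).
  - exact: bmeasM.
  - by apply: bmeas_sum => j; apply: bmeasM => //; exact: bmeas_cst.
  move=> w Nn; have Nn' : (N s w < n.+1)%N by [].
  rewrite (bigD1 (Ordinal Nn'))//= AjE eqxx mulr1 big1 ?addr0// => j jN.
  rewrite AjE; case: eqP => e; last by rewrite mulr0 mul0r.
  by move/negP : jN; case; apply/eqP/val_inj; rewrite /= e.
transitivity (\sum_(j < n.+1) mean P (fun w => \1_(Aj j) w * (N t w == j + k)%N%:R)).
  apply: eq_bigr => j _; have jn : (j <= n)%N by rewrite -ltnS.
  rewrite /pmf pmfE//; case: leqP => jk.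
    rewrite (count_law s0 st' jk (HAj j)); apply: eq_mean => w; rewrite AjE.
    by case: eqP => [->//|_]; rewrite mulr0 !mul0r.
  apply: (mean_eq_off_overflow t0).
  - by apply: bmeasM => //; exact: bmeas_cst.
  - by apply: bmeasM => //; exact: bt.
  - move=> w Nn; rewrite mulr0; case: eqP => e; rewrite ?mulr0//.
    by move: Nn; rewrite e leqNgt jk.
rewrite -mean_sum; last by move=> j; apply: itgM => //; exact: bt.
apply: (mean_eq_off_overflow s0).
- by apply: bmeas_sum => j; apply: bmeasM => //; exact: bt.
- by apply: bmeasM => //; exact: bmeas_indic.
move=> w Nn; have Nn' : (N s w < n.+1)%N by [].
rewrite (bigD1 (Ordinal Nn'))//= AjE eqxx mulr1 big1 ?addr0.
  rewrite indic_eq; congr (_ * (nat_of_bool _)%:R).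
  have [Nm _] := Nc w; have h := Nm _ _ s0 st'.
  by apply/eqP/eqP => [->|<-]; rewrite ?addKn ?subnKC.
move=> j jN; rewrite AjE; case: eqP => e; last by rewrite mulr0 mul0r.
by move/negP : jN; case; apply/eqP/val_inj; rewrite /= e.
Qed.

End binomial_process.

(** * Time changes between counting paths *)

Section time_changes.
Context {R : realType}.

(** Elementary time change: it alters the length of the interval from [a] to [a + b] into [c] and
    translates what follows. Exchanging [b] and [c] inverts it. *)
Definition stretch (a b c s : R) : R :=
  if s <= a then s else if s <= a + b then a + (s - a) * (c / b) else s + c - b.

Lemma stretch_lt a b c : 0 < b -> 0 < c -> {homo stretch a b c : s t / s < t}.
Proof.
move=> b0 c0 s t st; have cb : 0 < c / b by rewrite divr_gt0.
have key x : a < x -> 0 < (x - a) * (c / b) by move=> ax; rewrite mulr_gt0// subr_gt0.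
have keyb x : x <= a + b -> (x - a) * (c / b) <= c.
  by move=> xb; rewrite mulrA ler_pdivrMr// mulrC ler_wpM2l ?(ltW c0)// lerBlDl.
rewrite /stretch; have [sa|sa] := leP s a; have [ta|ta] := leP t a.
- by [].
- by have [tb|tb] := leP t (a + b); [have := key _ ta|]; lra.
- by lra.
- have [sb|sb] := leP s (a + b); have [tb|tb] := leP t (a + b).
  + by rewrite ltrD2l ltr_pM2r// ltrD2r.
  + by have := keyb _ sb; lra.
  + by lra.
  + by lra.
Qed.

Lemma stretchK a b c : 0 < b -> 0 < c -> cancel (stretch a b c) (stretch a c b).
Proof.
move=> b0 c0 s; have cb : 0 < c / b by rewrite divr_gt0.
rewrite {2}/stretch; have [sa|sa] := leP s a.
  by rewrite /stretch sa.
have [sb|sb] := leP s (a + b).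
  have h1 : 0 < (s - a) * (c / b) by rewrite mulr_gt0// subr_gt0.
  have h2 : (s - a) * (c / b) <= c.
    by rewrite mulrA ler_pdivrMr// mulrC ler_wpM2l ?(ltW c0)// lerBlDl.
  rewrite /stretch leNgt ltrDl h1/= lerD2l h2.
  by field; rewrite !lt0r_neq0.
by rewrite /stretch !ifF; [lra|apply/negbTE; rewrite -ltNge; lra|apply/negbTE; rewrite -ltNge; lra].
Qed.

Lemma stretch_time_change a b c : 0 <= a -> 0 < b -> 0 < c -> time_change (stretch a b c).
Proof.
move=> a0 b0 c0.
have ge0 a' b' c' s : 0 <= a' -> 0 < b' -> 0 < c' -> 0 <= s -> 0 <= stretch a' b' c' s.
  move=> a'0 b'0 c'0 s0; have z : stretch a' b' c' 0 = 0 by rewrite /stretch a'0.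
  move: s0; rewrite le_eqVlt => /predU1P[<-|s0]; first by rewrite z.
  by rewrite -z ltW// stretch_lt.
split; last by move=> s t _ _; exact: stretch_lt.
split.
- by move=> s; rewrite /= !in_itv/= !andbT => s0; exact: ge0.
- by move=> s t _ _ /(congr1 (stretch a c b)); rewrite !stretchK.
- move=> s; rewrite /= in_itv/= andbT => s0; exists (stretch a c b s).
    by rewrite /= in_itv/= andbT; exact: ge0.
  exact: stretchK.
Qed.

(** The polygonal time change with vertices (p i, q i) and slope 1 after the last one. The final
    clause states that it matches the vertices in order, which will carry jump times to jump
    times. *)
Lemma time_change_through (p q : nat -> R) r e : 0 < e ->
  p 0%N = 0 -> q 0%N = 0 ->
  (forall i, (i < r)%N -> p i < p i.+1) -> (forall i, (i < r)%N -> q i < q i.+1) ->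
  (forall i, (i <= r)%N -> `|p i - q i| < e) ->
  exists mu, [/\ time_change mu, forall s, 0 <= s -> `|mu s - s| < e,
    forall s, p r <= s -> mu s = q r + (s - p r) &
    forall i s, (i <= r)%N -> 0 <= s -> (p i <= s) = (q i <= mu s)].
Proof.
move=> e0 p0 q0; elim: r => [|r IH] pS qS pq.
  exists id; split.
  - exact: time_change_id.
  - by move=> s _; rewrite subrr normr0.
  - by move=> s _; rewrite p0 q0; ring.
  - by move=> i s; rewrite leqn0 => /eqP -> _; rewrite p0 q0.
have [||| mu [tc mue mur mui]] := IH.
- by move=> i ir; apply: pS; exact: ltnW.
- by move=> i ir; apply: qS; exact: ltnW.
- by move=> i ir; apply: pq; exact: leqW.
have qmono i : (i <= r)%N -> q i <= q r.
  move=> ir; rewrite -(subnKC ir); move: (subnKC ir); move: (r - i)%N => k.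
  elim: k => [|k IHk] in i ir * => e1; first by rewrite addn0.
  have ir' : (i < r)%N by rewrite -e1 addnS ltnS leq_addr.
  apply: le_trans (ltW (qS i (ltnW ir'))) _.
  by rewrite -addSnnS; apply: IHk => //; rewrite addSnnS.
have qr0 : 0 <= q r by rewrite -q0; exact: qmono.
have pr0 : 0 <= p r.
  elim: (r) pS => [|k IHk] pS'; first by rewrite p0.
  by apply: le_trans (IHk _) (ltW (pS' k _)) => // i ik; apply: pS'; exact: leqW.
set b := p r.+1 - p r; set c := q r.+1 - q r.
have b0 : 0 < b by rewrite subr_gt0 pS.
have c0 : 0 < c by rewrite subr_gt0 qS.
have b0' := ltW b0; have c0' := ltW c0.
(* Beyond [p r] the map [mu] has slope 1 and sends [p r.+1] to [q r + b]; the stretch corrects this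
   to [q r + c = q r.+1]. *)
exists (stretch (q r) b c \o mu); split.
- by apply: time_change_comp => //; exact: stretch_time_change.
- move=> s s0 /=; have := mue s s0; have := mui r s (leqnn r) s0.
  rewrite /stretch; have [ps|sp] := leP (p r) s; last first.
    by move=> /esym/negbT; rewrite -ltNge => /ltW ->.
  move=> _ _; rewrite (mur s ps).
  have pqr := pq r (leqW (leqnn r)); have pqr1 := pq r.+1 (leqnn _).
  case: ifP => [h|_].
    have -> : q r + (s - p r) - s = - (p r - q r) by ring.
    by rewrite normrN.
  have -> : (q r + (s - p r) <= q r + b) = (s - p r <= b) by rewrite lerD2l.
  case: ifP => h; last first.
    have -> : q r + (s - p r) + c - b - s = - (p r.+1 - q r.+1) by rewrite /b /c; ring.
    by rewrite normrN.
  set x := (s - p r) / b.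
  have x0 : 0 <= x by apply: divr_ge0; [rewrite subr_ge0|exact: b0'].
  have x1 : x <= 1 by rewrite ler_pdivrMr// mul1r.
  (* On the new segment the displacement is a convex combination of those at its two ends, both
     smaller than [e]. *)
  have -> : q r + (q r + (s - p r) - q r) * (c / b) - s =
      (1 - x) * - (p r - q r) + x * - (p r.+1 - q r.+1).
    by rewrite /x /c /b; field; exact: lt0r_neq0.
  clearbody x.
  apply: le_lt_trans (ler_normD _ _) _; rewrite !normrM !normrN (ger0_norm x0) ger0_norm ?subr_ge0//.
  have [->|xn1] := eqVneq x 1; first by rewrite subrr mul0r add0r mul1r.
  have x1' : 0 < 1 - x by rewrite subr_gt0 lt_neqAle xn1.
  apply: (@lt_le_trans _ _ ((1 - x) * e + x * e)); last by rewrite -mulrDl subrK mul1r.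
  by apply: ltr_leD; [rewrite ltr_pM2l|rewrite ler_wpM2l// ltW].
- move=> s ps /=; have prs : p r <= s by apply: le_trans ps; rewrite ltW// pS.
  rewrite (mur s prs) /stretch; case: ifP => h.
    have : p r < s by exact: lt_le_trans (pS r (ltnSn r)) ps.
    by move: h; rewrite gerDl subr_le0 => h; rewrite ltNge h.
  case: ifP => h'; last by rewrite /b /c; ring.
  have -> : s = p r.+1 by apply/eqP; rewrite eq_le ps andbT; move: h'; rewrite lerD2l /b lerD2r.
  by rewrite -/b /c; field; exact: lt0r_neq0.
- move=> i s; rewrite leq_eqVlt ltnS => /predU1P[->|ir] s0 /=.
    have [ps|sp] := leP (p r) s.
      rewrite (mur s ps) /stretch; case: ifP => h1.
        have se : s = p r by apply/eqP; rewrite eq_le ps andbT; move: h1; rewrite gerDl subr_le0.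
        rewrite se subrr addr0; apply/idP/idP; last first.
          by rewrite leNgt qS.
        by rewrite leNgt pS.
      rewrite lerD2l; case: ifP => h2.
        set x := q r + (s - p r) - q r; have xE : x = s - p r by rewrite /x; ring.
        rewrite -lerBlDl -/c xE mulrCA ler_pMr// ler_pdivlMr// mul1r /b lerD2r.
        by [].
      have h3 : b < s - p r by rewrite ltNge h2.
      by move: h3; rewrite /b /c => h3; apply/idP/idP => _; lra.
    have := mui r s (leqnn r) s0; rewrite leNgt sp/= => /esym/negbT; rewrite -ltNge => mq.
    rewrite /stretch (ltW mq); apply/idP/idP.
      by rewrite leNgt (lt_trans sp)// pS.
    by rewrite leNgt (lt_trans mq)// qS.
  rewrite (mui i s ir s0) /stretch; have [h|h] := leP (mu s) (q r); first by [].
  have qi := qmono i ir.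
  rewrite (le_trans qi (ltW h)); apply/esym; case: ifP => h'.
    apply: le_trans qi _; by rewrite lerDl; apply: mulr_ge0; [rewrite subr_ge0 ltW|exact: divr_ge0].
  by move/negbT: h'; rewrite -ltNge => h'; lra.
Qed.

End time_changes.

Section same_grid.
Context {R : realType}.
Implicit Types x y : R -> nat.

(** The infimum of the times at which level [c] is reached is attained, because the path is locally
    constant to the right. *)
Lemma level_time x (c : nat) v : counting_path x -> 0 <= v -> (c <= x v)%N ->
  exists p, [/\ 0 <= p, p <= v & forall s, 0 <= s -> (c <= x s)%N = (p <= s)].
Proof.
move=> xc v0 cv; have [xm _] := xc.
pose S := [set s : R | 0 <= s /\ (c <= x s)%N].
have S0 : S !=set0 by exists v.
have Sl : lbound S 0 by move=> s [].
have hS : has_inf S by split => //; exists 0.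
have p0 : 0 <= inf S by exact: lb_le_inf.
have pv : inf S <= v by apply: ge_inf => //; exists 0.
have cp : (c <= x (inf S))%N.
  have [e e0 xe] := counting_path_right xc p0.
  have [s [s0 cs] se] := inf_adherent e0 hS.
  have ps : inf S <= s by apply: ge_inf => //; exists 0.
  by rewrite -(xe s).
exists (inf S); split => // s s0; apply/idP/idP => [cs|ps].
  by apply: ge_inf => //; exists 0.
by apply: leq_trans cp _; exact: xm.
Qed.

(* Two paths with the same values on a grid fine enough to separate the jumps
   have their i-th jumps in the same grid cell, hence match up to a time change
   that moves every point by less than the mesh. *)
Lemma same_grid_time_change x y (de : R) J : 0 < de ->
  counting_path x -> counting_path y ->
  (forall j, (j <= J)%N -> x (de * j%:R) = y (de * j%:R)) ->
  (forall j, (j < J)%N -> (x (de * j.+1%:R)%R <= (x (de * j%:R)%R).+1)%N) ->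
  exists mu, [/\ time_change mu, forall s, 0 <= s -> `|mu s - s| < de &
    forall s, 0 <= s -> s + de <= de * J%:R -> y (mu s) = x s].
Proof.
move=> de0 xc yc xy x1; have [xm _] := xc; have [ym _] := yc.
pose g (j : nat) := de * j%:R.
pose z := x 0.
have g0 j : 0 <= g j by rewrite mulr_ge0// ltW.
have gm i j : (i <= j)%N -> g i <= g j by move=> ij; rewrite ler_wpM2l ?ler_nat// ltW.
set r := (x (g J) - z)%N.
have x00 : x (g 0%N) = z by rewrite /g mulr0.
have y00 : y 0 = z by rewrite -x00 xy// /g mulr0.
have xJ : (z <= x (g J))%N by apply: xm => //; exact: g0.
have cell i : (0 < i <= r)%N -> exists j, [/\ (j < J)%N, (x (g j) < z + i)%N &
    (z + i <= x (g j.+1))%N].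
  move=> /andP[i0 ir].
  have : exists j, (z + i <= x (g j))%N.
    by exists J; rewrite -leq_subRL//.
  move=> /ex_minnP[[|j] cj min]; first by move: cj; rewrite x00 leqNgt -{1}[z]addn0 ltn_add2l i0.
  exists j; split => //.
    by apply: min; rewrite -leq_subRL.
  by rewrite ltnNge; apply/negP => /min; rewrite ltnn.
have lev i : exists pq : R * R, (i = 0%N -> pq = (0, 0)) /\ ((0 < i <= r)%N ->
   exists j, [/\ (j < J)%N, (x (g j) < z + i)%N, (z + i <= x (g j.+1))%N,
     (g j < pq.1 <= g j.+1) && (g j < pq.2 <= g j.+1) &
     forall s, 0 <= s -> ((z + i <= x s)%N = (pq.1 <= s)) /\ ((z + i <= y s)%N = (pq.2 <= s))]).
  have [ir|nir] := boolP (0 < i <= r)%N; last by exists (0, 0); split.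
  have [j [jJ jl ju]] := cell i ir.
  have [p [p0 pj pE]] := level_time xc (g0 j.+1) ju.
  have ju' : (z + i <= y (g j.+1))%N by rewrite -xy.
  have [q [q0 qj qE]] := level_time yc (g0 j.+1) ju'.
  exists (p, q); split; first by move=> i0; move: ir; rewrite i0.
  move=> _; exists j; split => //=.
  - rewrite pj qj !andbT ltNge -pE// -ltnNge jl ltNge -qE// -ltnNge -xy//.
    exact: ltnW.
  - by move=> s s0; rewrite pE// qE.
have [pq hpq] := choice lev.
have [pq0 _] := hpq 0%N.
have pqS i : (i < r)%N -> (pq i).1 < (pq i.+1).1 /\ (pq i).2 < (pq i.+1).2.
  move=> ir; have [_ /(_ _)] := hpq i.+1; rewrite /= ir => /(_ isT)[j [jJ jl ju /andP[/andP[p1 p2] /andP[q1 q2]] E]].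
  case: i => [|i] in ir jl ju p1 p2 q1 q2 E *.
    by rewrite pq0//=; split; [exact: le_lt_trans p1|exact: le_lt_trans q1].
  have [_ /(_ _)] := hpq i.+1; rewrite /= (ltnW ir) => /(_ isT)[k [kJ kl ku /andP[/andP[p3 p4] /andP[q3 q4]] E']].
  (* Two consecutive levels cannot be reached in the same cell, as [x] grows by at most 1 per cell.
     This separates the level times of [y] as well. *)
  have kj : (k < j)%N.
    rewrite ltnNge; apply/negP => jk.
    have xjk : (x (g j) <= x (g k))%N by apply: xm => //; exact: gm.
    have := leq_trans ju (leq_trans (x1 j jJ) (leq_ltn_trans xjk kl)).
    by rewrite addnS ltnn.
  by split; [apply: le_lt_trans p4 (le_lt_trans (gm _ _ kj) p1)|apply: le_lt_trans q4 (le_lt_trans (gm _ _ kj) q1)].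
have [|||||mu [tc mue _ mui]] := @time_change_through R (fun i => (pq i).1) (fun i => (pq i).2) r de de0.
- by rewrite pq0.
- by rewrite pq0.
- by move=> i /pqS[].
- by move=> i /pqS[].
- move=> [|i] ir; first by rewrite pq0//= subrr normr0.
  have [_ /(_ ir)[j [_ _ _ /andP[/andP[p1 p2] /andP[q1 q2]] _]]] := hpq i.+1.
  have : g j.+1 = g j + de by rewrite /g -natr1; ring.
  by move=> e; rewrite e in p2 q2; rewrite ltr_norml; apply/andP; split; lra.
exists mu; split => // s s0; rewrite -/(g J) => sJ.
have mu0 : 0 <= mu s by exact: time_change_ge0.
have muJ : mu s <= g J.
  by have := mue s s0; rewrite ltr_norml => /andP[_ h]; lra.
(* Both values lie between [z] and [z + r], so passing the same levels makes them equal; the margin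
   [de] at the end of the grid keeps [mu s] inside it. *)
have lvl i : (i <= r)%N -> (z + i <= x s)%N = (z + i <= y (mu s))%N.
  case: i => [|i] ir; first by rewrite addn0 xm// -y00 ym.
  have [_ /(_ ir)[j [_ _ _ _ E]]] := hpq i.+1.
  by rewrite (E s s0).1 (E (mu s) mu0).2; exact: mui.
have xs0 : (z <= x s)%N by exact: xm.
have xsJ : (x s <= x (g J))%N by apply: xm => //; lra.
have ys0 : (z <= y (mu s))%N by rewrite -y00; exact: ym.
have ysJ : (y (mu s) <= x (g J))%N by rewrite xy//; exact: ym.
have h1 : (x s - z <= r)%N by rewrite leq_sub2r.
have h2 : (y (mu s) - z <= r)%N by rewrite leq_sub2r.
have := lvl _ h1; have := lvl _ h2; rewrite !subnKC// !leqnn => a b.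
by apply/eqP; rewrite eqn_leq a -b.
Qed.

End same_grid.

(** * Weak convergence of counting processes *)

(** The integrals of the positive and negative parts are suprema over simple functions below them,
    which are monotone for arbitrary functions. It will be applied to [F] along the default
    counts. *)
Lemma le_integral_any {d : measure_display} {T : measurableType d} {R : realType}
    (mu : {measure set T -> \bar R}) (f g : T -> \bar R) :
  (forall x, (f x <= g x)%E) -> (\int[mu]_x f x <= \int[mu]_x g x)%E.
Proof.
move=> fg; rewrite integralE [leRHS]integralE; apply: leeB.
  rewrite !ge0_integralTE//; apply: le_ereal_sup => _ [h hf <-]; exists h => // x.
  by apply: le_trans (hf x) _; apply: (@funepos_le _ _ setT); [move=> y _; exact: fg|rewrite inE].
rewrite !ge0_integralTE//; apply: le_ereal_sup => _ [h hf <-]; exists h => // x.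
by apply: le_trans (hf x) _; apply: (@funeneg_le _ _ setT); [move=> y _; exact: fg|rewrite inE].
Qed.

(** * Upper envelopes of a functional over grid cells *)

Section cells.
Context {R : realType}.
Implicit Types (x y : R -> nat) (c : nat -> nat).

Definition path x : skorokhod R := path_of (fun t => (x t)%:R).

Lemma path_ball x y (b e de : R) J : 0 < e -> counting_path x -> counting_path y ->
  0 < de -> de <= e -> b + de <= de * J%:R ->
  (forall j, (j <= J)%N -> x (de * j%:R) = y (de * j%:R)) ->
  (forall j, (j < J)%N -> (x (de * j.+1%:R)%R <= (x (de * j%:R)%R).+1)%N) ->
  skor_ball (path x) b e (path y).
Proof.
move=> e0 xc yc de0 dee bJ xy x1.
have [mu [tc mue yx]] := same_grid_time_change de0 xc yc xy x1.
exists mu; split => //.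
  by move=> s s0; exact: lt_le_trans (mue s s0) dee.
move=> s s0 sb; rewrite /path !path_ofE//; [|exact: xc.2|exact: yc.2|exact: time_change_ge0].
rewrite yx ?subrr ?normr0//.
by apply: le_trans bJ; rewrite lerD2r.
Qed.

Variable (F : skorokhod R -> R).

Definition cell (de : R) (J : nat) c : set (R -> nat) :=
  [set y | counting_path y /\ forall j, (j <= J)%N -> y (de * j%:R) = c j].

(** An upper envelope of [F] that depends on the grid values alone. Values taken by no counting path
    give the supremum of the empty set, which is 0. *)
Definition cell_sup (de : R) (J : nat) c : R := sup [set F (path y) | y in cell de J c].

Hypothesis (Fc : continuous F).
Variable (M : R).
Hypothesis (FM : forall z, `|F z| <= M).

Lemma cell_sup_ext de J c c' : (forall j, (j <= J)%N -> c j = c' j) ->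
  cell_sup de J c = cell_sup de J c'.
Proof.
move=> cc'; congr sup; apply/seteqP; split => _ [y [yc yg] <-]; exists y => //; split => // j jJ.
  by rewrite yg// cc'.
by rewrite yg// cc'.
Qed.

Lemma cell_sup_bound de J c : `|cell_sup de J c| <= M.
Proof.
have M0 : 0 <= M by apply: le_trans (FM (path (fun=> 0%N))).
have [E0|E0] := pselect ([set F (path y) | y in cell de J c] !=set0); last first.
  rewrite /cell_sup (_ : [set _ | _ in _] = set0) ?sup0 ?normr0//.
  by apply/seteqP; split => // z Ez; apply: E0; exists z.
have ub : ubound [set F (path y) | y in cell de J c] M.
  by move=> _ [y _ <-]; have := FM (path y); rewrite ler_norml => /andP[].
rewrite ler_norml /cell_sup ge_sup// andbT.
have [_ [y yc _]] := E0; apply: (@le_trans _ _ (F (path y))).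
  by have := FM (path y); rewrite ler_norml => /andP[].
by apply: ub_le_sup; [exists M|exists y].
Qed.

Lemma cell_sup_ge de J x : counting_path x ->
  F (path x) <= cell_sup de J (fun j => x (de * j%:R)).
Proof.
move=> xc; apply: ub_le_sup; last by exists x.
by exists M => _ [y _ <-]; have := FM (path y); rewrite ler_norml => /andP[].
Qed.

(** Used with (k+1)^2 steps, so that the grid reaches time k + 1: it becomes finer and longer at
    once. *)
Definition mesh (k : nat) : R := 1 / k.+1%:R.

Lemma mesh_gt0 k : 0 < mesh k. Proof. by rewrite divr_gt0. Qed.

Lemma cell_sup_cvg x : counting_path x ->
  (forall t, 0 < t -> \forall u \near t^'-, (x t <= (x u).+1)%N) ->
  (fun k => cell_sup (mesh k) (k.+1 * k.+1) (fun j => x (mesh k * j%:R))) @ \oo --> F (path x).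
Proof.
move=> xc xj; apply/cvgrPdist_le => ep ep0.
have Fcx : F @ path x --> F (path x) by exact: Fc.
have /cvgrPdist_le/(_ ep ep0) := Fcx.
move=> [[b e] /= e0 H].
(* An integer horizon of at least b + 1, leaving room for a displacement by one mesh; the grid
   contains it once [k.+1] is at least [B]. *)
pose B := (Num.truncn b).+2.
have bB : b + 1 <= B%:R.
  by rewrite /B -natr1 lerD2r ltW// truncnS_gt.
have [d0 d00 Hd] := unit_jump_modulus B%:R xc xj.
have /cvgrPdist_lt Hm : (fun k => mesh k) @ \oo --> (0 : R) by exact: cvg_harmonic_scale.
near=> k.
have mk0 := mesh_gt0 k.
have small z : 0 < z -> `|0 - mesh k| < z -> mesh k < z by move=> _; rewrite sub0r normrN gtr0_norm.
have mke : mesh k < e by apply: small => //; near: k; exact: Hm.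
have mkd : mesh k < d0 by apply: small => //; near: k; exact: Hm.
have mk1 : mesh k <= 1 by rewrite /mesh ler_pdivrMr// mul1r ler1n.
have kB : (B <= k.+1)%N by apply: leqW; near: k; exists B.
have mkJ : mesh k * (B * k.+1)%:R = B%:R.
  by rewrite natrM mulrCA /mesh mul1r mulVf ?mulr1// pnatr_eq0.
have jB j : (j <= B * k.+1)%N -> mesh k * j%:R <= B%:R.
  by move=> jB; rewrite -mkJ ler_wpM2l ?ler_nat// ltW.
have close y : cell (mesh k) (k.+1 * k.+1) (fun j => x (mesh k * j%:R)) y -> F (path y) <= F (path x) + ep.
  move=> [yc yg].
  have : skor_ball (path x) b e (path y).
    apply: (@path_ball x y b e (mesh k) (B * k.+1)) => //.
    - exact: ltW.
    - by rewrite mkJ; apply: le_trans bB; rewrite lerD2l.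
    - by move=> j jJ; rewrite yg//; apply: leq_trans jJ _; rewrite leq_mul2r kB orbT.
    - move=> j jJ; apply: Hd.
      + by rewrite mulr_ge0// ltW.
      + by apply: jB; exact: ltnW.
      + by rewrite ler_wpM2l ?ler_nat// ltW.
      + by rewrite -natr1 mulrDr mulr1 lerD2l ltW.
  by move=> /H /=; rewrite ler_norml => /andP[]; lra.
(* The path [x] itself belongs to the cell, so only the upper bound needs an argument. *)
rewrite distrC ger0_norm; last by rewrite subr_ge0; exact: cell_sup_ge.
rewrite lerBlDr addrC; apply: ge_sup; first by exists (F (path x)), x.
by move=> _ [y yc <-]; exact: close.
Unshelve. all: by end_near. Qed.

End cells.

(** * Functions of finitely many grid values *)

Section grid_functions.
Context {R : realType} {d : measure_display} {T : measurableType d}.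
Variable (U : R -> T -> nat).
Hypothesis mU : forall t i, 0 <= t -> measurable [set w | U t w = i].
Variables (de : R) (J : nat) (g : (nat -> nat) -> R).
Hypothesis (de0 : 0 < de).
Hypothesis gext : forall c c', (forall j, (j <= J)%N -> c j = c' j) -> g c = g c'.

Definition on_grid (c : nat -> nat) w : bool :=
  [forall j : 'I_J.+1, U (de * (j : nat)%:R) w == c j].

Definition extend B (c : {ffun 'I_J.+1 -> 'I_B.+1}) (j : nat) : nat := c (inord j).

Lemma bmeas_on_grid c : bmeas (fun w => (on_grid c w)%:R : R).
Proof.
have -> : (fun w => (on_grid c w)%:R : R) = fun w => \prod_(j < J.+1) \1_[set w | U (de * (j : nat)%:R) w = c j] w.
  apply/funext => w; rewrite /on_grid; have [/forallP h|] := boolP [forall j : 'I_J.+1, U (de * (j : nat)%:R) w == c j].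
    by rewrite big1// => j _; rewrite indicE mem_set//=; exact/eqP.
  rewrite negb_forall => /existsP[j /eqP h].
  by rewrite (bigD1 j)//= indicE memNset ?mul0r.
apply: bmeas_prod => j; apply: bmeas_indic; apply: mU.
by rewrite mulr_ge0// ltW.
Qed.

Definition grid_sum B w : R := \sum_(c : {ffun 'I_J.+1 -> 'I_B.+1}) g (extend c) * (on_grid (extend c) w)%:R.

Lemma grid_sumE B w : (forall j, (j <= J)%N -> (U (de * j%:R)%R w <= B)%N) ->
  grid_sum B w = g (fun j => U (de * j%:R) w).
Proof.
move=> UB; pose c0 : {ffun 'I_J.+1 -> 'I_B.+1} := [ffun j : 'I_J.+1 => inord (U (de * (j : nat)%:R) w)].
have c0E (j : 'I_J.+1) : c0 j = U (de * (j : nat)%:R) w :> nat.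
  by rewrite ffunE inordK// ltnS; apply: UB; rewrite -ltnS.
rewrite /grid_sum (bigD1 c0)//= big1 ?addr0.
  have -> : on_grid (extend c0) w.
    by apply/forallP => j; rewrite /extend inord_val c0E.
  rewrite mulr1; apply: gext => j jJ.
  by rewrite /extend c0E inordK.
move=> c cc0; rewrite (_ : on_grid _ _ = false) ?mulr0//.
apply/negbTE; apply: contra cc0 => /forallP h; apply/eqP/ffunP => j; apply/val_inj => /=.
by rewrite c0E; have /eqP -> := h j; rewrite /extend inord_val.
Qed.

Lemma bmeas_grid_sum B : bmeas (grid_sum B).
Proof.
by apply: bmeas_sum => c; apply: bmeasM; [exact: bmeas_cst|exact: bmeas_on_grid].
Qed.

(** [U] may be unbounded: the function is the limit of finite sums over configurations with values
    at most [B], which are constant in [B] from some point on for each [w]. *)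
Lemma bmeas_grid M : (forall c, `|g c| <= M) -> bmeas (fun w => g (fun j => U (de * j%:R) w)).
Proof.
move=> gM; split; last by exists M => w; exact: gM.
apply: (@measurable_fun_cvg _ _ R setT grid_sum).
  by move=> B; exact: (bmeas_grid_sum B).1.
move=> w _; apply: cvg_near_cst; near=> B; apply: grid_sumE => j jJ.
apply: (@leq_trans (\max_(j < J.+1) U (de * (j : nat)%:R) w)).
  exact: (@leq_bigmax _ (fun j : 'I_J.+1 => U (de * (j : nat)%:R) w) (Ordinal (n := J.+1) (m := j) jJ)).
by near: B; exists (\max_(j < J.+1) U (de * (j : nat)%:R) w).
Unshelve. all: by end_near. Qed.

End grid_functions.

Section weak_convergence.
Context {R : realType} {d d' : measure_display} {T : measurableType d} {T' : measurableType d'}.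
Variables (P : probability T R) (P' : probability T' R) (n : nat).
Variables (V : R -> R -> T -> nat) (W : R -> T' -> nat).
Hypothesis Vc : forall a w, counting_path (V a ^~ w).
Hypothesis Vn : forall a t w, (V a t w <= n)%N.
Hypothesis Vm : forall a t i, 0 < a -> 0 <= t -> measurable [set w | V a t w = i].
Hypothesis Wc : forall w, counting_path (W ^~ w).
Hypothesis Wj : forall w t, 0 < t -> \forall u \near t^'-, (W t w <= (W u w).+1)%N.
Hypothesis Wm : forall t i, 0 <= t -> measurable [set w | W t w = i].
Hypothesis Woff : forall t (f g : T' -> R), 0 <= t -> bmeas f -> bmeas g ->
  (forall w, (W t w <= n)%N -> f w = g w) -> mean P' f = mean P' g.
Hypothesis fdd : forall (de : R) J c, 0 < de -> (forall j, (c j <= n)%N) ->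
  (fun a => mean P (fun w => (on_grid (V a) de J c w)%:R)) @ +oo -->
  mean P' (fun w => (on_grid W de J c w)%:R).

(** First a grid is fixed for which the envelope has nearly the right mean under the limit law, by
    dominated convergence; then [a] tends to infinity on that grid. The majorant [G] is this
    envelope evaluated on the paths [V a]. *)
Lemma limit_cell_mean (F : skorokhod R -> R) M : continuous F -> (forall x, `|F x| <= M) ->
  itg P' (fun w => F (path (W ^~ w))) /\
  forall e, 0 < e -> \forall a \near +oo, exists2 G : T -> R, itg P G &
    (forall w, F (path (V a ^~ w)) <= G w) /\ mean P G <= mean P' (fun w => F (path (W ^~ w))) + e.
Proof.
move=> Fc FM.
pose g k c := cell_sup F (mesh k) (k.+1 * k.+1) c.
have gext k c c' : (forall j, (j <= k.+1 * k.+1)%N -> c j = c' j) -> g k c = g k c'.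
  exact: cell_sup_ext.
have gM k c : `|g k c| <= M by exact: cell_sup_bound.
have bg k : bmeas (fun w => g k (fun j => W (mesh k * j%:R) w)).
  exact: (bmeas_grid Wm (mesh_gt0 k) (@gext k) (gM k)).
have [IF cv] : P'.-integrable setT (EFin \o (fun w => F (path (W ^~ w)))) /\
    (fun k => mean P' (fun w => g k (fun j => W (mesh k * j%:R) w))) @ \oo --> mean P' (fun w => F (path (W ^~ w))).
  apply: (@dominated_Rintegral _ _ _ P' setT _ _ (fun=> M)) => //.
  - by move=> k; exact: (bg k).1.
  - by move=> w _; exact: (cell_sup_cvg Fc FM (Wc w) (@Wj w)).
  - by apply: (bmeas_itg P'); exact: bmeas_cst.
split => // e e0.
have e20 : 0 < e / 2 by rewrite divr_gt0.
have /cvgrPdist_le/(_ _ e20) [k _ /(_ k (leqnn k)) hk] := cv.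
pose J := (k.+1 * k.+1)%N.
have mk0 : (0 : R) <= mesh k by rewrite ltW// mesh_gt0.
have t0 : (0 : R) <= mesh k * J%:R by rewrite mulr_ge0.
have jt j : (j <= J)%N -> 0 <= (mesh k : R) * j%:R <= (mesh k : R) * J%:R.
  move=> jJ; apply/andP; split; first by apply: mulr_ge0.
  by apply: (ler_wpM2l mk0); rewrite ler_nat.
(* [W] stays below [n] only almost surely, so the sum over values 0 to [n] agrees with the envelope
   in mean. *)
have gsW : mean P' (grid_sum W (mesh k) J (g k) n) = mean P' (fun w => g k (fun j => W (mesh k * j%:R) w)).
  apply: (Woff t0); [exact: (bmeas_grid_sum Wm J (g k) (mesh_gt0 k) n)|exact: bg|].
  move=> w Wn; apply: (grid_sumE (@gext k)) => j jJ; apply: leq_trans Wn.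
  by have /andP[j0 jJ'] := jt j jJ; have [Wm' _] := Wc w; exact: Wm'.
have cvV : (fun a => \sum_(c : {ffun 'I_J.+1 -> 'I_n.+1}) g k (extend c) *
    mean P (fun w => (on_grid (V a) (mesh k) J (extend c) w)%:R)) @ +oo -->
    \sum_(c : {ffun 'I_J.+1 -> 'I_n.+1}) g k (extend c) *
    mean P' (fun w => (on_grid W (mesh k) J (extend c) w)%:R).
  apply: cvg_big => [|c _]; first exact: add_continuous.
  apply: cvgMr; apply: fdd; first exact: mesh_gt0.
  by move=> j; rewrite /extend -ltnS.
have sumW : \sum_(c : {ffun 'I_J.+1 -> 'I_n.+1}) g k (extend c) *
    mean P' (fun w => (on_grid W (mesh k) J (extend c) w)%:R) = mean P' (grid_sum W (mesh k) J (g k) n).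
  have bo c := bmeas_itg P' (bmeas_on_grid Wm J (mesh_gt0 k) c).
  rewrite /grid_sum mean_sum; last by move=> c; apply: itgZ; exact: bo.
  by apply: eq_bigr => c _; rewrite meanZ.
rewrite sumW gsW in cvV.
have /cvgrPdist_le/(_ _ e20) := cvV.
have apos : \forall a \near +oo, (0 : R) < a by apply: nbhs_pinfty_gt; exact: num_real.
apply: filterS2 apos => a a0 ha.
have Vm' t i : 0 <= t -> measurable [set w | V a t w = i] by exact: Vm.
exists (fun w => g k (fun j => V a (mesh k * j%:R) w)).
  by apply: bmeas_itg; exact: (bmeas_grid Vm' (mesh_gt0 k) (@gext k) (gM k)).
split; first by move=> w; exact: (cell_sup_ge FM).
have -> : mean P (fun w => g k (fun j => V a (mesh k * j%:R) w)) =
    \sum_(c : {ffun 'I_J.+1 -> 'I_n.+1}) g k (extend c) *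
    mean P (fun w => (on_grid (V a) (mesh k) J (extend c) w)%:R).
  have bo c := bmeas_itg P (bmeas_on_grid Vm' J (mesh_gt0 k) c).
  under eq_bigr => c _ do rewrite -meanZ//.
  rewrite -mean_sum; last by move=> c; apply: itgZ; exact: bo.
  apply: eq_mean => w; rewrite -[RHS]/(grid_sum (V a) (mesh k) J (g k) n w).
  by rewrite (grid_sumE (@gext k)).
move: ha hk; rewrite !ler_norml => /andP[h1 h2] /andP[h3 h4].
by rewrite [e]splitr; lra.
Qed.

(** The one-sided estimate applied to [F] and to [- F] encloses the expectation; the enclosure also
    makes it eventually finite. *)
Lemma weak_cvg_of_fdd : weak_cvg P P' (fun a t w => (V a t w)%:R) (fun t w => (W t w)%:R).
Proof.
move=> F Fc [M FM].
have [IF up] := limit_cell_mean Fc FM.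
have NFc : continuous (fun z => - F z) by move=> z; exact: (cvgN (Fc z)).
have NFM z : `|- F z| <= M by rewrite normrN.
have [_ lo] := limit_cell_mean NFc NFM.
rewrite unlock mean_EFin//.
set m' := mean P' _ in up *.
have mN : mean P' (fun w => - F (path (W ^~ w))) = - m'.
  by rewrite -[RHS]mulN1r -meanZ//; apply: eq_mean => w; rewrite mulN1r.
have bnd e : 0 < e -> \forall a \near +oo, ((m' - e)%:E <= \int[P]_w (F (path (V a ^~ w)))%:E <= (m' + e)%:E)%E.
  move=> e0; apply: filterS2 (up e e0) (lo e e0) => a [G IG [FG mG]] [H IH [FH mH]].
  apply/andP; split.
    apply: (@le_trans _ _ (\int[P]_w (- H w)%:E)%E).
      rewrite mean_EFin; last exact: itgN.
      rewrite lee_fin (_ : mean P (fun w => - H w) = - mean P H).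
        by rewrite mN in mH; lra.
      by rewrite -[RHS]mulN1r -meanZ//; apply: eq_mean => w; rewrite mulN1r.
    by apply: le_integral_any => w; rewrite lee_fin lerNl; exact: FH.
  apply: (@le_trans _ _ (\int[P]_w (G w)%:E)%E).
    by apply: le_integral_any => w; rewrite lee_fin; exact: FG.
  by rewrite mean_EFin// lee_fin.
apply/fine_cvgP; split.
  apply: filterS (bnd 1 ltr01) => a /andP[h1 h2].
  rewrite fin_numE; apply/andP; split; apply/eqP => h; first by move: h1; rewrite h leeNy_eq.
  by move: h2; rewrite h leye_eq.
apply/cvgrPdist_le => e e0; apply: filterS (bnd e e0) => a /=.
case: (\int[P]_w _)%E => [x||] /=; rewrite ?leeNy_eq ?leye_eq ?andbF// !lee_fin => /andP[h1 h2].
by rewrite ler_norml; apply/andP; split; lra.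
Qed.

End weak_convergence.

Section grid_events.
Context {R : realType} {d : measure_display} {T : measurableType d}.
Variables (U : R -> T -> nat) (de : R) (c : nat -> nat).

Lemma on_grid0 w : on_grid U de 0 c w = (U 0 w == c 0%N).
Proof.
rewrite /on_grid; apply/forallP/idP => [/(_ ord0)|h j]; first by rewrite mulr0.
by rewrite (ord1 j) mulr0.
Qed.

Lemma on_gridS J w :
  on_grid U de J.+1 c w = on_grid U de J c w && (U (de * J.+1%:R) w == c J.+1).
Proof.
rewrite /on_grid; apply/forallP/andP => [h|[/forallP h1 h2] j].
  split; last exact: (h ord_max).
  by apply/forallP => j; have := h (widen_ord (leqnSn _) j).
have [jJ|] := ltnP j J.+1; first exact: (h1 (Ordinal jJ)).
by move=> Jj; have -> : (j : nat) = J.+1 by apply/eqP; rewrite eqn_leq Jj -ltnS ltn_ord.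
Qed.

Lemma gen_on_grid (G : set_system T) J :
  (forall j, (j <= J)%N -> <<s G >> [set w | U (de * j%:R) w = c j]) ->
  <<s G >> [set w | on_grid U de J c w].
Proof.
elim: J => [|J IH] h.
  rewrite (_ : [set _ | _] = [set w | U (de * 0%:R) w = c 0%N]); first exact: h.
  by apply/seteqP; split => w; rewrite /= on_grid0 mulr0 => /eqP.
rewrite (_ : [set _ | _] = [set w | on_grid U de J c w] `&` [set w | U (de * J.+1%:R) w = c J.+1]).
  apply: gen_setI; last exact: h.
  by apply: IH => j jJ; apply: h; exact: leqW.
apply/seteqP; split => w; rewrite /= on_gridS; first by move=> /andP[-> /eqP].
by move=> [-> /eqP].
Qed.

Lemma on_grid_indic J w : (on_grid U de J c w)%:R = \1_[set w | on_grid U de J c w] w :> R.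
Proof. by rewrite indic_bool. Qed.

Lemma on_gridS_indic J w : (on_grid U de J.+1 c w)%:R =
  \1_[set w | on_grid U de J c w] w * (U (de * J.+1%:R) w == c J.+1)%:R :> R.
Proof. by rewrite -on_grid_indic on_gridS -natrM mulnb. Qed.

Lemma on_grid_fun J (f : nat -> R) w :
  \1_[set w | on_grid U de J c w] w * f (U (de * J%:R) w) =
  f (c J) * \1_[set w | on_grid U de J c w] w.
Proof.
rewrite -on_grid_indic; case: (boolP (on_grid U de J c w)) => h; last by rewrite mulr0 mul0r.
suff -> : U (de * J%:R) w = c J by rewrite mulrC.
by move/forallP : h => /(_ ord_max)/eqP.
Qed.

End grid_events.

(** * Convergence of the default counts *)

Section count_convergence.
Context {R : realType} {m n : nat} {d d' : measure_display}
  {T : measurableType d} {T' : measurableType d'}.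
Variables (P : probability T R) (P' : probability T' R) (Q : 'M[R]_m) (lam pi : 'cV[R]_m).
Hypothesis hQ : transition_matrix Q.
Hypothesis hirr : irreducible Q.
Hypothesis hpi : invariant_probability Q pi.
Hypothesis lam0 : forall k, 0 <= lam k 0.
Variables (X : R -> T -> 'cV[R]_m) (hX : markov_chain P Q X).
Variable (tau : R -> 'I_n -> T -> \bar R).
Hypothesis htau : forall a : R, 0 < a -> default_times P lam X a (tau a).
Variables (N : R -> T' -> nat) (hN : counting_process (R := R) N).
Hypothesis hint : binomial_intensity P' n ((lam^T *m pi) 0 0) N.

Local Notation linf := ((lam^T *m pi) 0 0).
Local Notation Na a := (default_count (tau a)).
Local Notation Fa a s := (default_filtration X a (tau a) s).

Let linf0 : 0 <= linf.
Proof.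
have [pi0 _ _] := hpi; rewrite linfE; apply: sumr_ge0 => k _.
by rewrite mulr_ge0.
Qed.

Lemma default_count_path a w : counting_path (R := R) (Na a ^~ w).
Proof.
split; last exact: default_count_cadlag.
move=> s t _ st; apply: leq_sum => k _.
have : ((tau a k w <= s%:E) ==> (tau a k w <= t%:E))%E.
  by apply/implyP => /le_trans; apply; rewrite lee_fin.
by case: (_ <= s%:E)%E => //= ->.
Qed.

Lemma gen_default_count a u s i : 0 <= u -> u <= s ->
  <<s Fa a s >> [set w | Na a u w = i].
Proof.
move=> u0 us.
rewrite (_ : [set _ | _] = [set w | (Na a u w)%:R = i%:R :> R]).
  exact: (gen_eq1 i%:R (gbmeas_count X a (tau a) u0 us).1).
by apply/seteqP; split => w /=; [move=> ->|move/eqP; rewrite eqr_nat => /eqP].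
Qed.

Lemma measurable_default_count a t i : 0 < a -> 0 <= t -> measurable [set w | Na a t w = i].
Proof.
move=> a0 t0; apply: (Fa_measurable hX a0 (htau a0) t0).
exact: gen_default_count.
Qed.

(** A default time may be at most 0 on a null set; the survival probability at time 0 is 1, since
    the hazard over a point vanishes. *)
Lemma mean_default_at0 a : 0 < a -> mean P (fun w => (Na a 0 w)%:R) = 0.
Proof.
move=> a0; have ht := htau a0.
have FXm : <<s chain_events X `[0, +oo[ >> `<=` measurable := FX_measurable hX.
have b k : bmeas (\1_[set w | (0%:E < tau a k w)%E] : T -> R).
  by apply: bmeas_indic; exact: (measurable_tau_gt ht).
have E w : (Na a 0 w)%:R = \sum_(k < n) (1 - \1_[set w | (0%:E < tau a k w)%E] w) :> R.
  rewrite /default_count natr_sum; apply: eq_bigr => k _; rewrite indicE.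
  have [h|h] := leP (tau a k w) 0%:E.
    by rewrite memNset ?subr0//= => h'; move: (lt_le_trans h' h); rewrite ltxx.
  by rewrite mem_set ?subrr.
under eq_mean do rewrite E.
rewrite mean_sum; last first.
  by move=> k; apply: itgB; apply: bmeas_itg => //; exact: bmeas_cst.
rewrite big1// => k _; rewrite meanB ?mean_cst; last 2 first.
- exact: itg_cst.
- exact: bmeas_itg.
rewrite -[X in X - _](mean_cst P 1); apply/eqP; rewrite subr_eq0; apply/eqP.
transitivity (mean P (fun w => \1_setT w * expR (- hazard lam X a 0 0 w))).
  by apply: eq_mean => w; rewrite hazard_refl oppr0 expR0 mulr1 indicT.
have := cond_exp_mean FXm (default_survival ht k (lexx 0)) (@gen_setT _ _ _) => /= ->.
by apply: eq_mean => w; rewrite indicT mul1r.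
Qed.

(** Induction along the grid: one more grid point multiplies the probability by [g], exactly for [N]
    and, by [count_estimate] on the event of the earlier grid values, up to a vanishing error for
    the default counts. *)
Lemma cvg_mean_on_grid (de : R) J c : 0 < de -> (forall j, (c j <= n)%N) ->
  (fun a => mean P (fun w => (on_grid (fun t w => Na a t w) de J c w)%:R)) @ +oo -->
  mean P' (fun w => (on_grid N de J c w)%:R).
Proof.
move=> de0 cn; have pos : \forall a \near +oo, (0 : R) < a by apply: nbhs_pinfty_gt; exact: num_real.
have ge0 j : 0 <= de * j%:R by rewrite mulr_ge0// ltW.
have le_grid i j : (i <= j)%N -> de * i%:R <= de * j%:R by move=> ij; rewrite ler_wpM2l ?ler_nat// ltW.
have b a i t : 0 < a -> 0 <= t -> bmeas (fun w => (Na a t w == i)%:R : R).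
  move=> a0 t0; apply: (gbmeas_bmeas (Fa_measurable hX a0 (htau a0) t0)).
  exact: (gbmeas_fun_count X a (tau a) (fun j => (j == i)%:R) t0 (lexx t)).
elim: J => [|J IH].
  apply: cvg_near_cst; apply: filterS pos => a a0.
  under [RHS]eq_mean do rewrite on_grid0 (counting0 hN).
  rewrite mean_cst -(mean_cst P (0 == c 0)%:R).
  under eq_mean do rewrite on_grid0.
  apply/eqP; rewrite -subr_eq0 -normr_le0 -meanB; last 2 first.
  - by apply: bmeas_itg; exact: b.
  - exact: itg_cst.
  have bB : bmeas (fun w => (Na a 0 w == c 0)%:R - (0 == c 0)%:R : R).
    by apply: bmeasB; [exact: b|exact: bmeas_cst].
  apply: le_trans (mean_norm (bmeas_itg P bB)) _.
  rewrite -[leRHS](mean_default_at0 a0); apply: mean_le.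
  - by apply: itg_abs; exact: bmeas_itg.
  - apply: bmeas_itg; apply: (gbmeas_bmeas (Fa_measurable hX a0 (htau a0) (lexx 0))).
    exact: gbmeas_count.
  (* The two indicators differ only where the count at time 0 is at least 1, so their distance is at
     most this count, whose mean is 0. *)
  - move=> w; case: (Na a 0 w) => [|j]; first by rewrite subrr normr0.
    by apply: (@le_trans _ _ 1); [case: eqP; case: eqP => //= _ _; rewrite ?subr0 ?sub0r ?subrr ?normrN ?normr1 ?normr0|rewrite ler1n].
pose g : R := gtrans n linf (c J.+1) (c J) de.
have step : de * J%:R < de * J.+1%:R by rewrite ltr_pM2l// ltr_nat.
have diff : de * J.+1%:R - de * J%:R = de by rewrite -natr1; ring.
have -> : mean P' (fun w => (on_grid N de J.+1 c w)%:R) = g * mean P' (fun w => (on_grid N de J c w)%:R).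
  under eq_mean do rewrite on_gridS_indic.
  rewrite (count_law linf0 hN hint (ge0 J) (ltW step) (cn J.+1)); last first.
    apply: gen_on_grid => j jJ. exact: (gen_N (c j) (ge0 j) (le_grid _ _ jJ)).
  under eq_mean do rewrite diff (on_grid_fun N de c J (fun i => gtrans n linf (c J.+1) i de)).
  rewrite -meanZ; first by apply: eq_mean => w; rewrite on_grid_indic.
  apply: bmeas_itg; apply: (bmeas_on_grid _ J de0 c) => t i t0.
  by exact: (F_measurable hN (gen_N i t0 (lexx t))).
pose p J a := mean P (fun w => (on_grid (fun t w => Na a t w) de J c w)%:R).
suff diff0 : (fun a => p J.+1 a - g * p J a) @ +oo --> (0 : R).
  have H : (fun a => p J.+1 a - g * p J a + g * p J a) @ +oo -->
      0 + g * mean P' (fun w => (on_grid N de J c w)%:R).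
    by apply: cvgD => //; exact: cvgMr.
  have e : (fun a => p J.+1 a - g * p J a + g * p J a) = p J.+1.
    by apply/funext => a; rewrite subrK.
  by rewrite add0r e in H.
apply/cvgrPdist_le => e e0.
have [a1 a10 H] := count_estimate hQ hirr hpi lam0 hX htau (ge0 J) step (cn J.+1) e0.
apply: filterS (near_pinfty_ge a1) => a aa1; have a0 := lt_le_trans a10 aa1.
rewrite sub0r normrN /p.
have GA : <<s Fa a (de * J%:R) >> [set w | on_grid (fun t w => Na a t w) de J c w].
  by apply: gen_on_grid => j jJ; apply: gen_default_count => //; exact: le_grid.
have mG : bmeas (fun w => (on_grid (fun t w => Na a t w) de J c w)%:R : R).
  by apply: bmeas_on_grid => // t i t0; exact: measurable_default_count.
have mS : bmeas (fun w => (on_grid (fun t w => Na a t w) de J.+1 c w)%:R : R).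
  by apply: bmeas_on_grid => // t i t0; exact: measurable_default_count.
apply: le_trans (_ : e * mean P (\1_[set w | on_grid (fun t w => Na a t w) de J c w]) <= e).
  apply: le_trans (H a aa1 _ GA); rewrite -(meanZ g (bmeas_itg P mG)) -meanB; last 2 first.
  - exact: bmeas_itg.
  - by apply: itgZ; exact: bmeas_itg.
  apply: eq_to_le; congr (`|_|); apply: eq_mean => w.
  rewrite mulrBr diff (on_grid_fun (fun t w => Na a t w) de c J (fun i => gtrans n linf (c J.+1) i de)).
  by rewrite on_gridS_indic on_grid_indic.
rewrite ler_piMr ?(ltW e0)// -(mean_cst P 1); apply: mean_le.
- by apply: bmeas_itg; move: mG; congr bmeas; apply/funext => w; rewrite on_grid_indic.
- exact: itg_cst.
- by move=> w; rewrite indicE; case: (_ \in _).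
Qed.

Theorem count_weak_cvg :
  weak_cvg P P' (fun a t w => (Na a t w)%:R) (fun t w => (N t w)%:R).
Proof.
apply: (@weak_cvg_of_fdd _ _ _ _ _ P P' n (fun a t w => Na a t w) N).
- exact: default_count_path.
- by move=> a t w; exact: default_count_le.
- exact: measurable_default_count.
- by move=> w; split; [exact: (counting_nondecreasing hN)|exact: (counting_cadlag hN)].
- exact: (counting_unit_jumps hN).
- move=> t i t0; exact: (F_measurable hN (gen_N i t0 (lexx t))).
- exact: (mean_eq_off_overflow linf0 hN hint).
- exact: cvg_mean_on_grid.
Qed.

End count_convergence.

Theorem corollary5p6 (R : realType) (m n : nat)
  (Q : 'M[R]_m) (lam pi : 'cV[R]_m)
  (hQ : transition_matrix Q) (hirr : irreducible Q)
  (hpi : invariant_probability Q pi) (hlam : forall k, 0 <= lam k 0)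
  (d : measure_display) (T : measurableType d) (P : probability T R)
  (X : R -> T -> 'cV[R]_m) (hX : markov_chain P Q X)
  (tau : R -> 'I_n -> T -> \bar R)
  (htau : forall a : R, 0 < a -> default_times P lam X a (tau a))
  (d' : measure_display) (T' : measurableType d') (P' : probability T' R)
  (N : R -> T' -> nat) (hN : counting_process (R := R) N)
  (hint : binomial_intensity P' n ((lam^T *m pi) 0 0) N) :
  let linf : R := (lam^T *m pi) 0 0 in
  let Na (a : R) := default_count (tau a) in
  let Fa (a : R) := default_filtration X a (tau a) in
  [/\ (* a *)
      forall (s t : R) (i : nat), 0 <= s -> s < t -> (i <= n)%N ->
        forall zeta : R -> T -> 'cV[R]_m,
          (forall (a : R) (k : 'I_m), 0 < a ->
             is_cond_exp P (Fa a s)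
               (fun w => \1_[set w | Na a t w = i] w * speed_up X a t w k 0)
               (fun w => zeta a w k 0)) ->
          Lnorm P +oo%E (fun w =>
             (`|zeta a w - gtrans n linf i (Na a s w) (t - s) *: pi|%R)%:E)%E
            @[a --> +oo] --> 0%E,
      (* b *)
      (forall (s t : R) (i : nat), 0 <= s -> s < t -> (i <= n)%N ->
        forall p : R -> T -> R,
          (forall a : R, 0 < a ->
             is_cond_prob P (Fa a s) [set w | Na a t w = i] (p a)) ->
          Lnorm P +oo%E (fun w =>
             (p a w - gtrans n linf i (Na a s w) (t - s))%:E)%E
            @[a --> +oo] --> 0%E) /\
      (forall (s t : R) (k : nat), 0 <= s -> s < t ->
        is_cond_prob P' (count_filtration N s)
          [set w | (N t w - N s w)%N = k]
          (fun w => binomial_pmf (n - N s w) (1 - expR (- linf * (t - s))) k))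
    & (* c *)
      weak_cvg P P' (fun a t w => (Na a t w)%:R) (fun t w => (N t w)%:R)].
Proof.
have [pi0 _ _] := hpi.
have linf0 : 0 <= (lam^T *m pi) 0 0.
  by rewrite linfE; apply: sumr_ge0 => k _; rewrite mulr_ge0.
move=> linf Na Fa; split.
- move=> s t i s0 st ni zeta.
  exact: (conditional_law_and_state hQ hirr hpi hlam hX htau s0 st ni).
- split=> [s t i s0 st ni p|s t k s0 st].
    exact: (conditional_law hQ hirr hpi hlam hX htau s0 st ni).
  exact: (increment_law linf0 hN hint k s0 st).
- exact: (count_weak_cvg hQ hirr hpi hlam hX htau hN hint).
Qed.
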